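(* Let $d\geq 0$ be an integer, let $A_0$ be a locally compact Abelian group containing a compact open subgroup, and let $A=\mathbb{R}^d\times A_0$. Let $f_1,g_1$ be a matched Gaussian pair on $\mathbb{R}^d$ and let $f_2,g_2$ be a matched pair of subcharacters of second degree on $A_0$. Then, for the functions $f:=f_1\otimes f_2$ and $g:=g_1\otimes g_2$ on $A$, equality occurs, for every $p\in[1,\infty)$, in Lieb's uncertainty inequalities $$\|V_gf\|_{L^p(A\times\widehat{A})}\leq\Big(\frac{2}{p}\Big)^{d/p}\|f\|_{L^2(A)}\|g\|_{L^2(A)}\quad(2\leq p<\infty),\qquad \|V_gf\|_{L^p(A\times\widehat{A})}\geq\Big(\frac{2}{p}\Big)^{d/p}\|f\|_{L^2(A)}\|g\|_{L^2(A)}\quad(1\leq p\leq 2);$$ that is, $\|V_gf\|_{L^p(A\times\widehat{A})}=(2/p)^{d/p}\|f\|_{L^2(A)}\|g\|_{L^2(A)}$ for every $p\in[1,\infty)$.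
   Context: Groups are written additively, and $\langle x,\xi\rangle\in\mathbb{T}$ (the complex numbers of modulus $1$) denotes the duality pairing of $x\in A$ with $\xi\in\widehat{A}$ (the dual group). The Haar measures on an LCA group and on its dual are normalized so that the Plancherel formula holds, and $A\times\widehat{A}$ carries the product measure. Time-frequency shifts on $L^2(A)$: $\pi(x,\xi)f(y)=\langle y,\xi\rangle f(y-x)$. Short-time Fourier transform: for $f,g\in L^2(A)$, $V_gf(x,\xi)=\langle f,\pi(x,\xi)g\rangle_{L^2(A)}=\int_A\overline{\langle y,\xi\rangle}f(y)\overline{g(y-x)}\,dy$. Tensor product: $(f_1\otimes f_2)(x_1,x_2)=f_1(x_1)f_2(x_2)$. A function $f$ on $\mathbb{R}^d$ is a Gaussian if $f(x)=\exp(-\alpha x\cdot x+i\beta x\cdot x+\gamma\cdot x+\delta)$ where $\alpha$ is a real symmetric positive definite $d\times d$ matrix, $\beta$ is a real symmetric $d\times d$ matrix, $\gamma\in\mathbb{C}^d$ and $\delta\in\mathbb{C}$. Two functions $f,g$ form a matched Gaussian pair if both are Gaussians with the same $\alpha$ and the same $\beta$, but possibly different $\gamma$'s and $\delta$'s. For an LCA group $B$, a continuous homomorphism $\phi:B\to\widehat{B}$ is symmetric if $\langle x,\phi(y)\rangle=\langle y,\phi(x)\rangle$ for all $x,y\in B$; a character of second degree of $B$ associated to such a $\phi$ is a continuous function $f:B\to\mathbb{T}$ with $f(x+y)=f(x)f(y)\langle x,\phi(y)\rangle$ for all $x,y\in B$. A subcharacter of second degree of $B$ is a function $h:B\to\mathbb{C}$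 for which there are a compact open subgroup $H\subset B$ and a continuous symmetric homomorphism $\phi:H\to\widehat{H}$ such that $h|_H$ is a character of second degree of $H$ associated to $\phi$, and $h(x)=0$ for $x\in B\setminus H$. A pair $f,g$ of functions on $B$ is a matched pair of subcharacters of second degree if $f=c_1\pi(z_1)h$ and $g=c_2\pi(z_2)h$ for some $c_1,c_2\in\mathbb{C}\setminus\{0\}$, $z_1,z_2\in B\times\widehat{B}$ and some subcharacter $h$ of second degree of $B$. *)

(* Defs.v *)
From HB Require Import structures.
From mathcomp Require Import all_boot all_order all_algebra complex.
From mathcomp Require Import all_classical all_reals all_analysis.

Set Implicit Arguments.
Unset Strict Implicit.
Unset Printing Implicit Defensive.

Import Order.TTheory GRing.Theory Num.Theory.
Import numFieldNormedType.Exports.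

Local Open Scope classical_set_scope.
Local Open Scope ring_scope.
Local Open Scope complex_scope.

HB.instance Definition _ (R : rcfType) := PseudoPointedMetric.copy R[i] R[i]^o.
HB.instance Definition _ (R : rcfType) := NormedModule.copy R[i] R[i]^o.

Lemma conjc_continuous (R : rcfType) : continuous (fun z : R[i] => z^*).
Proof.
move=> z U /nbhs_ballP[e /= e0 zeU]; apply/nbhs_ballP; exists e => //= w zew.
by apply: zeU; move: zew; rewrite -!ball_normE /= -rmorphB normcJ.
Qed.

(* The library makes [A * B] a topological group only when [A] and [B] are
   topological vector spaces over a common field, hence this alias. *)
Definition prodg (A B : Type) : Type := (A * B)%type.

Section prodg_topological_group.
Context (A B : topologicalZmodType).

HB.instance Definition _ := Topological.copy (prodg A B) (A * B)%type.
HB.instance Definition _ := GRing.Zmodule.copy (prodg A B) (A * B)%type.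

Lemma prodg_sub_continuous :
  continuous (fun x : prodg A B * prodg A B => x.1 - x.2).
Proof.
move=> [/= x1 x2] /= U /= [] [V W] /= [nV nW] nU.
have [/= V0 [V01 V02] nV1] := @sub_continuous A (x1.1, x2.1) _ nV.
have [/= W0 [W01 W02] nW1] := @sub_continuous B (x1.2, x2.2) _ nW.
exists ([set x | V0.1 x.1 /\ W0.1 x.2], [set x | V0.2 x.1 /\ W0.2 x.2]).
  by split; [exists (V0.1, W0.1)|exists (V0.2, W0.2)].
move=> [[a1 b1] [a2 b2]] /= [] [] Va1 Wb1 [] Va2 Wb2.
by apply: nU; split; [exact: (nV1 (a1, a2))|exact: (nW1 (b1, b2))].
Qed.

HB.instance Definition _ :=
  PreTopologicalNmodule_isTopologicalZmodule.Build (prodg A B)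
    prodg_sub_continuous.

End prodg_topological_group.

Definition subgroup (B : topologicalZmodType) (H : zmodClosed B) : Type :=
  {x : B | x \in H}.

Section subgroup_topological_group.
Context (B : topologicalZmodType) (H : zmodClosed B).

HB.instance Definition _ := SubChoice.on (subgroup H).
HB.instance Definition _ := [SubChoice_isSubZmodule of subgroup H by <:].
HB.instance Definition _ := Topological.copy (subgroup H)
  (initial_topology (val : subgroup H -> B)).

Lemma subgroup_sub_continuous :
  continuous (fun x : subgroup H * subgroup H => x.1 - x.2).
Proof.
apply: continuous_comp_initial => -[x y].
apply: (@continuous_comp (subgroup H * subgroup H)%type (B * B)%type B
  (fun z => (val z.1, val z.2)) (fun z => z.1 - z.2)); last first.
  exact: sub_continuous.
apply: cvg_pair.
- apply: (@continuous_comp _ _ _ fst (val : subgroup H -> B)).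
    exact: cvg_fst.
  exact: initial_continuous.
- apply: (@continuous_comp _ _ _ snd (val : subgroup H -> B)).
    exact: cvg_snd.
  exact: initial_continuous.
Qed.

HB.instance Definition _ :=
  PreTopologicalNmodule_isTopologicalZmodule.Build (subgroup H)
    subgroup_sub_continuous.

End subgroup_topological_group.

Section dual_group.
Context (R : realType) (A : topologicalZmodType).

Definition is_character (chi : A -> R[i]) : Prop :=
  [/\ continuous chi, forall x, `|chi x| = 1
    & forall x y, chi (x + y) = chi x * chi y].

(* The dual group, written additively like every group here: [chi + eta] is the
   pointwise product of characters, and [<x, chi>] is [chi x]. *)
Record dual := Dual { dual_fun :> A -> R[i] ; dualP : is_character dual_fun }.

HB.instance Definition _ := gen_eqMixin dual.
HB.instance Definition _ := gen_choiceMixin dual.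

Lemma dual_ext (chi eta : dual) : chi =1 eta -> chi = eta.
Proof.
case: chi eta => [f Pf] [g Pg] /= /funext fg; subst g.
by rewrite (Prop_irrelevance Pf Pg).
Qed.

Lemma is_character0 : is_character (fun=> 1).
Proof.
by split=> [x|x|x y]; [exact: cvg_cst|rewrite normr1|rewrite mulr1].
Qed.

Lemma is_characterD (chi eta : dual) :
  is_character (fun x => chi x * eta x).
Proof.
case: chi eta => f [cf nf mf] [g [cg ng mg]] /=; split=> [x|x|x y].
- exact: cvgM (cf x) (cg x).
- by rewrite normrM nf ng mulr1.
- by rewrite mf mg mulrACA.
Qed.

Lemma is_characterN (chi : dual) : is_character (fun x => (chi x)^*).
Proof.
case: chi => f [cf nf mf] /=; split=> [x|x|x y].
- apply: (@continuous_comp _ _ _ f); [exact: cf|exact: conjc_continuous].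
- by rewrite normcJ.
- by rewrite mf rmorphM.
Qed.

Lemma dual_addrA : associative (fun chi eta => Dual (is_characterD chi eta)).
Proof. by move=> f g h; apply: dual_ext => x /=; rewrite mulrA. Qed.

Lemma dual_addrC : commutative (fun chi eta => Dual (is_characterD chi eta)).
Proof. by move=> f g; apply: dual_ext => x /=; rewrite mulrC. Qed.

Lemma dual_add0r : left_id (Dual is_character0)
  (fun chi eta => Dual (is_characterD chi eta)).
Proof. by move=> f; apply: dual_ext => x /=; rewrite mul1r. Qed.

Lemma dual_addNr : left_inverse (Dual is_character0)
  (fun chi => Dual (is_characterN chi))
  (fun chi eta => Dual (is_characterD chi eta)).
Proof.
move=> f; apply: dual_ext => x /=.
by case: f => f [cf nf mf] /=; rewrite mulrC -sqr_normc nf expr1n.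
Qed.

HB.instance Definition _ :=
  GRing.isZmodule.Build dual dual_addrA dual_addrC dual_add0r dual_addNr.

HB.instance Definition _ := Topological.copy dual
  (initial_topology (fun chi : dual => (dual_fun chi : {compact-open, A -> R[i]}))).

Lemma dual_nbhs_uniform (K : set A) (chi : dual) (e : R[i]) :
  compact K -> 0 < e ->
  nbhs chi [set eta : dual | forall y, K y -> `|chi y - eta y| < e].
Proof.
move=> cK e0.
pose F := fmap dual_fun (nbhs chi).
have FF : Filter F.
  by apply: (@fmap_filter _ _ dual_fun (nbhs chi)); exact: nbhs_filter.
have [cchi _ _] := dualP chi.
have /fam_cvgP /(_ K cK) FK : {family compact, F --> dual_fun chi}.
  apply/compact_open_fam_compactP => //.
  exact: (@initial_continuous dual {compact-open, A -> R[i]} dual_fun chi).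
apply: (FK [set f | forall y, K y -> `|chi y - f y| < e]).
apply/uniform_nbhs; exists [set z | `|z.1 - z.2| < e]; split=> //.
by rewrite -entourage_ballE; exists e => //= -[u v]; rewrite -ball_normE.
Qed.

Lemma dual_sub_continuous :
  continuous (fun x : dual * dual => x.1 - x.2).
Proof.
apply: continuous_comp_initial => -[chi eta] /=.
apply/compact_open_fam_compactP.
  by have [] := dualP (chi - eta).
apply/fam_cvgP => K cK U /uniform_nbhs[E [entE EU]].
move: entE; rewrite -entourage_ballE => -[e /= e0 eE].
have e20 : 0 < e / 2 by rewrite divr_gt0.
exists ([set x : dual | forall y, K y -> `|chi y - x y| < e / 2],
        [set x : dual | forall y, K y -> `|eta y - x y| < e / 2]).
  by split; exact: dual_nbhs_uniform.
move=> [x1 x2] /= [x1P x2P]; apply: EU => y Ky; apply: eE => /=.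
rewrite -ball_normE /=.
have -> : chi y * (eta y)^* - x1 y * (x2 y)^* =
    (chi y - x1 y) * (eta y)^* + x1 y * (eta y - x2 y)^*.
  by rewrite rmorphB mulrBl mulrBr addrA subrK.
have [_ neta _] := dualP eta; have [_ nx1 _] := dualP x1.
rewrite (le_lt_trans (ler_normD _ _))// !normrM !normcJ neta nx1 mulr1 mul1r.
by rewrite [ltRHS]splitr ltrD// ?x1P ?x2P.
Qed.

HB.instance Definition _ :=
  PreTopologicalNmodule_isTopologicalZmodule.Build dual dual_sub_continuous.

End dual_group.


Definition lca (A : topologicalZmodType) : Prop :=
  hausdorff_space A /\ locally_compact [set: A].

Definition borel (A : topologicalZmodType) : Type := A.

HB.instance Definition _ (A : topologicalZmodType) := Choice.on (borel A).
HB.instance Definition _ (A : topologicalZmodType) := isPointed.Build (borel A) 0.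
HB.instance Definition _ (A : topologicalZmodType) :=
  Measurable.copy (borel A)
    (g_sigma_algebraType (@open A : set (set (borel A)))).

(* Haar measures need not be sigma-finite, hence the Radon regularity: outer
   regular on Borel sets and inner regular on open sets. *)
Definition is_haar (R : realType) (A : topologicalZmodType)
    (mu : {measure set (borel A) -> \bar R}) : Prop :=
  [/\ mu setT != 0%E,
      forall (x : A) (E : set (borel A)), measurable E ->
        mu [set x + y | y in (E : set A)] = mu E,
      forall K : set A, compact K -> (mu K < +oo)%E,
      forall E : set (borel A), measurable E ->
        mu E = ereal_inf [set mu U | U in [set U : set A | open U /\ E `<=` U]]
    & forall U : set A, open U ->
        mu U = ereal_sup [set mu K | K in [set K : set A | compact K /\ K `<=` U]]].

(* The product measure on [A * B], as a Borel measure: without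
   sigma-finiteness the library's product measure is not available, and the
   Borel sets of [A * B] may exceed the product sigma-algebra.  The condition
   on compact rectangles fixes the normalization of the Haar measure [lam]. *)
Definition is_product_haar (R : realType) (A B : topologicalZmodType)
    (mu : {measure set (borel A) -> \bar R})
    (nu : {measure set (borel B) -> \bar R})
    (lam : {measure set (borel (prodg A B)) -> \bar R}) : Prop :=
  is_haar lam /\
  forall (K : set A) (L : set B), compact K -> compact L ->
    lam (K `*` L) = (mu K * nu L)%E.

Section complex_integration.
Context (R : realType) (A : topologicalZmodType).
Implicit Types (mu : {measure set (borel A) -> \bar R}) (f g : A -> R[i]).

Definition cmeasurable f : Prop :=
  measurable_fun [set: borel A] (fun x : borel A => complex.Re (f x)) /\
  measurable_fun [set: borel A] (fun x : borel A => complex.Im (f x)).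

Definition cintegral mu f : R[i] :=
  (\int[mu]_x complex.Re (f x)) +i* (\int[mu]_x complex.Im (f x)).

Definition cLnorm mu (p : R) f : \bar R :=
  Lnorm mu p%:E (fun x => (Normc.normc (f x))%:E).

Definition inner mu f g : R[i] := cintegral mu (fun y => f y * (g y)^*).

End complex_integration.

Section time_frequency.
Context (R : realType) (A : topologicalZmodType).
Implicit Types (mu : {measure set (borel A) -> \bar R}) (f g : A -> R[i]).

Definition fourier mu f : dual R A -> R[i] :=
  fun xi => cintegral mu (fun x => f x * (xi x)^*).

Definition plancherel mu (nu : {measure set (borel (dual R A)) -> \bar R}) :
    Prop :=
  forall f, cmeasurable f ->
    (cLnorm mu 1 f < +oo)%E -> (cLnorm mu 2 f < +oo)%E ->
    cLnorm nu 2 (fourier mu f) = cLnorm mu 2 f.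

Definition tf_shift (z : prodg A (dual R A)) f : A -> R[i] :=
  fun y => z.2 y * f (y - z.1).

Definition stft mu g f : prodg A (dual R A) -> R[i] :=
  fun z => inner mu f (tf_shift z g).

End time_frequency.

Definition tensor (R : realType) (A B : topologicalZmodType)
    (f : A -> R[i]) (g : B -> R[i]) : prodg A B -> R[i] :=
  fun x => f x.1 * g x.2.

Section gaussians.
Context (R : realType) (d : nat).
Implicit Types (alpha beta : 'M[R]_d) (f g : 'rV[R]_d -> R[i]).

Definition cexp (z : R[i]) : R[i] :=
  (expR (complex.Re z))%:C *
  (cos (complex.Im z) +i* sin (complex.Im z)).

Definition qform alpha (x : 'rV[R]_d) : R := (x *m alpha *m x^T) ord0 ord0.

Definition posdefmx alpha : Prop :=
  alpha^T = alpha /\ forall x, x != 0 -> 0 < qform alpha x.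

Definition gaussian_fun alpha beta (gamma : 'rV[R[i]]_d) (delta : R[i]) :
    'rV[R]_d -> R[i] :=
  fun x => cexp ((- qform alpha x) +i* qform beta x
                 + \sum_(j < d) gamma ord0 j * (x ord0 j)%:C + delta).

Definition is_gaussian alpha beta f : Prop :=
  [/\ posdefmx alpha, beta^T = beta
    & exists gamma delta, f = gaussian_fun alpha beta gamma delta].

Definition matched_gaussians f g : Prop :=
  exists alpha beta, is_gaussian alpha beta f /\ is_gaussian alpha beta g.

End gaussians.

Section second_degree.
Context (R : realType).

Definition symmetric_hom (B : topologicalZmodType) (phi : B -> dual R B) : Prop :=
  [/\ continuous phi, forall x y, phi (x + y) = phi x + phi y
    & forall x y, phi y x = phi x y].

Definition second_degree_char (B : topologicalZmodType) (phi : B -> dual R B)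
    (f : B -> R[i]) : Prop :=
  [/\ continuous f, forall x, `|f x| = 1
    & forall x y, f (x + y) = f x * f y * phi y x].

Definition compact_open_subgroup (B : topologicalZmodType) (H : zmodClosed B) :
    Prop :=
  compact [set x : B | x \in H] /\ open [set x : B | x \in H].

Definition subcharacter (B : topologicalZmodType) (h : B -> R[i]) : Prop :=
  exists (H : zmodClosed B) (phi : subgroup H -> dual R (subgroup H)),
  [/\ compact_open_subgroup H, symmetric_hom phi,
      second_degree_char phi (fun x : subgroup H => h (val x))
    & forall x, x \notin H -> h x = 0].

Definition matched_subcharacters (B : topologicalZmodType) (f g : B -> R[i]) :
    Prop :=
  exists (c1 c2 : R[i]) (z1 z2 : prodg B (dual R B)) (h : B -> R[i]),
  [/\ c1 != 0, c2 != 0, subcharacter h,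
      f = (fun y => c1 * tf_shift z1 h y)
    & g = (fun y => c2 * tf_shift z2 h y)].

End second_degree.

(* Main.v *)
Require Import Defs.
From HB Require Import structures.
From mathcomp Require Import all_boot all_order all_algebra complex.
From mathcomp Require Import all_classical all_reals all_analysis.
From mathcomp Require Import measurable_realfun.
From mathcomp Require Import ring lra.

Set Implicit Arguments.
Unset Strict Implicit.
Unset Printing Implicit Defensive.

Import Order.TTheory GRing.Theory Num.Theory.
Import numFieldNormedType.Exports.

Local Open Scope classical_set_scope.
Local Open Scope ring_scope.
Local Open Scope complex_scope.

(** Let H be the compact open subgroup that carries the subcharacter h, let Q be
    the quadratic form of alpha and Q' that of its inverse.  Every character xi
    of R^d x A0 has a frequency w in R^d, with xi (x, 0) = exp (i w . x), and a
    restriction to H.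

    Completing squares, the integrand that defines V_g f ((x, u), xi) is a
    Gaussian on R^d with a linear phase, times a function on A0 that vanishes off
    the coset a1 + H and is there a multiple of a character of H
    ([chirped_product], [coset_product_near]).  By orthogonality of characters
    the second factor integrates to zero unless that character is trivial, and
    the first one contributes the Fourier transform of a Gaussian.  Hence
    ([normc_stft])

      |V_g f ((x, u), xi)| = D exp (- Q (x - b) / 2) exp (- Q' (w - l x) / 8)

    with l affine, on the region where u lies in the coset a1 - a2 + H and the
    restriction of xi to H is a prescribed locally constant function of u; off
    this region V_g f vanishes.

    Let m (E) be the mass of E x H, and n (E) the mass of the set of characters
    trivial on H with frequency in E.  On this region the Haar measure of the
    product, seen through (x, w), is the product of m and n
    ([lam_graph_region]).  So the p-th power of the norm is an iterated Gaussian
    integral, in which l x disappears by invariance of n, and which is then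
    computed exactly ([integral_profile_power]).

    These Gaussian integrals never have to be evaluated, only compared, and the
    comparison rests on the invariance of m and n under translation.
    Differentiating a translated integral gives Stein's identity
    ([stein_identity]).  It turns the dependence of a Gaussian integral on a
    dilation, and of its Fourier transform on the frequency, into linear
    differential equations, with solutions I (s alpha) = s^(- d / 2) I (alpha)
    ([gauss_intZ]) and I (alpha) exp (- Q' / 4) ([gauss_fourier_cos]).  The
    integrals for n follow from those for m by the Plancherel formula, applied
    to a Gaussian times a character of H extended by zero ([plancherel_gauss]).
    The same formula shows that every character of H extends to the whole group,
    so that all fibers of the restriction map have the same size
    ([res_surjective], [dual_fiber_measure_eq]).

    With both variables dilated by the exponent p, the powers of p combine to
    (2 / p)^d times I (2 alpha)^p, while the L^2 norms of f and g contribute one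
    square root of I (2 alpha) each. *)

(** * Borel measures on a topological group *)

Lemma borel_open (A : topologicalZmodType) (U : set (borel A)) :
  open (U : set A) -> measurable U.
Proof. by move=> oU; exact: sub_sigma_algebra. Qed.

Lemma borel_closed (A : topologicalZmodType) (U : set (borel A)) :
  closed (U : set A) -> measurable U.
Proof.
move=> cU; rewrite -(setCK U); apply: measurableC; apply: borel_open.
exact: closed_openC.
Qed.

Lemma borel_continuous_measurable (A B : topologicalZmodType) (f : A -> B) :
  continuous f -> measurable_fun [set: borel A] (f : borel A -> borel B).
Proof.
move=> cf; apply: (measurability (@open B : set (set (borel B)))) => //.
move=> _ [U oU <-]; rewrite setTI; apply: borel_open.
by move/continuousP : cf; apply.
Qed.

Lemma borel_continuous_measurable_real (R : realType) (A : topologicalZmodType)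
    (f : A -> R) :
  continuous f -> measurable_fun [set: borel A] (f : borel A -> R).
Proof.
move=> cf; apply: (measurability _ (RGenOInfty.measurableE R)).
move=> _ [_ [a ->] <-]; rewrite setTI; apply: borel_open.
by move/continuousP : cf; apply; exact: interval_open.
Qed.

Section shift.
Context (R : realType) (A : topologicalZmodType).
Context (m : {measure set (borel A) -> \bar R}).
Hypothesis m_inv : forall (x : A) (E : set (borel A)), measurable E ->
  m [set x + y | y in (E : set A)] = m E.

Lemma addl_continuous (x : A) : continuous (fun y : A => x + y).
Proof.
move=> y; apply: (@continuous_comp A (A * A)%type A (fun y => (x, y))
  (fun z => z.1 + z.2)); last exact: add_continuous.
by apply: cvg_pair => /=; [exact: cvg_cst|exact: cvg_id].
Qed.

Lemma measure_shift_preimage (x : A) (E : set (borel A)) : measurable E ->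
  m [set y | E (x + y)] = m E.
Proof.
move=> mE; rewrite -(m_inv (- x) mE); congr (m _).
apply/seteqP; split=> [y /= Exy|_ /= [y Ey <-]].
  by exists (x + y) => //; rewrite addKr.
by rewrite addNKr.
Qed.

Lemma ge0_integral_shift (x : A) (f : borel A -> \bar R) :
  measurable_fun setT f -> (forall y, 0 <= f y)%E ->
  (\int[m]_y f (x + (y : A))%R = \int[m]_y f y)%E.
Proof.
move=> mf f0.
have ms : measurable_fun [set: borel A] ((fun y : A => x + y) : borel A -> borel A).
  by apply: borel_continuous_measurable; exact: addl_continuous.
rewrite -(@ge0_integral_pushforward _ _ _ _ _ _ ms m setT f)//.
by apply: eq_measure_integral => E mE _; exact: measure_shift_preimage.
Qed.

Lemma integral_shift (x : A) (f : borel A -> \bar R) :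
  measurable_fun setT f ->
  (\int[m]_y f (x + (y : A))%R = \int[m]_y f y)%E.
Proof.
move=> mf; rewrite integralE [RHS]integralE; congr (_ - _)%E.
- rewrite -[LHS](_ : \int[m]_y f^\+ (x + (y : A))%R = _)%E; last first.
    by apply: eq_integral => y _; rewrite /= !funeposE.
  apply: (@ge0_integral_shift x (f^\+)%E) => //.
  exact: measurable_funepos.
- rewrite -[LHS](_ : \int[m]_y f^\- (x + (y : A))%R = _)%E; last first.
    by apply: eq_integral => y _; rewrite /= !funenegE.
  apply: (@ge0_integral_shift x (f^\-)%E) => //.
  exact: measurable_funeneg.
Qed.

Lemma Rintegral_shift (x : A) (f : borel A -> R) :
  measurable_fun setT f ->
  \int[m]_y f (x + (y : A))%R = \int[m]_y f y.
Proof.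
move=> mf; rewrite /Rintegral; congr fine.
apply: (integral_shift x (f := fun y => (f y)%:E)).
exact/measurable_EFinP.
Qed.

End shift.

(** * Quadratic forms *)

Lemma continuous_sum (R : realType) (T : topologicalType) (I : Type) (r : seq I)
    (f : I -> T -> R) :
  (forall i, continuous (f i)) -> continuous (fun x => \sum_(i <- r) f i x).
Proof.
move=> cf; apply: continuous_big => //; exact: add_continuous.
Qed.

Section dot.
Context (R : realType) (d : nat).
Implicit Types (x y w : 'rV[R]_d) (alpha : 'M[R]_d).

Definition dot x y : R := (x *m y^T) ord0 ord0.

Lemma dotE x y : dot x y = \sum_(j < d) x ord0 j * y ord0 j.
Proof. by rewrite /dot mxE; apply: eq_bigr => j _; rewrite mxE. Qed.

Lemma dotC x y : dot x y = dot y x.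
Proof. by rewrite !dotE; apply: eq_bigr => j _; rewrite mulrC. Qed.

Lemma dotDl x y w : dot (x + y) w = dot x w + dot y w.
Proof. by rewrite /dot mulmxDl mxE. Qed.

Lemma dotDr x y w : dot w (x + y) = dot w x + dot w y.
Proof. by rewrite dotC dotDl !(dotC w). Qed.

Lemma dotZl a x y : dot (a *: x) y = a * dot x y.
Proof. by rewrite /dot -scalemxAl mxE. Qed.

Lemma dotZr a x y : dot x (a *: y) = a * dot x y.
Proof. by rewrite dotC dotZl dotC. Qed.

Lemma dotNl x y : dot (- x) y = - dot x y.
Proof. by rewrite -scaleN1r dotZl mulN1r. Qed.

Lemma dotNr x y : dot x (- y) = - dot x y.
Proof. by rewrite dotC dotNl dotC. Qed.

Lemma dot0l x : dot 0 x = 0.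
Proof. by rewrite /dot mul0mx mxE. Qed.

Lemma dot0r x : dot x 0 = 0.
Proof. by rewrite dotC dot0l. Qed.

Lemma dot_delta x j : dot (delta_mx ord0 j) x = x ord0 j.
Proof.
rewrite dotE (bigD1 j)//= mxE !eqxx mul1r big1 ?addr0// => i ij.
by rewrite mxE (negbTE ij) andbF mul0r.
Qed.

Lemma dot_mulmxC alpha x y : dot (x *m alpha) y = dot x (y *m alpha^T).
Proof. by rewrite /dot trmx_mul trmxK mulmxA. Qed.

Lemma qform_dot alpha x : qform alpha x = dot (x *m alpha) x.
Proof. by []. Qed.

Lemma qformZ alpha a x : qform alpha (a *: x) = a ^+ 2 * qform alpha x.
Proof. by rewrite !qform_dot -scalemxAl dotZl dotZr mulrA expr2. Qed.

Lemma qformZmx alpha a x : qform (a *: alpha) x = a * qform alpha x.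
Proof. by rewrite !qform_dot -scalemxAr dotZl. Qed.

Lemma qform0 alpha : qform alpha 0 = 0.
Proof. by rewrite qform_dot mul0mx dot0l. Qed.

Lemma qformN alpha x : qform alpha (- x) = qform alpha x.
Proof. by rewrite -scaleN1r qformZ sqrrN expr1n mul1r. Qed.

Lemma qformD alpha x y : alpha^T = alpha ->
  qform alpha (x + y) = qform alpha x + 2 * dot (x *m alpha) y + qform alpha y.
Proof.
move=> sa; rewrite !qform_dot mulmxDl dotDl !dotDr.
rewrite (dot_mulmxC alpha y x) sa (dotC y); ring.
Qed.

Lemma dot_continuous w : continuous (dot w).
Proof.
move=> y; rewrite (_ : dot w = fun y => \sum_(j < d) w ord0 j * y ord0 j); last first.
  by apply/funext => z; rewrite dotE.
apply: continuous_sum => j z.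
apply: (continuousM (s := fun=> w ord0 j)); last exact: coord_continuous.
exact: cst_continuous.
Qed.

Lemma qform_continuous alpha : continuous (qform alpha).
Proof.
move=> y; rewrite (_ : qform alpha =
    fun y => \sum_(j < d) dot (row j alpha^T) y * y ord0 j); last first.
  apply/funext => z; rewrite qform_dot dotE; apply: eq_bigr => j _; congr (_ * _).
  rewrite dotE mxE; apply: eq_bigr => i _; rewrite !mxE; exact: mulrC.
apply: continuous_sum => j z.
apply: continuousM; [exact: dot_continuous|exact: coord_continuous].
Qed.

Lemma posdef_unit alpha : posdefmx alpha -> alpha \in unitmx.
Proof.
move=> [_ pa]; rewrite -row_free_unit -kermx_eq0; apply/eqP/row_matrixP => i.
rewrite row0; apply/eqP/negP => /negP /pa.
by rewrite /qform -row_mul mulmx_ker row0 mul0mx mxE ltxx.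
Qed.

Lemma posdefZ alpha a : 0 < a -> posdefmx alpha -> posdefmx (a *: alpha).
Proof.
move=> a0 [sa pa]; split; first by rewrite linearZ/= sa.
by move=> x x0; rewrite qformZmx mulr_gt0// pa.
Qed.

Lemma posdef_ge0 alpha x : posdefmx alpha -> 0 <= qform alpha x.
Proof.
by move=> [_ pa]; have [->|/pa/ltW//] := eqVneq x 0; rewrite qform0.
Qed.

(** The minimum of the form over the unit sphere, which is compact; the sphere is
    empty when the dimension is zero. *)
Lemma posdef_coercive alpha : posdefmx alpha ->
  exists2 c : R, 0 < c & forall x, c * `|x| ^+ 2 <= qform alpha x.
Proof.
move=> pa; have [_ pa1] := pa.
have [[x0 /= x01]|noS] := pselect ([set x : 'rV[R]_d | `|x| = 1] !=set0); last first.
  exists 1 => // x; have [->|x0] := eqVneq x 0.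
    by rewrite normr0 expr0n mulr0 qform0.
  exfalso; apply: noS; exists (`|x|^-1 *: x) => /=.
  by rewrite normrZ gtr0_norm ?invr_gt0 ?normr_gt0// mulVf// normr_eq0.
have cS : compact [set x : 'rV[R]_d | `|x| = 1].
  apply: bounded_closed_compact.
    by exists 1; split => //= r r1 x /= ->; exact: ltW.
  apply: (@closed_comp _ _ (fun x : 'rV[R]_d => `|x|) [set 1]).
    by move=> x _; exact: norm_continuous.
  exact: closed_eq.
have [|c cS' cmin] := compact_EVT_min (ex_intro _ x0 x01) cS (f := qform alpha).
  by apply: continuous_subspaceT; exact: qform_continuous.
have c1 : `|c| = 1 by move: cS'; rewrite inE.
exists (qform alpha c).
  by apply: pa1; rewrite -normr_eq0 c1 oner_eq0.
move=> x; have [->|xn0] := eqVneq x 0.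
  by rewrite normr0 expr0n mulr0 qform0.
have nx : 0 < `|x| by rewrite normr_gt0.
rewrite -ler_pdivlMr ?exprn_gt0//.
rewrite [leRHS](_ : _ = qform alpha (`|x|^-1 *: x)); last first.
  by rewrite qformZ exprVn mulrC.
apply: cmin; rewrite inE /=.
by rewrite normrZ gtr0_norm ?invr_gt0// mulVf// normr_eq0.
Qed.

End dot.

(** * Gaussians are integrable for invariant measures *)

Section growth.
Context (R : realType) (d : nat) (m : {measure set (borel 'rV[R]_d) -> \bar R}).
Hypothesis m_inv : forall (x : 'rV[R]_d) (E : set (borel 'rV[R]_d)),
  measurable E -> m [set x + y | y in (E : set 'rV[R]_d)] = m E.
Hypothesis m_fin : forall K : set 'rV[R]_d, compact K -> (m K < +oo)%E.

Let B (r : R) : set 'rV[R]_d := [set y | `|y| <= r].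

Let closedB r : closed (B r).
Proof.
apply: (@closed_comp _ _ (fun x : 'rV[R]_d => `|x|) [set x | x <= r]).
  by move=> x _; exact: norm_continuous.
exact: closed_le.
Qed.

Let compactB r : compact (B r).
Proof.
apply: bounded_closed_compact; last exact: closedB.
exists r; split; first exact: num_real.
by move=> M rM y /= yr; rewrite (le_trans yr)// ltW.
Qed.

Let measurableB r : measurable (B r : set (borel 'rV[R]_d)).
Proof. by apply: borel_closed; exact: closedB. Qed.

(** By compactness finitely many unit balls cover the ball of radius 2, and
    dilating the cover does not change how many translates are needed. *)
Lemma ball_doubling :
  exists N : nat, forall r : R, 0 < r -> (m (B (2 * r)) <= N%:R%:E * m (B r))%E.
Proof.
have : @cover_compact 'rV[R]_d (B 2) by rewrite -compact_cover; exact: compactB.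
move=> /(_ _ setT (fun i => [set y : 'rV[R]_d | `|- i + y| < 1])) [i _||D _ BD].
- apply: (@open_comp _ _ (fun y : 'rV[R]_d => `|- i + y|) [set x | x < 1]).
    move=> y _; apply: (@continuous_comp _ _ _ (fun y => - i + y) (fun y => `|y|)).
      exact: addl_continuous.
    exact: norm_continuous.
  exact: open_lt.
- by move=> y _; exists y => //=; rewrite addNr normr0.
pose s := finmap.enum_fset D.
exists (size s) => r r0.
have mE (i : 'rV[R]_d) : measurable ([set y | B r (- (r *: i) + y)] : set (borel 'rV[R]_d)).
  rewrite -[X in measurable X]setTI.
  apply: (borel_continuous_measurable (@addl_continuous _ (- (r *: i)))) => //.
have -> : ((size s)%:R%:E * m (B r) = \sum_(i <- s) m [set y | B r (- (r *: i) + y)%R])%E.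
  rewrite (eq_bigr (fun=> m (B r))); last first.
    by move=> i _; rewrite (measure_shift_preimage m_inv).
  rewrite big_const_seq count_predT.
  elim: (size s) => [|n ih]; first by rewrite mul0e.
  by rewrite /= -ih -natr1 EFinD ge0_muleDl// mul1e addeC.
rewrite fsbig_seq;
  last exact: finmap.fset_uniq.
apply: content_sub_fsum => //.
move=> y /= y2r.
have [|i iD /=] := BD (r^-1 *: y).
  rewrite /B /= normrZ gtr0_norm ?invr_gt0//.
  by rewrite ler_pdivrMl// mulrC.
move=> /ltW yi; exists i => //.
rewrite /B /= (_ : - (r *: i) + y = r *: (- i + r^-1 *: y)).
  by rewrite normrZ gtr0_norm// -[leRHS]mulr1 ler_pM2l.
by rewrite scalerDr scalerA divff ?gt_eqF// scale1r scalerN.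
Qed.

(** Iterating the doubling bound: balls grow at most polynomially. *)
Lemma ball_growth : exists N : nat, exists2 M : R, 0 <= M &
  forall k : nat, (m (B (2 ^+ k)) <= (N%:R ^+ k * M)%:E)%E.
Proof.
have [N HN] := ball_doubling.
have m1 : m (B 1) \is a fin_num by rewrite ge0_fin_numE//; exact/m_fin/compactB.
exists N; exists (fine (m (B 1))).
  by apply: fine_ge0; exact: measure_ge0.
elim=> [|k ih]; first by rewrite !expr0 mul1r fineK.
rewrite exprS; apply: (le_trans (HN (2 ^+ k) _)); first by rewrite exprn_gt0.
by rewrite exprS -mulrA EFinM lee_wpmul2l// lee_fin.
Qed.

End growth.

Lemma expRN_le (R : realType) (j : nat) (x : R) : 0 < x ->
  expR (- x) <= (j%:R / x) ^+ j.
Proof.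
move=> x0; case: j => [|j]; first by rewrite expr0 -expR0 ler_expR oppr_le0 ltW.
have j0 : 0 < j.+1%:R :> R by [].
rewrite expRN -[leRHS]invrK lef_pV2 ?posrE ?expR_gt0 ?invr_gt0 ?exprn_gt0 ?divr_gt0//.
rewrite -exprVn invf_div.
have {2}-> : x = j.+1%:R * (x / j.+1%:R) by rewrite mulrC divfK ?gt_eqF.
rewrite expRM_natl lerXn2r ?nnegrE ?expR_ge0 ?divr_ge0 ?ltW//.
by rewrite (lt_le_trans _ (expR_ge1Dx _))// ltrDr.
Qed.

Section gaussian_finite.
Context (R : realType) (d : nat) (m : {measure set (borel 'rV[R]_d) -> \bar R}).
Hypothesis m_inv : forall (x : 'rV[R]_d) (E : set (borel 'rV[R]_d)),
  measurable E -> m [set x + y | y in (E : set 'rV[R]_d)] = m E.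
Hypothesis m_fin : forall K : set 'rV[R]_d, compact K -> (m K < +oo)%E.

Let B (r : R) : set 'rV[R]_d := [set y | `|y| <= r].

Lemma dyadic_ball_exists (y : 'rV[R]_d) : exists k : nat, B (2 ^+ k) y /\
  (4 ^+ k / 4 <= 1 + `|y| ^+ 2).
Proof.
have [k0 hk0] : exists k : nat, `|y| <= 2 ^+ k.
  exists (Num.truncn `|y|).+1; rewrite ltW// (lt_le_trans (truncnS_gt _))//.
  by rewrite -natrX ler_nat ltnW// ltn_expl.
have ex : exists k, `|y| <= 2 ^+ k by exists k0.
case: (ex_minnP ex) => k yk mink; exists k; split => //.
case: k yk mink => [|k] yk mink.
  by rewrite expr0 -lerBlDl (@le_trans _ _ 0) ?exprn_ge0//; lra.
have /negP : ~ (`|y| <= 2 ^+ k) by move=> /mink; rewrite ltnn.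
rewrite -ltNge => /ltW k2y.
rewrite exprS mulrC mulKf// (_ : 4 = 2 ^+ 2); last by rewrite expr2; lra.
rewrite -exprM mulnC exprM (@le_trans _ _ (`|y| ^+ 2)) ?lerDr//.
by rewrite lerXn2r ?nnegrE ?exprn_ge0.
Qed.

(** Bound the integrand on dyadic shells by constants: the Gaussian decay beats
    the polynomial growth of the balls by a geometric factor. *)
Lemma gaussian_finite alpha : posdefmx alpha ->
  (\int[m]_y (expR (- qform alpha y))%:E < +oo)%E.
Proof.
move=> pa; have [c c0 Qc] := posdef_coercive pa.
have [N [M M0 BM]] := ball_growth m_inv m_fin.
pose b k : R := expR c * expR (- (c / 4 * 4 ^+ k)).
have b0 k : 0 <= b k by rewrite mulr_ge0 ?expR_ge0.
have mB r : measurable (B r : set (borel 'rV[R]_d)).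
  apply: borel_closed; apply: (@closed_comp _ _ (fun x : 'rV[R]_d => `|x|) [set x | x <= r]).
    by move=> x _; exact: norm_continuous.
  exact: closed_le.
have mf : measurable_fun [set: borel 'rV[R]_d] (fun y => (expR (- qform alpha y))%:E).
  apply/measurable_EFinP; apply: (@borel_continuous_measurable_real _ _
    (fun y => expR (- qform alpha y))) => y.
  apply: (@continuous_comp _ _ _ (fun y => - qform alpha y) expR).
    by apply: continuousN; exact: qform_continuous.
  exact: continuous_expR.
have mg k : measurable_fun [set: borel 'rV[R]_d]
    (fun y => ((b k)%:E * (\1_(B (2 ^+ k)) y)%:E)%E).
  by apply: emeasurable_funM => //; apply/measurable_EFinP; exact: measurable_indic.
(* With this exponent the bound (j / x) ^ j for exp (- x) at x = c 4^k / 4 gains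
   4^(j k), which is at least (2 N)^k and so absorbs the growth N^k. *)
pose j := N.+1.
pose C : R := 2 * (expR c * M * (4 * j%:R / c) ^+ j).
have C0 : 0 <= C.
  by rewrite !mulr_ge0 ?expR_ge0// exprn_ge0// divr_ge0// ?mulr_ge0// ltW.
apply: (@le_lt_trans _ _ (\int[m]_y \sum_(0 <= k <oo) (b k)%:E * (\1_(B (2 ^+ k)) y)%:E)%E).
  apply: ge0_le_integral => //.
  - by apply: ge0_emeasurable_sum => // k y _ _; rewrite mule_ge0// lee_fin.
  - move=> y _; have [k [Bky ky]] := dyadic_ball_exists y.
    have h0 i : (0 <= i)%N -> xpredT i -> (0 <= (b i)%:E * (\1_(B (2 ^+ i)) y)%:E :> \bar R)%E.
      by move=> _ _; rewrite mule_ge0// lee_fin.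
    apply: le_trans (@nneseries_lim_ge _ _ xpredT 0%N k.+1 h0).
    rewrite big_nat_recr//= indicE mem_set// mule1.
    rewrite (@le_trans _ _ (b k)%:E)//; last first.
      by rewrite leeDr// sume_ge0// => i _; rewrite mule_ge0// lee_fin.
    rewrite lee_fin /b -expRD ler_expR (le_trans (_ : _ <= - (c * `|y| ^+ 2)))//.
      by rewrite lerN2 Qc.
    rewrite lerNl opprB lerBlDr -mulrA (mulrC 4^-1) -[X in _ + X]mulr1 -mulrDr.
    by rewrite ler_pM2l// addrC.
rewrite integral_nneseries//; last by move=> k y _; rewrite mule_ge0// lee_fin.
apply: (@le_lt_trans _ _ (\sum_(0 <= k <oo) (C / (2 ^ k.+1)%:R)%:E)%E); last first.
  by apply: le_lt_trans (epsilon_trick0 _ C0) _; rewrite ltry.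
apply: lee_nneseries => [k _ _|k _].
  by apply: integral_ge0 => y _; rewrite mule_ge0// lee_fin.
rewrite ge0_integralZl// ?lee_fin//; last first.
  by apply/measurable_EFinP; exact: measurable_indic.
rewrite integral_indic// setIT.
apply: (@le_trans _ _ ((b k)%:E * (N%:R ^+ k * M)%:E)%E).
  by apply: lee_wpmul2l; [rewrite lee_fin|exact: BM].
rewrite -EFinM lee_fin /b /C.
have h4 : 0 < c / 4 * 4 ^+ k by rewrite mulr_gt0 ?exprn_gt0 ?divr_gt0.
have := expRN_le j h4 => hE.
have hN : (2 * N%:R) <= 4 ^+ j :> R.
  rewrite -!natrX -natrM ler_nat.
  rewrite (_ : 4 = 2 * 2)%N// expnMn leq_mul//.
    by rewrite expnS leq_pmulr// expn_gt0.
  by rewrite ltnW// (leq_trans (ltn_expl N (isT : 1 < 2)%N))// leq_exp2l.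
have hNk : N%:R ^+ k / (4 ^+ k) ^+ j <= (2 ^+ k)^-1 :> R.
  rewrite ler_pdivrMr ?exprn_gt0// ler_pdivlMl ?exprn_gt0//.
  by rewrite -exprMn -exprM mulnC exprM lerXn2r ?nnegrE ?mulr_ge0 ?exprn_ge0.
apply: (@le_trans _ _ (expR c * M * (4 * j%:R / c) ^+ j * (N%:R ^+ k / (4 ^+ k) ^+ j))).
  rewrite (_ : expR c * M * (4 * j%:R / c) ^+ j * (N%:R ^+ k / (4 ^+ k) ^+ j) =
     expR c * (j%:R / (c / 4 * 4 ^+ k)) ^+ j * (N%:R ^+ k * M)).
    by rewrite ler_wpM2r ?mulr_ge0// ?exprn_ge0// ler_wpM2l ?expR_ge0.
  rewrite (_ : j%:R / (c / 4 * 4 ^+ k) = (4 * j%:R / c) / 4 ^+ k).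
    by rewrite [in RHS]exprMn exprVn; ring.
  by field; rewrite !gt_eqF ?exprn_gt0.
apply: (@le_trans _ _ (expR c * M * (4 * j%:R / c) ^+ j * (2 ^+ k)^-1)).
  rewrite ler_wpM2l// mulr_ge0 ?exprn_ge0 ?divr_ge0 ?mulr_ge0 ?expR_ge0//.
  exact: ltW.
rewrite natrX exprS le_eqVlt; apply/orP; left; apply/eqP.
by field; rewrite !gt_eqF ?exprn_gt0.
Qed.

End gaussian_finite.

(** * Tilted Gaussians and exponential weights *)

(** Differentiation under the integral sign, in the form of a derivative at one
    point with a common bound [G] for the integrand and its derivative. *)
Lemma is_derive_integral (R : realType) (d : measure_display)
    (T : measurableType d) (m : {measure set T -> \bar R})
    (h h' : R -> T -> R) (a u v : R) (G : T -> R) :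
  u < a < v ->
  (forall x, u < x < v -> measurable_fun setT (h x)) ->
  (forall x y, u < x < v -> is_derive x 1 (h^~ y) (h' x y)) ->
  m.-integrable setT (EFin \o G) ->
  (forall x y, u < x < v -> `|h x y| <= G y) ->
  (forall x y, u < x < v -> `|h' x y| <= G y) ->
  is_derive a 1 (fun x => \int[m]_y h x y) (\int[m]_y h' a y).
Proof.
move=> auv mh dh iG hG h'G.
have aI : `]u, v[%classic a by rewrite /= in_itv.
have ih x : `]u, v[%classic x -> m.-integrable setT (EFin \o h x).
  rewrite /= in_itv /= => xuv.
  apply: (le_integrable measurableT _ _ iG).
    by apply/measurable_EFinP; exact: mh.
  move=> y _ /=; rewrite lee_fin (le_trans (hG _ _ xuv))//.
  exact: ler_norm.
have dh1 x y : `]u, v[%classic x -> [set: T] y -> derivable (h^~ y) x 1.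
  by rewrite /= in_itv /= => /(dh x y) [].
have G0 y : 0 <= G y by rewrite (le_trans _ (hG a y auv)).
have pE x y : u < x < v -> partial1of2 h x y = h' x y.
  by move=> /(dh x y) [_ <-]; rewrite partial1of2E.
have pG x y : `]u, v[%classic x -> [set: T] y -> `|partial1of2 h x y| <= G y.
  by rewrite /= in_itv /= => xuv _; rewrite pE// h'G.
apply: DeriveDef.
  exact: (derivable_under_integral measurableT aI ih dh1 G0 iG pG).
rewrite -derive1E (differentiation_under_integral measurableT aI ih dh1 G0 iG pG).
by apply: eq_Rintegral => y _; rewrite pE.
Qed.

Section gaussian_integrals.
Context (R : realType) (d : nat) (m : {measure set (borel 'rV[R]_d) -> \bar R}).
Hypothesis m_inv : forall (x : 'rV[R]_d) (E : set (borel 'rV[R]_d)),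
  measurable E -> m [set x + y | y in (E : set 'rV[R]_d)] = m E.
Hypothesis m_fin : forall K : set 'rV[R]_d, compact K -> (m K < +oo)%E.
Context (alpha : 'M[R]_d).
Hypothesis pos_alpha : posdefmx alpha.

Implicit Types (w y c : 'rV[R]_d).

Lemma gauss_exponent_continuous w :
  continuous (fun y => - qform alpha y + dot w y).
Proof.
move=> y; have h : {for y, continuous (fun y => - qform alpha y)}.
  by apply: continuousN; exact: qform_continuous.
exact: (continuousD h (@dot_continuous R d w y)).
Qed.

Lemma tilted_continuous w : continuous (fun y => expR (- qform alpha y + dot w y)).
Proof.
move=> y; apply: (continuous_comp (gauss_exponent_continuous (w := w) (x := y))).
exact: continuous_expR.
Qed.

(** The shift [c] solves 2 c alpha = w, which cancels the linear term. *)
Lemma complete_square w y :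
  let c := 2^-1 *: (w *m invmx alpha) in
  - qform alpha (c + y) + dot w (c + y) =
  qform (invmx alpha) w / 4 - qform alpha y.
Proof.
move=> c; have [sa _] := pos_alpha.
have ca : c *m alpha = 2^-1 *: w.
  by rewrite -scalemxAl mulmxKV// posdef_unit.
rewrite qformD// ca dotZl dotDr qform_dot ca dotZl.
have -> : dot w c = qform (invmx alpha) w / 2.
  by rewrite qform_dot /c dotZr mulrC dotC.
by field.
Qed.

Lemma integral_tilted w :
  (\int[m]_y (expR (- qform alpha y + dot w y))%:E =
   (expR (qform (invmx alpha) w / 4))%:E * \int[m]_y (expR (- qform alpha y))%:E)%E.
Proof.
pose c := 2^-1 *: (w *m invmx alpha).
have mf v : measurable_fun [set: borel 'rV[R]_d]
    (fun y => (expR (- qform alpha y + dot v y))%:E).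
  apply/measurable_EFinP; apply: borel_continuous_measurable_real.
  exact: tilted_continuous.
have mf0 : measurable_fun [set: borel 'rV[R]_d]
    (fun y => (expR (- qform alpha y))%:E).
  rewrite (_ : (fun y => _) = fun y => (expR (- qform alpha y + dot 0 y))%:E)//.
  by apply/funext => y; rewrite dot0l addr0.
rewrite -(ge0_integral_shift m_inv c (mf w)); last first.
  by move=> y; rewrite lee_fin expR_ge0.
under eq_integral do rewrite complete_square expRD EFinM.
by rewrite ge0_integralZl// => y _; rewrite lee_fin expR_ge0.
Qed.

Lemma integrable_tilted w :
  m.-integrable setT (EFin \o (fun y => expR (- qform alpha y + dot w y))).
Proof.
apply/integrableP; split.
  apply/measurable_EFinP; apply: borel_continuous_measurable_real.
  exact: tilted_continuous.
rewrite (eq_integral (fun y : borel 'rV[R]_d => (expR (- qform alpha y + dot w y))%:E)).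
  rewrite integral_tilted lte_mul_pinfty ?lee_fin ?expR_ge0//.
  exact: gaussian_finite.
by move=> y _ /=; rewrite ger0_norm// expR_ge0.
Qed.

(** Twice the hyperbolic cosine of the linear form [w]: a weight that dominates
    that form and its exponential, and whose products with a Gaussian are sums of
    tilted Gaussians, hence integrable. *)
Definition ch w y : R := expR (dot w y) + expR (- dot w y).

Lemma ch_ge0 w y : 0 <= ch w y.
Proof. by rewrite addr_ge0 ?expR_ge0. Qed.

Lemma expR_le_ch w y t : `|t| <= 1 -> expR (t * dot w y) <= ch w y.
Proof.
move=> t1; have h : t * dot w y <= `|dot w y|.
  by rewrite (le_trans (ler_norm _))// normrM ler_piMl.
rewrite (@le_trans _ _ (expR `|dot w y|)) ?ler_expR// /ch.
by case: (ger0P (dot w y)) => _; rewrite ?lerDl ?lerDr expR_ge0.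
Qed.

Lemma ch_ge1 w y : 1 <= ch w y.
Proof.
by rewrite -(expR0 R) (le_trans _ (@expR_le_ch w y 0 _)) ?mul0r// normr0.
Qed.

Lemma normr_le_ch w y : `|dot w y| <= ch w y.
Proof.
rewrite (@le_trans _ _ (expR `|dot w y|))//.
  by rewrite (le_trans _ (expR_ge1Dx _))// lerDr.
by rewrite /ch; case: (ger0P (dot w y)) => _; rewrite ?lerDl ?lerDr expR_ge0.
Qed.

Lemma ch_shift_le w c y t : `|t| <= 1 ->
  ch w (t *: c + y) <= expR `|dot w c| * ch w y.
Proof.
move=> t1; rewrite /ch dotDr dotZr opprD !expRD mulrDr.
have h s : `|s| <= 1 -> expR (s * dot w c) <= expR `|dot w c|.
  by move=> s1; rewrite ler_expR (le_trans (ler_norm _))// normrM ler_piMl.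
have hN : expR (- (t * dot w c)) <= expR `|dot w c|.
  by rewrite -mulNr h// normrN.
by apply: lerD; apply: ler_wpM2r; [exact: expR_ge0|exact: h|exact: expR_ge0|].
Qed.

Lemma integrable_ch (us : seq 'rV[R]_d) w : m.-integrable setT
  (EFin \o (fun y => (\prod_(u <- us) ch u y) * expR (- qform alpha y + dot w y))).
Proof.
elim: us w => [|u us ih] w.
  rewrite (_ : EFin \o _ =
    EFin \o (fun y => expR (- qform alpha y + dot w y))).
    exact: integrable_tilted.
  by apply/funext => y /=; rewrite big_nil mul1r.
have := integrableD measurableT (ih (w + u)) (ih (w - u)).
congr (_.-integrable _ _); apply/funext => y /=.
rewrite -EFinD -mulrDr; congr EFin.
rewrite big_cons (mulrC (ch u y)) -mulrA; congr (_ * _).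
by rewrite /ch !dotDl dotNl !addrA expRD [in X in _ + X]expRD -mulrDr mulrC.
Qed.

End gaussian_integrals.

(** * Stein's identity *)

Section stein.
Context (R : realType) (d : nat) (m : {measure set (borel 'rV[R]_d) -> \bar R}).
Hypothesis m_inv : forall (x : 'rV[R]_d) (E : set (borel 'rV[R]_d)),
  measurable E -> m [set x + y | y in (E : set 'rV[R]_d)] = m E.
Hypothesis m_fin : forall K : set 'rV[R]_d, compact K -> (m K < +oo)%E.
Context (alpha : 'M[R]_d).
Hypothesis pos_alpha : posdefmx alpha.

Implicit Types (w y c : 'rV[R]_d).

(** By translation invariance the integral of F (t c + y), where F is [P] times
    the Gaussian, does not depend on t; [P'] is the derivative of [P] along [c],
    and the identity says that the derivative at t = 0 vanishes. *)
Lemma stein_identity (P P' : 'rV[R]_d -> R) (c u : 'rV[R]_d) (C : R) :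
  0 <= C ->
  continuous P -> continuous P' ->
  (forall (t : R) y, is_derive t 1 (fun t => P (t *: c + y)) (P' (t *: c + y))) ->
  (forall y, `|P y| <= C * ch u y) -> (forall y, `|P' y| <= C * ch u y) ->
  \int[m]_y ((P' y - 2 * dot (c *m alpha) y * P y) * expR (- qform alpha y)) = 0.
Proof.
move=> C0 cP cP' dP bP bP'.
have [sa _] := pos_alpha.
pose v := 2 *: (c *m alpha).
pose F y : R := P y * expR (- qform alpha y).
pose F' y : R := (P' y - 2 * dot (c *m alpha) y * P y) * expR (- qform alpha y).
(* Domination for |t| < 1: the weight [u] bounds [P] and [P'], one factor [v]
   bounds the cross term of - Q (t c + y), and the other the linear form in front
   of [P] in [F']. *)
pose G y : R := 2 * C * expR `|dot u c| * expR `|dot v c| *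
  (\prod_(w <- [:: u; v; v]) ch w y * expR (- qform alpha y + dot 0 y)).
have cF : continuous F.
  move=> y; apply: (continuousM (cP y)).
  apply: (@continuous_comp _ _ _ (fun y => - qform alpha y) expR).
    by apply: continuousN; exact: qform_continuous.
  exact: continuous_expR.
have dQ (t : R) y : is_derive t 1 (fun t => expR (- qform alpha (t *: c + y)))
    (- (2 * dot (c *m alpha) (t *: c + y)) * expR (- qform alpha (t *: c + y))).
  rewrite (_ : (fun t => expR (- qform alpha (t *: c + y))) =
     expR \o (fun t => - (t ^+ 2 * qform alpha c + t * (2 * dot (c *m alpha) y)
        + qform alpha y))); last first.
    apply/funext => s /=; rewrite qformD// qformZ -scalemxAl dotZl.
    congr expR; ring.
  apply: is_derive_eq.
  rewrite /= qformD// qformZ -scalemxAl dotZl dotDr dotZr -qform_dot.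
  rewrite !scaler0 !addr0 /GRing.scale/= !mulr1 (mulrC (expR _)); congr (_ * expR _); last ring.
  ring.
have dF (t : R) y : is_derive t 1 (fun t => F (t *: c + y)) (F' (t *: c + y)).
  have h := is_deriveM (dP t y) (dQ t y).
  rewrite (_ : (fun t => F (t *: c + y)) = (fun t => P (t *: c + y)) *
    (fun t => expR (- qform alpha (t *: c + y))))//.
  apply: (is_derive_eq h).
  rewrite /F' /GRing.scale/=; ring.
have bE (t : R) y : `|t| <= 1 -> expR (- qform alpha (t *: c + y)) <= ch v y * expR (- qform alpha y).
  move=> t1; rewrite qformD// qformZ -scalemxAl dotZl.
  rewrite (_ : - _ = - (t ^+ 2 * qform alpha c) + ((- t) * dot v y + - qform alpha y)); last first.
    by rewrite /v dotZl; ring.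
  rewrite expRD expRD -[leRHS]mul1r ler_pM ?expR_ge0 ?mulr_ge0 ?expR_ge0//.
    by rewrite -(expR0 R) ler_expR oppr_le0 mulr_ge0 ?sqr_ge0 ?posdef_ge0.
  by rewrite ler_wpM2r ?expR_ge0// expR_le_ch// normrN.
have GE y : G y = 2 * (C * (expR `|dot u c| * ch u y)) * (expR `|dot v c| * ch v y) *
   (ch v y * expR (- qform alpha y)).
  by rewrite /G !big_cons big_nil dot0l addr0 mulr1; ring.
have e1 (x : R) : 1 <= expR `|x| :> R by rewrite -(expR0 R) ler_expR.
have tI (t : R) : -1 < t < 1 -> `|t| <= 1 by move=> /andP[? ?]; rewrite ler_norml !ltW.
have hv y : 1 <= expR `|dot v c| * ch v y.
  by rewrite -[leLHS]mulr1 ler_pM// ?ch_ge1.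
have bF (t : R) y : -1 < t < 1 -> `|F (t *: c + y)| <= G y.
  move=> tt; have t1 := tI _ tt; rewrite GE /F normrM (ger0_norm (expR_ge0 _)).
  rewrite ler_pM ?expR_ge0 ?bE// -[leLHS]mulr1 ler_pM//.
  have hle := ler_wpM2l C0 (ch_shift_le u c y t1).
  rewrite (le_trans (bP _))// (le_trans hle)//.
  by rewrite ler_peMl ?ler1n// !mulr_ge0 ?expR_ge0 ?ch_ge0.
have bF' (t : R) y : -1 < t < 1 -> `|F' (t *: c + y)| <= G y.
  move=> tt; have t1 := tI _ tt; rewrite GE /F' normrM (ger0_norm (expR_ge0 _)).
  rewrite ler_pM ?expR_ge0 ?bE//.
  rewrite (le_trans (ler_normB _ _))// -dotZl -/v normrM.
  rewrite (_ : 2 * _ * _ = C * (expR `|dot u c| * ch u y) * (expR `|dot v c| * ch v y)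
    + C * (expR `|dot u c| * ch u y) * (expR `|dot v c| * ch v y)); last by ring.
  have hle := ler_wpM2l C0 (ch_shift_le u c y t1).
  have hu : 0 <= C * (expR `|dot u c| * ch u y) by rewrite !mulr_ge0 ?expR_ge0 ?ch_ge0.
  rewrite lerD//.
    rewrite -[leLHS]mulr1 ler_pM//.
    by rewrite (le_trans (bP' _)).
  rewrite mulrC ler_pM//.
    by rewrite (le_trans (bP _)).
  by rewrite (le_trans (normr_le_ch _ _))// ch_shift_le.
have iG : m.-integrable setT (EFin \o (G : borel 'rV[R]_d -> R)).
  have := integrableZl measurableT (2 * C * expR `|dot u c| * expR `|dot v c|)
    (integrable_ch m_inv m_fin pos_alpha [:: u; v; v] 0).
  by congr (_.-integrable _ _); apply/funext => y.
have D : is_derive (0 : R) 1 (fun t => \int[m]_y F (t *: c + (y : 'rV[R]_d)))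
   (\int[m]_y F' (0 *: c + (y : 'rV[R]_d))).
  apply: (@is_derive_integral _ _ _ m (fun t (y : borel 'rV[R]_d) => F (t *: c + (y : 'rV[R]_d)))
    (fun t (y : borel 'rV[R]_d) => F' (t *: c + (y : 'rV[R]_d))) 0 (-1) 1 G) => //.
  - by rewrite ltrN10 ltr01.
  - move=> t _; apply: (@borel_continuous_measurable_real _ _ (fun y => F (t *: c + y))) => y.
    by apply: (continuous_comp (@addl_continuous _ (t *: c) y)); exact: cF.
have K0 : (fun t => \int[m]_y F (t *: c + (y : 'rV[R]_d))) = cst (\int[m]_y F y).
  apply/funext => t; apply: (Rintegral_shift m_inv (t *: c) (f := F)).
  exact: borel_continuous_measurable_real.
move: D; rewrite K0 => -[_]; rewrite derive_cst => ->.
by apply: eq_Rintegral => y _; rewrite scale0r add0r.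
Qed.

End stein.

(** * Dilation of Gaussian integrals *)

Lemma Rintegral_sum (R : realType) (d : measure_display) (T : measurableType d)
    (m : {measure set T -> \bar R}) (I : Type) (r : seq I) (f : I -> T -> R) :
  (forall i, m.-integrable setT (EFin \o f i)) ->
  \int[m]_y (\sum_(i <- r) f i y) = \sum_(i <- r) \int[m]_y f i y.
Proof.
move=> fi; elim: r => [|i r ih].
  rewrite big_nil -[RHS](mul0r (fine (m setT))) -(Rintegral_cst m measurableT 0).
  by apply: eq_Rintegral => y _; rewrite big_nil.
rewrite big_cons -ih -RintegralD//.
  by apply: eq_Rintegral => y _; rewrite big_cons.
rewrite (_ : EFin \o _ = (fun y => \sum_(j <- r) (f j y)%:E)%E).
  by apply: integrable_sum => // j _; exact: fi.
by apply/funext => y /=; rewrite -sumEFin.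
Qed.

(** The integrating factor: f' = - p' f has the first integral f exp p. *)
Lemma linear_ode_invariant (R : realType) (f p p' : R -> R) :
  (forall x : R, is_derive x 1 f (- p' x * f x)) ->
  (forall x : R, is_derive x 1 p (p' x)) ->
  forall x y, f x * expR (p x) = f y * expR (p y).
Proof.
move=> df dp x y.
apply: (@is_derive_0_is_cst R (f * (expR \o p))) => z.
have dep : is_derive z 1 (expR \o p) (expR (p z) * p' z).
  exact: is_derive1_comp.
apply: (is_derive_eq (is_deriveM (df z) dep)).
by rewrite /GRing.scale/=; ring.
Qed.

Section gaussian_moments.
Context (R : realType) (d : nat) (m : {measure set (borel 'rV[R]_d) -> \bar R}).
Hypothesis m_inv : forall (x : 'rV[R]_d) (E : set (borel 'rV[R]_d)),
  measurable E -> m [set x + y | y in (E : set 'rV[R]_d)] = m E.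
Hypothesis m_fin : forall K : set 'rV[R]_d, compact K -> (m K < +oo)%E.
Implicit Types (alpha : 'M[R]_d) (w y c : 'rV[R]_d).

Definition gauss_int alpha : R := \int[m]_y expR (- qform alpha y).

Lemma gauss_continuous alpha : continuous (fun y => expR (- qform alpha y)).
Proof.
move=> y; apply: (@continuous_comp _ _ _ (fun y => - qform alpha y) expR).
  by apply: continuousN; exact: qform_continuous.
exact: continuous_expR.
Qed.

Lemma integrable_gauss_dominated alpha (us : seq 'rV[R]_d) (C : R) (f : 'rV[R]_d -> R) :
  posdefmx alpha -> continuous f ->
  (forall y, `|f y| <= C * \prod_(u <- us) ch u y * expR (- qform alpha y)) ->
  m.-integrable setT (EFin \o f).
Proof.
move=> pa cf fC.
have := integrableZl measurableT C (integrable_ch m_inv m_fin pa us 0).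
apply: le_integrable => //.
  by apply/measurable_EFinP; exact: borel_continuous_measurable_real.
move=> y _ /=; rewrite lee_fin (le_trans (fC y))//.
by rewrite dot0l addr0 mulrA ler_norm.
Qed.

Lemma integrable_gauss alpha : posdefmx alpha ->
  m.-integrable setT (EFin \o (fun y : 'rV[R]_d => expR (- qform alpha y))).
Proof.
move=> pa; apply: (@integrable_gauss_dominated alpha [::] 1) => //.
  exact: gauss_continuous.
by move=> y; rewrite big_nil !mul1r ger0_norm ?expR_ge0.
Qed.

Lemma coord_le_ch (y : 'rV[R]_d) k : `|y ord0 k| <= ch (delta_mx ord0 k) y.
Proof. by rewrite -dot_delta normr_le_ch. Qed.

(** Summing over k Stein's identity for the coordinate function y_k in the
    direction of the k-th basis vector. *)
Lemma gauss_second_moment alpha : posdefmx alpha ->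
  2 * \int[m]_y (qform alpha y * expR (- qform alpha y)) = d%:R * gauss_int alpha.
Proof.
move=> pa.
pose e (k : 'I_d) : 'rV[R]_d := delta_mx ord0 k.
pose f (k : 'I_d) (y : 'rV[R]_d) := dot (e k *m alpha) y * y ord0 k * expR (- qform alpha y).
have cf k : continuous (f k).
  move=> y; apply: (continuousM _ (@gauss_continuous alpha y)).
  by apply: (continuousM (@dot_continuous _ _ (e k *m alpha) y)); exact: coord_continuous.
have fi k : m.-integrable setT (EFin \o (f k : borel 'rV[R]_d -> R)).
  apply: (@integrable_gauss_dominated alpha [:: e k *m alpha; e k] 1) => // y.
  rewrite /f normrM (ger0_norm (expR_ge0 _)) ler_wpM2r ?expR_ge0//.
  rewrite mul1r !big_cons big_nil mulr1 normrM ler_pM//.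
    exact: normr_le_ch.
  exact: coord_le_ch.
have key k : gauss_int alpha = 2 * \int[m]_y f k y.
  have [sa _] := pa.
  have st := @stein_identity R d m m_inv m_fin alpha pa (fun y => y ord0 k) (fun=> 1)
    (e k) (e k) 1 ler01.
  have {}st : \int[m]_y ((1 - 2 * dot (e k *m alpha) y * (y : 'rV[R]_d) ord0 k) *
      expR (- qform alpha y)) = 0.
    apply: st.
    - exact: coord_continuous.
    - by move=> y; exact: cst_continuous.
    - move=> t y; rewrite (_ : (fun t => _) = fun t => t + y ord0 k).
        by apply: is_derive_eq; rewrite addr0.
      by apply/funext => s; rewrite !mxE !eqxx mulr1.
    - by move=> y; rewrite mul1r coord_le_ch.
    - by move=> y; rewrite normr1 mul1r ch_ge1.
  apply/eqP; rewrite -subr_eq0 -RintegralZl// /gauss_int -RintegralB//; last 2 first.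
  - exact: integrable_gauss.
  - have := integrableZl measurableT 2 (fi k).
    by congr (_.-integrable _ _); apply/funext => y.
  rewrite -st; apply/eqP/eq_Rintegral => y _.
  by rewrite /f; ring.
have -> : \int[m]_y (qform alpha y * expR (- qform alpha y)) =
    \sum_(k < d) \int[m]_y f k y.
  rewrite -Rintegral_sum//; apply: eq_Rintegral => y _.
  rewrite -mulr_suml; congr (_ * _).
  rewrite qform_dot dotC dotE; apply: eq_bigr => k _.
  rewrite mulrC; congr (_ * _).
  have [sa _] := pa; rewrite dot_mulmxC dot_delta sa.
  by [].
rewrite mulr_sumr (eq_bigr (fun=> gauss_int alpha)); last by move=> k _; rewrite -key.
by rewrite sumr_const card_ord mulr_natl.
Qed.

(** Differentiating in [s] brings down - Q, whose integral is the second moment. *)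
Lemma is_derive_gauss_int alpha (s : R) : posdefmx alpha -> 0 < s ->
  is_derive s 1 (fun s => gauss_int (s *: alpha)) (- (d%:R / 2 / s) * gauss_int (s *: alpha)).
Proof.
move=> pa s0.
have -> : - (d%:R / 2 / s) * gauss_int (s *: alpha) =
    \int[m]_y (- qform alpha y * expR (- qform (s *: alpha) y)).
  have /esym := gauss_second_moment (posdefZ s0 pa).
  move=> H; apply: (@mulfI _ (- (2 * s))); first by rewrite oppr_eq0 mulf_neq0 ?gt_eqF.
  transitivity (d%:R * gauss_int (s *: alpha)); first by field; rewrite gt_eqF.
  rewrite H mulNr -mulrA -mulrN; congr (_ * _).
  rewrite -mulNr -RintegralZl//.
    by apply: eq_Rintegral => y _; rewrite qformZmx; ring.
  apply: (@integrable_gauss_dominated (s / 2 *: alpha) [::] (2 / s)) => //.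
  - by apply: posdefZ => //; rewrite divr_gt0.
  - move=> y; have hN : {for y, continuous (fun y => - qform alpha y)}.
      by apply: continuousN; exact: qform_continuous.
    exact: (continuousM hN (@gauss_continuous (s *: alpha) y)).
  - move=> y; rewrite big_nil mulr1 !qformZmx normrM normrN (ger0_norm (expR_ge0 _)).
    rewrite (ger0_norm (posdef_ge0 _ pa)) -ler_pdivrMl ?divr_gt0// invf_div.
    rewrite mulrA (_ : - (s * _) = - (s / 2 * qform alpha y) + - (s / 2 * qform alpha y)); last by field.
    rewrite expRD mulrA ler_piMl ?expR_ge0//.
    rewrite expRN ler_pdivrMr ?expR_gt0// mul1r.
    by rewrite (le_trans _ (expR_ge1Dx _))// lerDr.
have s40 : 0 < s / 4 by rewrite divr_gt0.
have Q0 y := posdef_ge0 y pa.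
(* A factor Q is absorbed by exp (s Q / 4), which leaves the rate x - s / 4 > s / 4. *)
have Qexp y (x : R) : s / 2 < x < 2 * s ->
    qform alpha y * expR (- (x * qform alpha y)) <= 4 / s * expR (- (s / 4 * qform alpha y)).
  move=> /andP[sx _]; rewrite -ler_pdivrMl ?divr_gt0// invf_div mulrA.
  apply: (@le_trans _ _ (expR (s / 4 * qform alpha y) * expR (- (x * qform alpha y)))).
    by rewrite ler_wpM2r ?expR_ge0// (le_trans _ (expR_ge1Dx _))// lerDr.
  rewrite -expRD ler_expR.
  have : 0 <= (x - s / 2) * qform alpha y by rewrite mulr_ge0// subr_ge0 ltW.
  by lra.
apply: (@is_derive_integral _ _ _ m (fun s (y : borel 'rV[R]_d) => expR (- qform (s *: alpha) y))
  (fun s (y : borel 'rV[R]_d) => - qform alpha y * expR (- qform (s *: alpha) y))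
  s (s / 2) (2 * s)
  (fun y : borel 'rV[R]_d => (1 + 4 / s) * expR (- qform (s / 4 *: alpha) y))).
- by apply/andP; split; lra.
- move=> x _; apply: (@borel_continuous_measurable_real _ _ (fun y => expR (- qform (x *: alpha) y))).
  exact: gauss_continuous.
- move=> x y _; rewrite (_ : (fun s => _) = expR \o (fun s => - (s * qform alpha y))); last first.
    by apply/funext => z; rewrite /= qformZmx.
  apply: is_derive_eq; rewrite qformZmx /GRing.scale/=; ring.
- have := integrableZl measurableT (1 + 4 / s) (integrable_gauss (posdefZ s40 pa)).
  by congr (_.-integrable _ _); apply/funext => y.
- move=> x y /andP[xs _]; rewrite !qformZmx ger0_norm ?expR_ge0//.
  have h4 : 0 <= 4 / s by rewrite divr_ge0// ltW.
  rewrite -[leLHS]mul1r ler_pM ?expR_ge0 ?lerDl//.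
  by rewrite ler_expR lerN2 ler_wpM2r//; lra.
- move=> x y xs; rewrite !qformZmx normrM normrN (ger0_norm (Q0 y)) ger0_norm ?expR_ge0//.
  by rewrite (le_trans (Qexp y x xs))// ler_wpM2r ?expR_ge0// lerDr.
Qed.

(** In the variable t = ln s the derivative formula becomes a linear equation with
    constant coefficient - d / 2. *)
Lemma gauss_intZ alpha (s : R) : posdefmx alpha -> 0 < s ->
  gauss_int (s *: alpha) = s `^ (- (d%:R / 2)) * gauss_int alpha.
Proof.
move=> pa s0.
have h1 (t : R) : is_derive t 1 (fun t => gauss_int (expR t *: alpha))
    (- (d%:R / 2) * gauss_int (expR t *: alpha)).
  have h := is_derive_gauss_int pa (expR_gt0 t).
  apply: (is_derive_eq (is_derive1_comp h (is_derive_expR t))).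
  by field; rewrite gt_eqF ?expR_gt0.
have h2 (t : R) : is_derive t 1 (fun t => d%:R / 2 * t) (d%:R / 2 : R).
  by apply: is_derive_eq; rewrite /GRing.scale/=; ring.
have h0 : gauss_int (expR 0 *: alpha) * expR (d%:R / 2 * 0) = gauss_int alpha.
  by rewrite mulr0 expR0 scale1r mulr1.
have [t ->] : exists t, s = expR t by exists (ln s); rewrite lnK.
have <- := etrans (linear_ode_invariant h1 h2 t 0) h0.
have pE : expR t `^ (- (d%:R / 2)) * expR (d%:R / 2 * t) = 1.
  by rewrite /powR gt_eqF ?expR_gt0// expRK -expRD mulNr addNr expR0.
rewrite mulrCA pE [RHS]mulr1; reflexivity.
Qed.

End gaussian_moments.

(** * The Fourier transform of a Gaussian *)

Section gaussian_fourier.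
Context (R : realType) (d : nat) (m : {measure set (borel 'rV[R]_d) -> \bar R}).
Hypothesis m_inv : forall (x : 'rV[R]_d) (E : set (borel 'rV[R]_d)),
  measurable E -> m [set x + y | y in (E : set 'rV[R]_d)] = m E.
Hypothesis m_fin : forall K : set 'rV[R]_d, compact K -> (m K < +oo)%E.
Context (alpha : 'M[R]_d).
Hypothesis pa : posdefmx alpha.
Implicit Types (w y c : 'rV[R]_d).

Let qs w := qform (invmx alpha) w.

Lemma normr_sin (x : R) : `|sin x| <= 1.
Proof. by rewrite ler_norml sin_geN1 sin_le1. Qed.

Lemma normr_cos (x : R) : `|cos x| <= 1.
Proof. by rewrite ler_norml cos_geN1 cos_le1. Qed.

Let trig_continuous (g : R -> R) w (s : R) : continuous g ->
  continuous (fun y : 'rV[R]_d => g (s * dot w y)).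
Proof.
move=> cg y; apply: (@continuous_comp _ _ _ (fun y => s * dot w y) g); last exact: cg.
exact: (continuousM (@cst_continuous _ _ s y) (@dot_continuous _ _ w y)).
Qed.

Let trig_gauss_continuous (g : R -> R) w (s : R) : continuous g ->
  continuous (fun y : 'rV[R]_d => g (s * dot w y) * expR (- qform alpha y)).
Proof.
move=> cg y.
exact: (continuousM (@trig_continuous g w s cg y) (@gauss_continuous R d alpha y)).
Qed.

Let is_derive_trig (g g' : R -> R) w (s : R) :
  continuous g -> (forall x : R, is_derive x 1 g (g' x)) ->
  (forall x, `|g x| <= 1) -> (forall x, `|g' x| <= 1) ->
  is_derive s 1 (fun s => \int[m]_y (g (s * dot w y) * expR (- qform alpha y)))
    (\int[m]_y (dot w y * g' (s * dot w y) * expR (- qform alpha y))).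
Proof.
move=> cg dg g1 g'1.
have iG := integrable_ch m_inv m_fin pa [:: w] 0.
apply: (@is_derive_integral _ _ _ m
  (fun s (y : borel 'rV[R]_d) => g (s * dot w y) * expR (- qform alpha y))
  (fun s (y : borel 'rV[R]_d) => dot w y * g' (s * dot w y) * expR (- qform alpha y))
  s (s - 1) (s + 1) _ _ _ _ iG).
- by apply/andP; split; lra.
- move=> x _.
  exact: (borel_continuous_measurable_real (trig_gauss_continuous (w := w) (s := x) cg)).
- move=> x y _.
  have h1 : is_derive x 1 (fun s => s * dot w y) (dot w y).
    by apply: is_derive_eq; rewrite /GRing.scale/=; ring.
  have h2 := @is_derive1_comp _ g (fun s => s * dot w y) x _ _ (dg _) h1.
  have h3 := is_deriveM h2 (is_derive_cst (expR (- qform alpha y)) x 1).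
  by apply: (is_derive_eq h3); rewrite /GRing.scale/=; ring.
- move=> x y _; rewrite big_cons big_nil mulr1 dot0l addr0 normrM.
  rewrite (ger0_norm (expR_ge0 _)) ler_wpM2r ?expR_ge0//.
  by rewrite (le_trans (g1 _))// ch_ge1.
- move=> x y _; rewrite big_cons big_nil mulr1 dot0l addr0 !normrM.
  rewrite (ger0_norm (expR_ge0 _)) ler_wpM2r ?expR_ge0//.
  by rewrite -[leRHS]mulr1 ler_pM// normr_le_ch.
Qed.

(* Cosine and sine are treated together, as functions with g'' = - g. *)
Let fourier_trig (g g' : R -> R) w :
  continuous g -> (forall x : R, is_derive x 1 g (g' x)) ->
  continuous g' -> (forall x : R, is_derive x 1 g' (- g x)) ->
  (forall x, `|g x| <= 1) -> (forall x, `|g' x| <= 1) ->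
  \int[m]_y (g (dot w y) * expR (- qform alpha y)) =
  g 0 * expR (- (qs w / 4)) * gauss_int m alpha.
Proof.
move=> cg dg cg' dg' g1 g'1.
(* In this direction 2 c alpha = w, so Stein's identity for g' (s w . y) expresses
   the derivative in s of the transform F s by F s itself. *)
pose c := 2^-1 *: (w *m invmx alpha).
have ca : 2 *: (c *m alpha) = w.
  by rewrite -scalemxAl mulmxKV ?posdef_unit// scalerA divff// scale1r.
have wc : dot w c = qs w / 2 by rewrite /qs qform_dot /c dotZr mulrC dotC.
pose F (s : R) : R := \int[m]_y (g (s * dot w y) * expR (- qform alpha y)).
have ig (f : R -> R) s : continuous f -> (forall x, `|f x| <= 1) ->
    m.-integrable setT (EFin \o ((fun y => f (s * dot w y) * expR (- qform alpha y)) : borel 'rV[R]_d -> R)).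
  move=> cf f1; apply: (@integrable_gauss_dominated _ _ _ m_inv m_fin alpha [::] 1) => //.
    exact: trig_gauss_continuous.
  move=> y; rewrite big_nil !mul1r normrM (ger0_norm (expR_ge0 _)).
  by rewrite ler_piMl ?expR_ge0.
have iwg (s : R) : m.-integrable setT (EFin \o ((fun y => dot w y * g' (s * dot w y) *
    expR (- qform alpha y)) : borel 'rV[R]_d -> R)).
  apply: (@integrable_gauss_dominated _ _ _ m_inv m_fin alpha [:: w] 1) => //.
    move=> y; exact: (continuousM (continuousM (@dot_continuous _ _ w y)
      (@trig_continuous g' w s cg' y)) (@gauss_continuous R d alpha y)).
  move=> y; rewrite big_cons big_nil mul1r mulr1 !normrM (ger0_norm (expR_ge0 _)).
  rewrite ler_wpM2r ?expR_ge0//.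
  by rewrite -[leRHS]mulr1 ler_pM// normr_le_ch.
have dF (s : R) : is_derive s 1 F (- (s * (qs w / 2)) * F s).
  apply: (is_derive_eq (is_derive_trig w s cg dg g1 g'1)).
  have st := @stein_identity R d m m_inv m_fin alpha pa
    (fun y => g' (s * dot w y)) (fun y => - (s * dot w c) * g (s * dot w y)) c 0
    (1 + `|s * dot w c|).
  have {}st : \int[m]_y ((- (s * dot w c) * g (s * dot w y)
      - 2 * dot (c *m alpha) y * g' (s * dot w y)) * expR (- qform alpha y)) = 0.
    apply: st.
    - by rewrite addr_ge0.
    - exact: trig_continuous.
    - move=> y; exact: (continuousM (@cst_continuous _ _ (- (s * dot w c)) y)
        (@trig_continuous g w s cg y)).
    - move=> t y.
      have h1 : is_derive t 1 (fun t => s * dot w (t *: c + y)) (s * dot w c).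
        rewrite (_ : (fun t => s * dot w (t *: c + y)) =
          (fun t => s * dot w c * t + s * dot w y)); last first.
          by apply/funext => z; rewrite dotDr dotZr; ring.
        by apply: is_derive_eq; rewrite /GRing.scale/=; ring.
      apply: (is_derive_eq (@is_derive1_comp _ g' (fun t => s * dot w (t *: c + y)) t _ _ (dg' _) h1)); ring.
    - move=> y; rewrite -[leLHS]mulr1 ler_pM ?ch_ge1//.
      by rewrite (le_trans (g'1 _))// lerDl.
    - move=> y; rewrite -[leLHS]mulr1 ler_pM ?ch_ge1// normrM normrN.
      by rewrite (@le_trans _ _ `|s * dot w c|) ?lerDr// ler_piMr.
  have E1 : \int[m]_y (- (s * dot w c) * (g (s * dot w y) * expR (- qform alpha y))
     - dot w y * g' (s * dot w y) * expR (- qform alpha y)) = 0.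
    rewrite -[RHS]st; apply: eq_Rintegral => y _.
    have -> : 2 * dot (c *m alpha) y = dot w y by rewrite -dotZl ca.
    by ring.
  have i1 : m.-integrable setT (EFin \o ((fun y => - (s * dot w c) *
     (g (s * dot w y) * expR (- qform alpha y))) : borel 'rV[R]_d -> R)).
    have := integrableZl measurableT (- (s * dot w c)) (ig g s cg g1).
    by congr (_.-integrable _ _); apply/funext => y.
  rewrite RintegralB// in E1.
  rewrite RintegralZl// in E1; last exact: ig.
  by move/eqP: E1; rewrite subr_eq0 => /eqP <-; rewrite wc.
have dp (s : R) : is_derive s 1 (fun s => qs w / 4 * s ^+ 2) (s * (qs w / 2)).
  by apply: is_derive_eq; rewrite /GRing.scale/=; field.
have F0 : F 0 * expR (qs w / 4 * 0 ^+ 2) = g 0 * gauss_int m alpha.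
  rewrite expr0n mulr0 expR0 mulr1 /F /gauss_int -RintegralZl//; last exact: integrable_gauss.
  by apply: eq_Rintegral => y _; rewrite mul0r.
have := etrans (linear_ode_invariant dF dp 1 0) F0.
rewrite expr1n mulr1 mulrAC => <-; rewrite -mulrA.
have -> : expR (qs w / 4) * expR (- (qs w / 4)) = 1 by rewrite -expRD subrr expR0.
by rewrite [RHS]mulr1; apply: eq_Rintegral => y _; rewrite mul1r.
Qed.

Lemma gauss_fourier_cos w :
  \int[m]_y (cos (dot w y) * expR (- qform alpha y)) =
  expR (- (qform (invmx alpha) w / 4)) * gauss_int m alpha.
Proof.
rewrite (@fourier_trig cos (fun x => - sin x)) ?cos0 ?mul1r//.
- exact: continuous_cos.
- by move=> x; apply: continuousN; exact: continuous_sin.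
- exact: normr_cos.
- by move=> x; rewrite normrN normr_sin.
Qed.

Lemma gauss_fourier_sin w :
  \int[m]_y (sin (dot w y) * expR (- qform alpha y)) = 0.
Proof.
rewrite (@fourier_trig sin cos) ?sin0 ?mul0r//.
- exact: continuous_sin.
- exact: continuous_cos.
- exact: normr_sin.
- exact: normr_cos.
Qed.

End gaussian_fourier.

(** * The complex plane and the unit circle *)

Section complex_topology.
Context (R : realType).
Implicit Types (z w : R[i]).
Local Notation Re := (@complex.Re R).
Local Notation Im := (@complex.Im R).

Lemma normr_normc z : `|z| = (Normc.normc z)%:C.
Proof. by rewrite normc_def; case: z. Qed.

Lemma normc_ge0 z : 0 <= Normc.normc z.
Proof. by rewrite -ler0c -normr_normc. Qed.

Lemma normc_sqr z : Normc.normc z ^+ 2 = Re z ^+ 2 + Im z ^+ 2.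
Proof.
apply: complexI; rewrite add_Re2_Im2 normr_normc.
by rewrite rmorphXn.
Qed.

Lemma normc1P z : (`|z| = 1) <-> Re z ^+ 2 + Im z ^+ 2 = 1.
Proof.
rewrite normr_normc -normc_sqr; split=> [[->]|/eqP].
  by rewrite expr1n.
by rewrite sqrp_eq1 ?normc_ge0// => /eqP ->.
Qed.

Lemma normr_Re_le z : `|Re z| <= Normc.normc z.
Proof. by rewrite -lecR -normr_normc normc_ge_Re. Qed.

Lemma normr_Im_le z : `|Im z| <= Normc.normc z.
Proof.
rewrite -(ler_pXn2r (ltn0Sn 1)) ?nnegrE ?normc_ge0// normc_sqr real_normK ?num_real//.
by rewrite lerDr sqr_ge0.
Qed.

Lemma normc_le_add z : Normc.normc z <= `|Re z| + `|Im z|.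
Proof.
rewrite -(ler_pXn2r (ltn0Sn 1)) ?nnegrE ?normc_ge0 ?addr_ge0// normc_sqr sqrrD.
rewrite !real_normK ?num_real//.
by rewrite addrAC lerDl mulrn_wge0// mulr_ge0.
Qed.

Lemma nbhs_complexP z (A : set R[i]) :
  nbhs z A <-> exists2 e : R, 0 < e & forall w, Normc.normc (z - w) < e -> A w.
Proof.
split=> [/nbhs_ballP[e /= e0 eA]|[e e0 eA]].
  have eE : e = (Re e)%:C by rewrite RRe_real ?gtr0_real.
  exists (Re e); first by rewrite -ltcR -eE.
  by move=> w zw; apply: eA; rewrite -ball_normE /= eE normr_normc ltcR.
apply/nbhs_ballP; exists e%:C => /=; first by rewrite ltcR.
by move=> w; rewrite -ball_normE /= normr_normc ltcR; exact: eA.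
Qed.

Lemma Re_continuous : continuous (Re : R[i] -> R).
Proof.
move=> z A /nbhs_ballP[e /= e0 eA]; apply/nbhs_complexP; exists e => // w zw.
apply: eA; rewrite -ball_normE /=; apply: le_lt_trans zw.
by rewrite (le_trans _ (normr_Re_le _))//; case: z; case: w.
Qed.

Lemma Im_continuous : continuous (Im : R[i] -> R).
Proof.
move=> z A /nbhs_ballP[e /= e0 eA]; apply/nbhs_complexP; exists e => // w zw.
apply: eA; rewrite -ball_normE /=; apply: le_lt_trans zw.
by rewrite (le_trans _ (normr_Im_le _))//; case: z; case: w.
Qed.

Lemma complex_continuous (T : topologicalType) (a b : T -> R) :
  continuous a -> continuous b -> continuous (fun x => a x +i* b x : R[i]).
Proof.
move=> ca cb x A /nbhs_complexP[e e0 eA].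
have e20 : 0 < e / 2 by rewrite divr_gt0.
have na : \forall y \near x, ball (a x) (e / 2) (a y) := ca x _ (nbhsx_ballx (a x) (e / 2) e20).
have nb : \forall y \near x, ball (b x) (e / 2) (b y) := cb x _ (nbhsx_ballx (b x) (e / 2) e20).
change (\forall y \near x, A (a y +i* b y)).
near=> y; have ay : ball (a x) (e / 2) (a y) by near: y.
have bxy : ball (b x) (e / 2) (b y) by near: y.
move: ay bxy; rewrite -!ball_normE /= => ay bxy.
apply: eA; apply: (le_lt_trans (normc_le_add _)) => /=.
by rewrite [ltRHS]splitr ltrD.
Unshelve. all: by end_near. Qed.

Definition cis (t : R) : R[i] := cos t +i* sin t.

Lemma cisD s t : cis (s + t) = cis s * cis t.
Proof.
by rewrite /cis cosD sinD (addrC (sin s * cos t)).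
Qed.

Lemma cis0 : cis 0 = 1.
Proof. by rewrite /cis cos0 sin0. Qed.

Lemma normr_cis t : `|cis t| = 1.
Proof. by apply/normc1P; rewrite /= cos2Dsin2. Qed.

Lemma conj_cis t : (cis t)^* = cis (- t).
Proof. by rewrite /cis cosN sinN. Qed.

Lemma cis_continuous : continuous cis.
Proof. apply: complex_continuous; [exact: continuous_cos|exact: continuous_sin]. Qed.

Lemma cis_sum (I : Type) (r : seq I) (f : I -> R) :
  cis (\sum_(i <- r) f i) = \prod_(i <- r) cis (f i).
Proof.
elim: r => [|i r ih]; first by rewrite !big_nil cis0.
by rewrite !big_cons cisD ih.
Qed.

(** The circle has no small subgroups: squaring at least doubles 1 - Re z as
    long as the powers stay in the right half plane, which forces Re z = 1. *)
Lemma unit_Re_powers_eq1 z : `|z| = 1 -> (forall n, 0 < Re (z ^+ n)) -> z = 1.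
Proof.
move=> z1 pz.
have z1n n : `|z ^+ n| = 1 by rewrite normrX z1 expr1n.
have Re2 w : `|w| = 1 -> Re (w ^+ 2) = 2 * Re w ^+ 2 - 1.
  case: w => a b /normc1P /= ab.
  rewrite expr2 /= -!expr2 -{2}ab; ring.
have grow n : 2 ^+ n * (1 - Re z) <= 1 - Re (z ^+ (2 ^ n)).
  elim: n => [|n ih]; first by rewrite expr0 mul1r expn0 expr1.
  rewrite exprS -mulrA expnSr exprM Re2//.
  have := pz (2 ^ n)%N; have := normr_Re_le (z ^+ (2 ^ n)).
  have -> : Normc.normc (z ^+ (2 ^ n)) = 1.
    by apply: complexI; rewrite -normr_normc z1n.
  rewrite ler_norml => /andP[_]; set a := Re (z ^+ _) in ih *.
  move=> a1 a0; nra.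
have Rez : Re z <= 1.
  rewrite (le_trans (ler_norm _))// (le_trans (normr_Re_le _))//.
  by rewrite -lecR -normr_normc z1.
have Rez1 : Re z = 1.
  apply/eqP; rewrite eq_le Rez /= -subr_le0 leNgt; apply/negP => b0.
  have [n hn] : exists n : nat, (1 - Re z)^-1 <= 2 ^+ n.
    exists (Num.truncn (1 - Re z)^-1).+1; rewrite ltW// (lt_le_trans (truncnS_gt _))//.
    by rewrite -natrX ler_nat ltnW// ltn_expl.
  have := pz (2 ^ n)%N; have := grow n.
  have : 1 <= 2 ^+ n * (1 - Re z) by rewrite -ler_pdivrMr// div1r.
  lra.
move/normc1P : z1; rewrite Rez1 expr1n => /eqP.
rewrite -subr_eq0 addrAC subrr add0r sqrf_eq0 => /eqP Imz.
by case: z Rez1 Imz {pz z1n grow Rez} => a b /= -> ->.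
Qed.

(** At t = pi / (c - c') the two sides differ by the factor -1. *)
Lemma cis_inj_line c c' : (forall t, cis (c * t) = cis (c' * t)) -> c = c'.
Proof.
move=> cc'; apply/eqP; rewrite -subr_eq0; apply/negPn/negP => h.
have : cis ((c - c') * (pi / (c - c'))) = 1.
  rewrite mulrBl cisD cc' -conj_cis.
  by rewrite -sqr_normc normr_cis expr1n.
rewrite mulrC divfK// /cis cospi => -[] /eqP; rewrite eqNr.
by rewrite oner_eq0.
Qed.

End complex_topology.

(** * Characters of the real line *)

Section real_characters.
Context (R : realType).
Local Notation Re := (@complex.Re R).
Local Notation Im := (@complex.Im R).

Lemma normc_lt1_Re (z : R[i]) : Normc.normc (1 - z) < 1 -> 0 < Re z.
Proof.
move=> h; have := normr_Re_le (1 - z); case: z h => a b /= h.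
move=> /le_lt_trans /(_ h); rewrite ltr_norml => /andP[_]; lra.
Qed.

Lemma sqr_unit_Re_inj (z w : R[i]) : 0 < Re z -> 0 < Re w -> z ^+ 2 = w ^+ 2 -> z = w.
Proof.
move=> z0 w0 /eqP; rewrite eqf_sqr => /orP[/eqP//|/eqP zw].
exfalso; move: z0; rewrite zw; case: w w0 {zw} => a b /= a0.
by rewrite oppr_gt0 ltNge ltW.
Qed.

Lemma cos_gt0_half (t : R) : `|t| < pi / 2 -> 0 < cos t.
Proof. by rewrite ltr_norml => h; exact: cos_gt0_pihalf. Qed.

(** Near 0 the values of f lie in the right half plane, where square roots are
    unique.  So f agrees with t -> cis (c t) at r / 2^n for a suitable c, hence on
    a dense subgroup, and everywhere by continuity. *)
Lemma real_character (f : R -> R[i]) :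
  continuous f -> (forall t, `|f t| = 1) -> (forall s t, f (s + t) = f s * f t) ->
  exists c, forall t, f t = cis (c * t).
Proof.
move=> cf f1 fD.
have f0 : f 0 = 1.
  have fn0 : f 0 != 0 by rewrite -normr_eq0 f1 oner_eq0.
  by apply: (mulfI fn0); rewrite -fD addr0 mulr1.
have /nbhs_ballP[r2 /= r20 fr] : nbhs (0 : R) (f @^-1` [set w | Normc.normc (f 0 - w) < 1]).
  by apply: cf; apply/nbhs_complexP; exists 1.
have Ref t : `|t| < r2 -> 0 < Re (f t).
  move=> tr; apply: normc_lt1_Re; rewrite -f0; apply: fr.
  by rewrite -ball_normE /= sub0r normrN.
pose r := r2 / 2.
have r0 : 0 < r by rewrite divr_gt0.
have rn n : 0 < r / 2 ^+ n by rewrite divr_gt0 ?exprn_gt0.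
have rnr n : `|r / 2 ^+ n| < r2.
  rewrite gtr0_norm// (@le_lt_trans _ _ r)//.
    by rewrite ler_pdivrMr ?exprn_gt0// ler_peMr ?exprn_ege1 ?ler1n// ltW.
  by rewrite /r ltr_pdivrMr// ltr_pMr// ltr1n.
have Rer : 0 < Re (f r) by have := Ref _ (rnr 0); rewrite expr0 divr1.
have abr : Re (f r) ^+ 2 + Im (f r) ^+ 2 = 1 by apply/normc1P.
have Imr : -1 < Im (f r) < 1.
  by apply/andP; split; nra.
have [theta [fr_theta theta_lt]] : exists theta, f r = cis theta /\ `|theta| < pi / 2.
  exists (asin (Im (f r))).
  have Imr' : -1 <= Im (f r) <= 1 by case/andP: Imr => /ltW -> /ltW ->.
  split.
    rewrite /cis asinK ?in_itv//= cos_asin//.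
    rewrite (_ : 1 - _ = Re (f r) ^+ 2); last by rewrite -abr; ring.
    by rewrite sqrtr_sqr gtr0_norm//; case: (f r).
  case/andP: Imr => h1 h2.
  by rewrite ltr_norml asin_gtNpi2 ?asin_ltpi2// ?h1 ?h2 ltW.
have half (x : R) n : x / 2 ^+ n.+1 + x / 2 ^+ n.+1 = x / 2 ^+ n.
  by rewrite exprS; field; rewrite expf_neq0.
pose c := theta / r.
(* The quotient of f by the candidate; it remains to show that it is trivial. *)
pose g t := f t * cis (- (c * t)).
have gD s t : g (s + t) = g s * g t by rewrite /g fD mulrDr opprD cisD mulrACA.
have fdy n : f (r / 2 ^+ n) = cis (theta / 2 ^+ n).
  elim: n => [|n ih]; first by rewrite expr0 !divr1.
  apply: sqr_unit_Re_inj; first exact: Ref.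
    apply: cos_gt0_half; rewrite normrM (ger0_norm (_ : 0 <= (2 ^+ n.+1)^-1)).
      rewrite (le_lt_trans _ theta_lt)// ler_piMr// invf_le1 ?exprn_gt0//.
      by rewrite exprn_ege1// ler1n.
    by rewrite invr_ge0 exprn_ge0.
  by rewrite !expr2 -fD -cisD (half r) (half theta).
have gdy n : g (r / 2 ^+ n) = 1.
  rewrite /g fdy /c (_ : theta / r * (r / 2 ^+ n) = theta / 2 ^+ n).
    by rewrite -conj_cis -sqr_normc normr_cis expr1n.
  by rewrite mulrA divfK ?gt_eqF.
have g0 : g 0 = 1 by rewrite /g mulr0 oppr0 f0 cis0 mulr1.
have gN t : g (- t) = (g t)^-1.
  apply: (mulfI (_ : g t != 0)); first by rewrite /g mulf_neq0// -normr_eq0 ?f1 ?normr_cis oner_eq0.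
  by rewrite -gD subrr g0 mulfV// /g mulf_neq0// -normr_eq0 ?f1 ?normr_cis oner_eq0.
have gnat (k : nat) t : g (k%:R * t) = g t ^+ k.
  elim: k => [|k ih]; first by rewrite mul0r g0 expr0.
  by rewrite -natr1 mulrDl mul1r gD ih exprSr.
have gint (k : int) t : g t = 1 -> g (k%:~R * t) = 1.
  move=> gt1; case: k => k; first by rewrite gnat gt1 expr1n.
  by rewrite NegzE mulrNz mulNr gN gnat gt1 expr1n invr1.
have cg : {for 0, continuous g}.
  apply: cvgM; first exact: cf.
  apply: (@continuous_comp _ _ _ (fun t => - (c * t)) (@cis R)); last exact: cis_continuous.
  apply: continuousN.
  exact: (continuousM (@cst_continuous _ _ c (0:R)) (@cvg_id _ (nbhs (0:R)))).
have gsmall t (e : R) : 0 < e -> Normc.normc (1 - g t) < e.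
  move=> e0.
  have /nbhs_ballP[del /= del0 gdel] : nbhs (0 : R) (g @^-1` [set w | Normc.normc (g 0 - w) < e]).
    by apply: cg; apply/nbhs_complexP; exists e.
  have [n hn] : exists n : nat, r / 2 ^+ n < del.
    exists (Num.truncn (r / del)).+1.
    rewrite ltr_pdivrMr ?exprn_gt0// mulrC -ltr_pdivrMr// (lt_le_trans (truncnS_gt _))//.
    by rewrite -natrX ler_nat ltnW// ltn_expl.
  pose s := r / 2 ^+ n; have s0 : 0 < s := rn n.
  (* Removing a multiple of s, where g is 1, moves t into the neighborhood of 0. *)
  pose k := Num.floor (t / s).
  have gE : g t = g (t - k%:~R * s).
    by rewrite gD -mulNr -mulrNz (gint _ _ (gdy n)) mulr1.
  have := @gdel (t - k%:~R * s); rewrite g0 gE; apply.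
  rewrite -ball_normE /= sub0r normrN.
  have kt : k%:~R * s <= t by rewrite -ler_pdivlMr// ge_floor.
  rewrite ger0_norm ?subr_ge0// (lt_trans _ hn)//.
  rewrite ltrBlDr -[X in X + _]mul1r -mulrDl addrC -ltr_pdivrMr//.
  by rewrite -[1]/(1%:~R) -intrD floorD1_gt.
have g1 t : g t = 1.
  apply/eqP; rewrite eq_sym -subr_eq0 -normr_eq0 normr_normc.
  have [//|/eqP n0] := eqVneq (Normc.normc (1 - g t)) 0; first by move=> ->.
  have := gsmall t _ (_ : 0 < Normc.normc (1 - g t)); rewrite ltxx => H.
  by exfalso; suff: false by []; apply: H; rewrite lt_neqAle normc_ge0 eq_sym andbT; apply/eqP.
exists c => t; have := g1 t; rewrite /g -conj_cis => H.
rewrite -[LHS]mulr1 -[1](expr1n _ 2) -(normr_cis (c * t)) sqr_normc.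
by rewrite (mulrC (cis _)) mulrA H mul1r.
Qed.

End real_characters.

(** * The dual of a topological group *)

Section dual_basics.
Context (R : realType) (B : topologicalZmodType).
Implicit Types (xi eta : dual R B).

Lemma dual_continuous xi : continuous xi.
Proof. by have [] := dualP xi. Qed.

Lemma dual_norm xi x : `|xi x| = 1.
Proof. by have [] := dualP xi. Qed.

Lemma dual_add xi x y : xi (x + y) = xi x * xi y.
Proof. by have [] := dualP xi. Qed.

Lemma dual_neq0 xi x : xi x != 0.
Proof. by rewrite -normr_eq0 dual_norm oner_eq0. Qed.

Lemma dual_zero xi : xi 0 = 1.
Proof. by apply: (mulfI (dual_neq0 xi 0)); rewrite -dual_add addr0 mulr1. Qed.

Lemma dual_mulrn xi x n : xi (x *+ n) = xi x ^+ n.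
Proof.
elim: n => [|n ih]; first by rewrite mulr0n dual_zero expr0.
by rewrite mulrSr dual_add ih exprSr.
Qed.

Lemma dual_sum xi (I : Type) (r : seq I) (f : I -> B) :
  xi (\sum_(i <- r) f i) = \prod_(i <- r) xi (f i).
Proof.
elim: r => [|i r ih]; first by rewrite !big_nil dual_zero.
by rewrite !big_cons dual_add ih.
Qed.

Lemma dual_conjM xi x : xi x * (xi x)^* = 1.
Proof. by rewrite -sqr_normc dual_norm expr1n. Qed.

Lemma dual_addE xi eta x : (xi + eta) x = xi x * eta x. Proof. by []. Qed.

Lemma dual_oppE xi x : (- xi) x = (xi x)^*. Proof. by []. Qed.

(** A character close to [xi] on [K] differs from it by values whose powers all
    lie in the right half plane, as [K] is stable under multiples; these values
    are then 1. *)
Lemma dual_locally_constant (K : set B) xi : compact K ->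
  (forall x n, K x -> K (x *+ n)) ->
  nbhs xi [set eta : dual R B | forall x, K x -> eta x = xi x].
Proof.
move=> cK Kn.
have := dual_nbhs_uniform xi cK (@ltr01 R[i]).
apply: filterS => eta /= h x Kx.
suff : (xi x)^* * eta x = 1.
  by move=> e; rewrite -[LHS]mul1r -(dual_conjM xi x) -mulrA e mulr1.
apply: unit_Re_powers_eq1; first by rewrite normrM normcJ !dual_norm mulr1.
move=> n; apply: normc_lt1_Re.
rewrite -ltcR -normr_normc exprMn -rmorphXn/= -!dual_mulrn.
have := h _ (Kn x n Kx); set y := x *+ n.
rewrite -[X in X < _](mul1r) -{1}(dual_norm xi y) -(normcJ (xi y)) -normrM.
by rewrite mulrBr (mulrC _ (xi y)) dual_conjM.
Qed.

Lemma dual_hausdorff : hausdorff_space (dual R B).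
Proof.
move=> xi eta cl; apply: dual_ext => x; apply/eqP/negPn/negP => xex.
pose e := Normc.normc (xi x - eta x) / 2.
have e0 : 0 < e.
  rewrite divr_gt0// lt_neqAle normc_ge0 andbT eq_sym.
  apply: contra xex => /eqP h; rewrite -subr_eq0 -normr_eq0 normr_normc h.
  by [].
pose U (chi : dual R B) := [set z : dual R B | forall y, [set x] y -> `|chi y - z y| < e%:C].
have nU chi : nbhs chi (U chi).
  by apply: dual_nbhs_uniform; [exact: compact_set1|rewrite ltcR].
have [z [/(_ x erefl) h1 /(_ x erefl) h2]] := cl _ _ (nU xi) (nU eta).
have : `|xi x - eta x| < e%:C + e%:C.
  rewrite -(subrKA (z x)) (le_lt_trans (ler_normD _ _))// ltrD//.
  by rewrite distrC.
by rewrite normr_normc -rmorphD ltcR /e -splitr ltxx.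
Qed.

End dual_basics.

Section subgroup_basics.
Context (R : realType) (B : topologicalZmodType) (H : zmodClosed B).

HB.instance Definition _ := isPointed.Build (subgroup H) 0.

Lemma subgroup_val_continuous : continuous (val : subgroup H -> B).
Proof. exact: initial_continuous. Qed.

Lemma subgroup_compact : compact [set x : B | x \in H] -> compact [set: subgroup H].
Proof.
move=> cH F FF _.
have PF : ProperFilter (val @ F) by exact: fmap_proper_filter.
have FH : (val @ F) [set x : B | x \in H].
  change (F ((val : subgroup H -> B) @^-1` [set x : B | x \in H])).
  by apply: (filterS _ (@filterT _ F _)) => h _ /=; exact: valP.
have [p [/= pH cp]] := cH _ PF FH.
pose q : subgroup H := exist _ p pH.
exists q; split => // A U FA qU.
have : nbhs q U := qU.
rewrite nbhsE => -[V [[W oW WV] Vq] VU].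
have Wp : nbhs p W by apply: open_nbhs_nbhs; split => //; move: Vq; rewrite -WV.
have FA' : (val @ F) (val @` A).
  change (F ((val : subgroup H -> B) @^-1` (val @` A))).
  by apply: (filterS _ FA) => h Ah /=; exists h.
have [_ [[h Ah <-] Wh]] := cp _ _ FA' Wp.
by exists h; split => //; apply: VU; rewrite -WV.
Qed.

Lemma subgroup_open (U : set (subgroup H)) : open [set x : B | x \in H] ->
  open U -> open [set val h | h in U].
Proof.
move=> oH [W oW <-].
rewrite (_ : [set val h | h in _] = W `&` [set x : B | x \in H]); first exact: openI.
apply/seteqP; split=> [_ [h /= Wh <-]|x [Wx Hx]]; first by split => //; exact: valP.
by exists (exist _ x Hx).
Qed.

(** The dual of a compact group is discrete, so a continuous map into it is
    locally constant. *)
Lemma compact_dual_fiber_open (phi : subgroup H -> dual R (subgroup H)) chi :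
  compact [set x : B | x \in H] -> continuous phi ->
  open [set h | phi h = chi].
Proof.
move=> cH cphi; apply: (@open_comp _ _ phi [set eta | eta = chi]); first by move=> x _; exact: cphi.
rewrite openE => _ ->; rewrite /interior.
have := dual_locally_constant chi (subgroup_compact cH) (fun _ _ _ => I).
by apply: filterS => eta e; apply: dual_ext => x; exact: e.
Qed.

(** The fibers form an open partition of a compact space. *)
Lemma compact_dual_range_finite (phi : subgroup H -> dual R (subgroup H)) :
  compact [set x : B | x \in H] -> continuous phi -> finite_set (range phi).
Proof.
move=> cH cphi; have := subgroup_compact cH.
rewrite compact_cover => /(_ _ setT (fun h => phi @^-1` [set chi | chi = phi h])).
case; first by move=> h _; exact: compact_dual_fiber_open.
  by move=> h _; exists h.
move=> D _ Dcov.
have fD : finite_set (phi @` [set` finmap.enum_fset D]).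
  exact/finite_image/finite_seq.
apply: sub_finite_set fD => _ [h _ <-].
by have [k kD /= ->] := Dcov h Logic.I; exists k.
Qed.

End subgroup_basics.

(** * Frequency and restriction of a character *)

Lemma prodg_hausdorff (A B : topologicalZmodType) :
  hausdorff_space A -> hausdorff_space B -> hausdorff_space (prodg A B).
Proof.
move=> hA hB [a b] [a' b'] cl.
have -> : a = a'.
  apply: hA => U V aU aV; have [] := cl (fst @^-1` U) (fst @^-1` V).
  - exact: (cvg_fst (F := nbhs a) (G := nbhs b) aU).
  - exact: (cvg_fst (F := nbhs a') (G := nbhs b') aV).
  by move=> z [/= h1 h2]; exists z.1.
have -> // : b = b'.
apply: hB => U V aU aV; have [] := cl (snd @^-1` U) (snd @^-1` V).
- exact: (cvg_snd (F := nbhs a) (G := nbhs b) aU).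
- exact: (cvg_snd (F := nbhs a') (G := nbhs b') aV).
by move=> z [/= h1 h2]; exists z.2.
Qed.

Lemma prodg_fst_continuous (A B : topologicalZmodType) :
  continuous (fst : prodg A B -> A).
Proof. by move=> z; exact: cvg_fst. Qed.

Lemma prodg_snd_continuous (A B : topologicalZmodType) :
  continuous (snd : prodg A B -> B).
Proof. by move=> z; exact: cvg_snd. Qed.

Lemma prodg_pair_continuous (T : topologicalType) (A B : topologicalZmodType)
    (f : T -> A) (g : T -> B) :
  continuous f -> continuous g -> continuous (fun x => (f x, g x) : prodg A B).
Proof. by move=> cf cg x; apply: cvg_pair; [exact: cf|exact: cg]. Qed.

Section frequency.
Context (R : realType) (d : nat) (A0 : topologicalZmodType).
Local Notation G := (prodg 'rV[R]_d A0).
Implicit Types (xi eta : dual R G).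

Lemma dual_prodg xi (z : G) : xi z = xi (z.1, 0) * xi (0, z.2).
Proof.
rewrite -dual_add; congr (dual_fun xi _).
case: z => x u; change ((x, u) = (x + 0, 0 + u) :> G).
by rewrite addr0 add0r.
Qed.

Lemma line_continuous (x : 'rV[R]_d) : continuous (fun t : R => (t *: x, 0) : G).
Proof.
apply: prodg_pair_continuous; last by move=> t; exact: cst_continuous.
by move=> t; apply: (@cvgZl _ _ _ _ _ (fun t : R => t) t x); exact: cvg_id.
Qed.

Lemma line_add (x : 'rV[R]_d) (s t : R) :
  ((s + t) *: x, 0) = (s *: x, 0) + (t *: x, 0) :> G.
Proof.
change (((s + t) *: x, 0) = (s *: x + t *: x, 0 + 0) :> G).
by rewrite scalerDl addr0.
Qed.

(** Each coordinate line carries a character of the real line. *)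
Lemma frequency_exists xi :
  exists w : 'rV[R]_d, forall x : 'rV[R]_d, xi (x, 0) = cis (dot w x).
Proof.
have hj (j : 'I_d) : exists c, forall t, xi (t *: delta_mx ord0 j, 0) = cis (c * t).
  apply: real_character.
  - move=> t; apply: (continuous_comp (@line_continuous _ t)).
    exact: dual_continuous.
  - by move=> t; rewrite dual_norm.
  - by move=> s t; rewrite line_add dual_add.
have [c hc] := choice hj.
exists (\row_j c j) => x.
have -> : ((x, 0) : G) = \sum_(j < d) ((x ord0 j *: delta_mx ord0 j, 0) : G).
  rewrite [in LHS](row_sum_delta x).
  elim: (index_enum _) => [|j r ih]; first by rewrite !big_nil.
  rewrite !big_cons -ih.
  change ((x ord0 j *: delta_mx ord0 j + \sum_(i <- r) x ord0 i *: delta_mx ord0 i, 0) =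
   (x ord0 j *: delta_mx ord0 j + \sum_(i <- r) x ord0 i *: delta_mx ord0 i, 0 + 0) :> G).
  by rewrite addr0.
rewrite dual_sum dotE cis_sum; apply: eq_bigr => j _.
by rewrite hc mxE.
Qed.

Definition freq xi : 'rV[R]_d := projT1 (cid (frequency_exists xi)).

Lemma freqP xi (x : 'rV[R]_d) : xi (x, 0) = cis (dot (freq xi) x).
Proof. by rewrite /freq; case: cid. Qed.

Lemma freq_unique xi w : (forall x : 'rV[R]_d, xi (x, 0) = cis (dot w x)) -> freq xi = w.
Proof.
move=> hw; apply/rowP => j; apply: cis_inj_line => t.
have := freqP xi (t *: delta_mx ord0 j); rewrite hw !dotZr !(dotC _ (delta_mx _ _)) !dot_delta.
by rewrite (mulrC _ t) (mulrC _ t).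
Qed.

Lemma freqD xi eta : freq (xi + eta) = freq xi + freq eta.
Proof. by apply: freq_unique => x; rewrite dual_addE !freqP dotDl cisD. Qed.

Lemma freqN xi : freq (- xi) = - freq xi.
Proof. by apply: freq_unique => x; rewrite dual_oppE !freqP dotNl conj_cis. Qed.

Lemma is_character_cis (w : 'rV[R]_d) : is_character (fun z : G => cis (dot w z.1)).
Proof.
split=> [z|z|y z].
- apply: (@continuous_comp _ _ _ (fun z : G => dot w z.1) (@cis R)); last exact: cis_continuous.
  apply: (continuous_comp (@prodg_fst_continuous _ _ z)); exact: dot_continuous.
- exact: normr_cis.
- by rewrite -cisD -dotDr.
Qed.

Definition modulation (w : 'rV[R]_d) : dual R G := Dual (is_character_cis w).

Lemma freq_modulation w : freq (modulation w) = w.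
Proof. exact: freq_unique. Qed.

(** If the frequencies of [xi] and [eta] differ by at least e in the j-th
    coordinate, then the two characters take opposite values at some point of the
    segment of half-length pi / e on that axis, so they are not uniformly close
    there. *)
Lemma freq_continuous : continuous freq.
Proof.
move=> xi A /nbhs_ballP[e /= e0 eA].
pose T := pi / e.
have T0 : 0 < T by rewrite divr_gt0// pi_gt0.
pose K (j : 'I_d) : set G := (fun t : R => (t *: delta_mx ord0 j, 0) : G) @` `[- T, T].
have cK j : compact (K j).
  apply: continuous_compact; last exact: segment_compact.
  by apply: continuous_subspaceT; exact: line_continuous.
have nK j := dual_nbhs_uniform xi (cK j) (@ltr01 R[i]).
suff : nbhs xi [set eta : dual R G | forall j, `|freq xi ord0 j - freq eta ord0 j| < e].
  apply: filterS => eta h; apply: eA; split=> // i j.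
  by rewrite ord1 -ball_normE /=; exact: h.
have := filter_forall (nbhs_filter xi) nK.
apply: filterS => eta h j; rewrite ltNge; apply/negP.
set del := freq xi ord0 j - freq eta ord0 j => he.
have del0 : del != 0 by rewrite -normr_gt0 (lt_le_trans e0).
(* At this time the two characters are opposite. *)
pose t := pi / del.
have tT : `|t| <= T.
  rewrite normrM normfV (ger0_norm (pi_ge0 R)) ler_pM2l ?pi_gt0//.
  by rewrite lef_pV2// posrE normr_gt0.
have /(_ ((t *: delta_mx ord0 j, 0) : G)) := h j.
have Kt : K j ((t *: delta_mx ord0 j, 0) : G).
  by exists t => //=; rewrite in_itv /= -ler_norml.
move=> /(_ Kt); rewrite !freqP !dotZr !(dotC _ (delta_mx _ _)) !dot_delta.
set a := freq xi ord0 j; set b := freq eta ord0 j.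
have tdel : t * del = pi by rewrite /t divfK.
have -> : t * a = t * b + pi.
  by rewrite -tdel -mulrDr; congr (_ * _); rewrite addrC /del subrK.
rewrite cisD (_ : cis pi = -1); last by rewrite /cis cospi sinpi; apply/eqP; rewrite eq_complex /= oppr0 !eqxx.
rewrite mulrN1 -opprD normrN -mulr2n -mulr_natr normrM normr_cis mul1r normr_nat.
by rewrite -[1]/(1%:R) ltr_nat.
Qed.

End frequency.

Section restriction.
Context (R : realType) (d : nat) (A0 : topologicalZmodType) (H : zmodClosed A0).
Local Notation G := (prodg 'rV[R]_d A0).
Implicit Types (xi eta : dual R G).

Lemma is_character_res xi : is_character (fun h : subgroup H => xi (0, val h)).
Proof.
split=> [h|h|g h].
- apply: (@continuous_comp _ _ _ (fun h : subgroup H => (0, val h) : G)); last exact: dual_continuous.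
  have c : continuous (fun h : subgroup H => (0, val h) : G).
    apply: (prodg_pair_continuous _ (@subgroup_val_continuous _ H)).
    by move=> x; exact: cst_continuous.
  exact: c.
- exact: dual_norm.
- rewrite -dual_add; congr (dual_fun xi _).
  change ((0, val g + val h) = (0 + 0, val g + val h) :> G).
  by rewrite addr0.
Qed.

Definition res xi : dual R (subgroup H) := Dual (is_character_res xi).

Lemma resE xi h : res xi h = xi (0, val h). Proof. by []. Qed.

Lemma resD xi eta : res (xi + eta) = res xi + res eta.
Proof. by apply: dual_ext. Qed.

Lemma resN xi : res (- xi) = - res xi.
Proof. by apply: dual_ext. Qed.

Lemma res_modulation w : res (modulation A0 w) = 0.
Proof. by apply: dual_ext => h; rewrite resE /= dot0r cis0. Qed.

(** Characters near [xi] agree with it on the compact subgroup. *)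
Lemma res_fiber_open (chi : dual R (subgroup H)) :
  compact [set x : A0 | x \in H] -> open [set xi | res xi = chi].
Proof.
move=> cH; rewrite openE => xi /= xic; rewrite /interior.
pose K : set G := [set 0] `*` [set x : A0 | x \in H].
have cK : compact K by apply: compact_setX => //; exact: compact_set1.
have Kn (x : G) (n : nat) : K x -> K (x *+ n).
  move=> [x1 x2]; elim: n => [|n [ih1 ih2]]; first by split => //=; exact: rpred0.
  rewrite mulrS; split => /=.
    by change (x.1 + (x *+ n).1 = 0); rewrite x1 ih1 addr0.
  exact: rpredD.
have := dual_locally_constant xi cK Kn.
apply: filterS => eta h; rewrite -xic; apply: dual_ext => x.
by rewrite !resE; apply: h; split => //=; exact: valP.
Qed.

End restriction.

(** * Image measures and complex integrals *)

Section restricted_image.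
Context (d1 d2 : measure_display) (T1 : measurableType d1) (T2 : measurableType d2).
Context (R : realType) (mu : {measure set T1 -> \bar R}).
Context (D : set T1) (mD : measurable D) (f : T1 -> T2) (mf : measurable_fun setT f).

(** The image under [f] of the restriction of [mu] to [D].  The proofs are
    arguments so that the measure structure can be inferred. *)
Definition restricted_image (mD : measurable D) (mf : measurable_fun setT f)
  (E : set T2) : \bar R := pushforward (mrestr mu mD) f E.

Let mrestr_f := measure_function_pushforward__canonical__measure_function_Measure
  (mrestr mu mD) mf.

HB.instance Definition _ := Measure.copy (restricted_image mD mf) mrestr_f.

Lemma restricted_imageE E : restricted_image mD mf E = mu (f @^-1` E `&` D).
Proof. by []. Qed.

Lemma ge0_integral_restricted_image (g : T2 -> \bar R) :
  measurable_fun setT g -> (forall y, 0 <= g y)%E ->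
  (\int[restricted_image mD mf]_y g y = \int[mu]_(x in D) g (f x))%E.
Proof.
move=> mg g0.
transitivity (\int[mrestr mu mD]_x g (f x))%E.
  exact: (@ge0_integral_pushforward _ _ _ _ _ _ mf (mrestr mu mD) setT g).
rewrite (@ge0_negligible_integral _ _ _ _ setT (~` D))//.
- rewrite setDE setCK setTI; apply: eq_measure_integral => A mA AD.
  by rewrite /= /mrestr setIidl.
- exact: measurableC.
- exact: measurableT_comp.
- by rewrite /= /mrestr setICl measure0.
Qed.

Lemma integral_restricted_image (g : T2 -> \bar R) :
  measurable_fun setT g ->
  (\int[restricted_image mD mf]_y g y = \int[mu]_(x in D) g (f x))%E.
Proof.
move=> mg; rewrite [LHS]integralE [RHS]integralE; congr (_ - _)%E.
- rewrite ge0_integral_restricted_image//; last exact: measurable_funepos.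
  by apply: eq_integral => x _; rewrite !funeposE.
- rewrite ge0_integral_restricted_image//; last exact: measurable_funeneg.
  by apply: eq_integral => x _; rewrite !funenegE.
Qed.

Lemma Rintegral_restricted_image (g : T2 -> R) :
  measurable_fun setT g ->
  \int[restricted_image mD mf]_y g y = \int[mu]_(x in D) g (f x).
Proof.
move=> mg; rewrite /Rintegral; congr fine; apply: integral_restricted_image.
exact/measurable_EFinP.
Qed.

End restricted_image.

Section complex_integrals.
Context (R : realType) (A : topologicalZmodType).
Context (m : {measure set (borel A) -> \bar R}).
Implicit Types (f g : A -> R[i]).
Local Notation Re := (@complex.Re R).
Local Notation Im := (@complex.Im R).

Definition cintegrable g :=
  m.-integrable setT (EFin \o (fun y : borel A => Re (g y))) /\
  m.-integrable setT (EFin \o (fun y : borel A => Im (g y))).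

Lemma continuous_cmeasurable g : continuous g -> cmeasurable g.
Proof.
move=> cg; split; apply: borel_continuous_measurable_real => y.
- by apply: continuous_comp; [exact: cg|exact: Re_continuous].
- by apply: continuous_comp; [exact: cg|exact: Im_continuous].
Qed.

Lemma cintegralZ (k : R[i]) g : cintegrable g ->
  cintegral m (fun y => k * g y) = k * cintegral m g.
Proof.
move=> [ir ii]; case: k => a b.
have iZ c (h : borel A -> R) : m.-integrable setT (EFin \o h) ->
    m.-integrable setT (EFin \o (fun y => c * h y)).
  move=> ih; have := integrableZl measurableT c ih.
  by congr (_.-integrable _ _); apply/funext.
rewrite /cintegral.
have -> : \int[m]_x Re ((a +i* b) * g x) =
    a * \int[m]_x Re (g x) - b * \int[m]_x Im (g x).
  rewrite -!RintegralZl// -RintegralB//; last 2 first.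
  - exact: iZ.
  - exact: iZ.
  by apply: eq_Rintegral => y _; case: (g y).
have -> : \int[m]_x Im ((a +i* b) * g x) =
    a * \int[m]_x Im (g x) + b * \int[m]_x Re (g x).
  rewrite -!RintegralZl// -RintegralD//; last 2 first.
  - exact: iZ.
  - exact: iZ.
  by apply: eq_Rintegral => y _; case: (g y).
by [].
Qed.

Lemma eq_cintegral f g : f =1 g -> cintegral m f = cintegral m g.
Proof. by move=> /funext ->. Qed.

Lemma cintegrable_le g (h : borel A -> R) : continuous g ->
  m.-integrable setT (EFin \o h) -> (forall y, Normc.normc (g y) <= h y) ->
  cintegrable g.
Proof.
move=> cg ih gh; have [mr mi] := continuous_cmeasurable cg.
split; apply: (le_integrable measurableT _ _ ih).
- exact/measurable_EFinP.
- move=> y _ /=; rewrite lee_fin (le_trans (normr_Re_le _))// (le_trans (gh y))//.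
  exact: ler_norm.
- exact/measurable_EFinP.
- move=> y _ /=; rewrite lee_fin (le_trans (normr_Im_le _))// (le_trans (gh y))//.
  exact: ler_norm.
Qed.

Hypothesis m_inv : forall (x : A) (E : set (borel A)), measurable E ->
  m [set x + y | y in (E : set A)] = m E.

Lemma cintegral_shift (x : A) g : continuous g ->
  cintegral m (fun y => g (x + y)) = cintegral m g.
Proof.
move=> cg; have [mr mi] := continuous_cmeasurable cg; rewrite /cintegral.
congr (_ +i* _).
- exact: (Rintegral_shift m_inv x mr).
- exact: (Rintegral_shift m_inv x mi).
Qed.

(** Orthogonality of characters: the integral is invariant under a translation
    that multiplies the function by [z]. *)
Lemma cintegral_eigen (x : A) (z : R[i]) g : continuous g -> cintegrable g ->
  z != 1 -> (forall y, g (x + y) = z * g y) -> cintegral m g = 0.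
Proof.
move=> cg ig z1 gz; have := cintegral_shift x cg.
rewrite (eq_cintegral gz) cintegralZ// => /eqP.
rewrite -subr_eq0 -[X in _ - X]mul1r -mulrBl mulf_eq0 subr_eq0 (negbTE z1).
by move/eqP.
Qed.

End complex_integrals.

(** * Integration over a cylinder above a coset *)

Section cylinders.
Context (R : realType) (d : nat) (A0 : topologicalZmodType) (H : zmodClosed A0).
Local Notation G := (prodg 'rV[R]_d A0).

Definition cyl (a : A0) : set G := [set z | z.2 - a \in H].

Hypothesis oH : open [set x : A0 | x \in H].

Lemma coset_open (a : A0) : open [set x : A0 | x - a \in H].
Proof.
apply: (@open_comp _ _ (fun x : A0 => x - a) [set x | x \in H]) => // x _.
rewrite (_ : (fun x => x - a) = (fun x => - a + x)); first exact: addl_continuous.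
by apply/funext => y; rewrite addrC.
Qed.

Lemma coset_complement_open (a : A0) : open [set x : A0 | x - a \notin H].
Proof.
rewrite openE => x /= xa; have := @coset_open x; rewrite openE.
move=> /(_ x); rewrite /= subrr rpred0 => /(_ isT); apply: filterS => y /= yx.
apply: contra xa => ya.
have <- : (y - a) - (y - x) = x - a by rewrite opprB addrC addrA subrK.
exact: rpredB.
Qed.

Lemma cyl_open a : open (cyl a).
Proof.
apply: (@open_comp _ _ (snd : G -> A0) [set x | x - a \in H]); last exact: coset_open.
by move=> z _; exact: prodg_snd_continuous.
Qed.

Lemma cyl_measurable a : measurable (cyl a : set (borel G)).
Proof. by apply: borel_open; exact: cyl_open. Qed.

Lemma fst_measurable :
  measurable_fun setT ((fst : G -> 'rV[R]_d) : borel G -> borel 'rV[R]_d).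
Proof. by apply: borel_continuous_measurable; exact: prodg_fst_continuous. Qed.

Context (mu : {measure set (borel G) -> \bar R}).
Hypothesis mu_inv : forall (x : G) (E : set (borel G)), measurable E ->
  mu [set x + y | y in (E : set G)] = mu E.
Hypothesis mu_fin : forall K : set G, compact K -> (mu K < +oo)%E.
Hypothesis cH : compact [set x : A0 | x \in H].

(** The measure induced on R^d by the cylinder above a coset of H; it is
    independent of the coset and invariant under translation. *)
Definition fiber_measure (a : A0) : {measure set (borel 'rV[R]_d) -> \bar R} :=
  restricted_image mu (cyl_measurable a) fst_measurable.

Lemma fiber_measureE a E : fiber_measure a E = mu [set z | E z.1 /\ z.2 - a \in H].
Proof. by []. Qed.

Lemma fiber_measure_coset a E : measurable E ->
  fiber_measure a E = fiber_measure 0 E.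
Proof.
move=> mE; rewrite !fiber_measureE.
have mS : measurable ([set z : G | E z.1 /\ z.2 - 0 \in H] : set (borel G)).
  have := measurableI _ _ (fst_measurable measurableT mE) (cyl_measurable 0).
  by rewrite setTI.
rewrite -(measure_shift_preimage mu_inv ((0, - a) : G) mS); congr (mu _).
apply/seteqP; split=> -[x u] /=.
  by change (E x /\ u - a \in H -> E (0 + x) /\ - a + u - 0 \in H);
    rewrite add0r subr0 addrC.
by change (E (0 + x) /\ - a + u - 0 \in H -> E x /\ u - a \in H);
  rewrite add0r subr0 addrC.
Qed.

Lemma fiber_measure_inv (x : 'rV[R]_d) (E : set (borel 'rV[R]_d)) : measurable E ->
  fiber_measure 0 [set x + y | y in (E : set 'rV[R]_d)] = fiber_measure 0 E.
Proof.
move=> mE; rewrite !fiber_measureE.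
have mS : measurable ([set z : G | E z.1 /\ z.2 - 0 \in H] : set (borel G)).
  have := measurableI _ _ (fst_measurable measurableT mE) (cyl_measurable 0).
  by rewrite setTI.
rewrite -(mu_inv ((x, 0) : G) mS); congr (mu _).
apply/seteqP; split=> [[_ u] /= [[y Ey <-] uH]|_ /= [[y u] /= [Ey uH] <-]].
  by exists (y, u) => //; change ((x + y, 0 + u) = (x + y, u) :> G); rewrite add0r.
split; first by exists y.
by change (0 + u - 0 \in H); rewrite add0r.
Qed.

Lemma fiber_measure_fin (K : set 'rV[R]_d) : compact K -> (fiber_measure 0%R K < +oo)%E.
Proof.
move=> cK; rewrite fiber_measureE.
have -> : [set z : G | K z.1 /\ z.2 - 0 \in H] = K `*` [set x : A0 | x \in H].
  by apply/seteqP; split => -[x u] /=; rewrite subr0.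
by apply: mu_fin; exact: compact_setX.
Qed.

Local Notation m := (fiber_measure 0).

Lemma ge0_integral_cyl a (g : borel 'rV[R]_d -> \bar R) :
  measurable_fun setT g -> (forall y, 0 <= g y)%E ->
  (\int[mu]_(z in cyl a) g (z : G).1 = \int[m]_y g y)%E.
Proof.
move=> mg g0.
rewrite -(ge0_integral_restricted_image mu (cyl_measurable a) fst_measurable mg)//.
apply: (@eq_measure_integral _ _ _ setT (fiber_measure 0) (fiber_measure a)) => E mE _.
by rewrite fiber_measure_coset.
Qed.

Lemma Rintegral_cyl a (g : borel 'rV[R]_d -> R) : measurable_fun setT g ->
  \int[mu]_(z in cyl a) g (z : G).1 = \int[m]_y g y.
Proof.
move=> mg.
rewrite -(Rintegral_restricted_image mu (cyl_measurable a) fst_measurable mg)//.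
rewrite /Rintegral; congr fine.
apply: (@eq_measure_integral _ _ _ setT (fiber_measure 0) (fiber_measure a)) => E mE _.
by rewrite fiber_measure_coset.
Qed.

Definition cyl_fun (a : A0) (g : 'rV[R]_d -> R) (z : G) : R :=
  if z.2 - a \in H then g z.1 else 0.

Lemma integral_cyl_fun a (g : 'rV[R]_d -> R) :
  continuous g -> (forall y, 0 <= g y) ->
  (\int[mu]_z (cyl_fun a g z)%:E = \int[m]_y (g y)%:E)%E.
Proof.
move=> cg g0.
rewrite -(@ge0_integral_cyl a (fun y => (g y)%:E)); last first.
- by move=> y; rewrite lee_fin.
- by apply/measurable_EFinP; exact: borel_continuous_measurable_real.
rewrite [RHS]integral_mkcond; apply: eq_integral => z _.
rewrite patchE /cyl_fun; have [za|za] := boolP ((z : G).2 - a \in H).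
  by rewrite mem_set.
by rewrite memNset//; exact/negP.
Qed.

Lemma cyl_fun_measurable a (g : 'rV[R]_d -> R) : continuous g ->
  measurable_fun setT (cyl_fun a g : borel G -> R).
Proof.
move=> cg; apply: borel_continuous_measurable_real => z U.
rewrite /cyl_fun; have [za|za] := boolP (z.2 - a \in H) => nU.
- have n1 : nbhs z (cyl a) by apply: open_nbhs_nbhs; split => //; exact: cyl_open.
  have n2 : nbhs z [set y : G | U (g y.1)].
    exact: (continuous_comp (@prodg_fst_continuous _ _ z) (@cg z.1)).
  change (nbhs z [set y : G | U (if y.2 - a \in H then g y.1 else 0)]).
  apply: (filterS _ (filterI n1 n2)) => y [yH /=].
  by rewrite (yH : y.2 - a \in H).
- have n1 : nbhs z [set z : G | z.2 - a \notin H].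
    apply: open_nbhs_nbhs; split => //.
    apply: (@open_comp _ _ (snd : G -> A0) [set x | x - a \notin H]); last exact: coset_complement_open.
    by move=> y _; exact: prodg_snd_continuous.
  change (nbhs z [set y : G | U (if y.2 - a \in H then g y.1 else 0)]).
  by apply: (filterS _ n1) => y /= /negbTE ->; exact: nbhs_singleton.
Qed.

Section gauss.
Context (alpha : 'M[R]_d).
Hypothesis pa : posdefmx alpha.
Let minv := fiber_measure_inv.
Let mfin := fiber_measure_fin.

Lemma gauss_shift_continuous (c : 'rV[R]_d) :
  continuous (fun y : 'rV[R]_d => expR (- qform alpha (y - c))).
Proof.
move=> y; apply: (@continuous_comp _ _ _ (fun y : 'rV[R]_d => y - c) (fun y => expR (- qform alpha y))).
  rewrite (_ : (fun y : 'rV[R]_d => y - c) = (fun y : 'rV[R]_d => - c + y)); first exact: addl_continuous.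
  by apply/funext => z; rewrite addrC.
exact: gauss_continuous.
Qed.

Lemma integral_gaussE (a : {measure set (borel 'rV[R]_d) -> \bar R})
  (iv : forall (x : 'rV[R]_d) (E : set (borel 'rV[R]_d)), measurable E ->
     a [set x + y | y in (E : set 'rV[R]_d)] = a E)
  (fi : forall K : set 'rV[R]_d, compact K -> (a K < +oo)%E) (c : 'rV[R]_d) :
  (\int[a]_y (expR (- qform alpha ((y : 'rV[R]_d) - c)))%:E = (gauss_int a alpha)%:E)%E.
Proof.
rewrite -(ge0_integral_shift iv c (f := fun y => (expR (- qform alpha ((y : 'rV[R]_d) - c)))%:E)).
- rewrite /gauss_int /Rintegral fineK.
    by apply: eq_integral => y _; rewrite addrC addKr.
  exact: (integrable_fin_num measurableT (integrable_gauss iv fi pa)).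
- by apply/measurable_EFinP; apply: borel_continuous_measurable_real; exact: gauss_shift_continuous.
- by move=> y; rewrite lee_fin expR_ge0.
Qed.

Lemma integral_gauss_cyl a (C : R) (c : 'rV[R]_d) : 0 <= C ->
  (\int[mu]_z (cyl_fun a (fun y : 'rV[R]_d => C * expR (- qform alpha (y - c))) z)%:E =
   (C * gauss_int m alpha)%:E)%E.
Proof.
move=> C0; have cg := @gauss_shift_continuous c.
rewrite integral_cyl_fun; last first.
- by move=> y; rewrite mulr_ge0 ?expR_ge0.
- by move=> y; exact: (continuousM (@cst_continuous _ _ C y) (cg y)).
under eq_integral do rewrite EFinM.
rewrite ge0_integralZl//.
- by rewrite integral_gaussE.
- by apply/measurable_EFinP; exact: borel_continuous_measurable_real.
Qed.

End gauss.
End cylinders.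

(** * Gaussians times a character of a coset *)

Lemma normc_mul (R : realType) (z w : R[i]) :
  Normc.normc (z * w) = Normc.normc z * Normc.normc w.
Proof. by apply: complexI; rewrite rmorphM /= -!normr_normc normrM. Qed.

Lemma normc_real (R : realType) (x : R) : 0 <= x -> Normc.normc x%:C = x.
Proof.
by move=> x0; apply: complexI; rewrite -normr_normc ger0_norm// lecR.
Qed.

Lemma normc_unit (R : realType) (z : R[i]) : `|z| = 1 -> Normc.normc z = 1.
Proof. by move=> z1; apply: complexI; rewrite -normr_normc z1. Qed.

Lemma normc_zero (R : realType) : Normc.normc (0 : R[i]) = 0.
Proof. by apply: complexI; rewrite -normr_normc normr0. Qed.

Lemma real_continuous_complex (R : realType) (T : topologicalType) (f : T -> R) :
  continuous f -> continuous (fun x => (f x)%:C).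
Proof. by move=> cf; apply: complex_continuous => // x; exact: cst_continuous. Qed.

Section coset_characters.
Context (R : realType) (A0 : topologicalZmodType) (H : zmodClosed A0).
Hypothesis oH : open [set x : A0 | x \in H].
Context (a : A0) (u : A0 -> R[i]) (k : R[i]) (f : subgroup H -> R[i]).
Hypothesis cf : continuous f.
Hypothesis u_out : forall y, y - a \notin H -> u y = 0.
Hypothesis u_in : forall h : subgroup H, u (a + val h) = k * f h.

(** H being open, a function given separately on a coset of H and by zero on its
    complement is continuous as soon as it is so on the coset. *)
Lemma coset_char_continuous : continuous u.
Proof.
move=> y U nU; have [ya|ya] := boolP (y - a \in H).
- pose h : subgroup H := exist _ (y - a) ya.
  have uy : u y = k * f h by rewrite -u_in /= addrC subrK.
  have ckf : {for h, continuous (fun h => k * f h)}.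
    exact: (continuousM (@cst_continuous _ _ k h) (@cf h)).
  have : nbhs h [set h | U (k * f h)] by apply: ckf; rewrite -uy.
  rewrite nbhsE => -[W [oW Wh] WU].
  have oV : open [set x : A0 | [set val h | h in W] (- a + x)].
    apply: (@open_comp _ _ (fun x : A0 => - a + x) [set val h | h in W]).
      by move=> x _; exact: addl_continuous.
    exact: subgroup_open.
  have nV : nbhs y [set x : A0 | [set val h | h in W] (- a + x)].
    by apply: open_nbhs_nbhs; split => //=; exists h => //=; rewrite addrC.
  change (nbhs y [set x | U (u x)]).
  apply: (filterS _ nV) => x /= [w Ww wx].
  have -> : x = a + val w by rewrite (wx : val w = - a + x) addNKr.
  by rewrite u_in; exact: WU.
- have nV : nbhs y [set x : A0 | x - a \notin H].
    by apply: open_nbhs_nbhs; split => //; exact: coset_complement_open.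
  change (nbhs y [set x | U (u x)]).
  apply: (filterS _ nV) => x /= xa; rewrite u_out// -(u_out ya).
  exact: nbhs_singleton.
Qed.

End coset_characters.

Section gauss_integrals.
Context (R : realType) (d : nat) (A0 : topologicalZmodType) (H : zmodClosed A0).
Local Notation G := (prodg 'rV[R]_d A0).
Local Notation Re := (@complex.Re R).
Local Notation Im := (@complex.Im R).
Hypothesis oH : open [set x : A0 | x \in H].
Hypothesis cH : compact [set x : A0 | x \in H].
Context (mu : {measure set (borel G) -> \bar R}).
Hypothesis mu_inv : forall (x : G) (E : set (borel G)), measurable E ->
  mu [set x + y | y in (E : set G)] = mu E.
Hypothesis mu_fin : forall K : set G, compact K -> (mu K < +oo)%E.
Local Notation m := (fiber_measure oH mu 0).
Context (alpha : 'M[R]_d).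
Hypothesis pa : posdefmx alpha.
Let minv := fiber_measure_inv oH mu_inv.
Let mfin := fiber_measure_fin oH mu_fin cH.

Definition gauss_phase (c v : 'rV[R]_d) (y : 'rV[R]_d) : R[i] :=
  (expR (- qform alpha (y - c)))%:C * cis (dot v y).

Lemma gauss_phase_continuous c v : continuous (gauss_phase c v).
Proof.
move=> y.
have h1 : {for y, continuous (fun y : 'rV[R]_d => (expR (- qform alpha (y - c)))%:C : R[i])}.
  apply: (real_continuous_complex (f := fun y : 'rV[R]_d => expR (- qform alpha (y - c)))).
  exact: gauss_shift_continuous.
have h2 : {for y, continuous (fun y => cis (dot v y))}.
  apply: (continuous_comp (@dot_continuous _ _ v y)); exact: cis_continuous.
exact: (continuousM h1 h2).
Qed.

Lemma normc_gauss_phase c v y :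
  Normc.normc (gauss_phase c v y) = expR (- qform alpha (y - c)).
Proof.
by rewrite normc_mul normc_real ?expR_ge0// (normc_unit (normr_cis _)) mulr1.
Qed.

Lemma cintegrable_gauss_phase c v : cintegrable m (gauss_phase c v).
Proof.
apply: (@cintegrable_le _ _ _ _ (fun y => expR (- qform alpha ((y : 'rV[R]_d) - c)))).
- exact: gauss_phase_continuous.
- apply/integrableP; split.
    by apply/measurable_EFinP; apply: borel_continuous_measurable_real; exact: gauss_shift_continuous.
  rewrite (eq_integral (fun y : borel 'rV[R]_d => (expR (- qform alpha ((y : 'rV[R]_d) - c)))%:E)).
    by rewrite (integral_gaussE pa minv mfin) ltry.
  by move=> y _ /=; rewrite ger0_norm ?expR_ge0.
- by move=> y; rewrite normc_gauss_phase.
Qed.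

(** Translating by [c] leaves the phase cis (v . c) and a centered Gaussian. *)
Lemma cintegral_gauss_phase c v :
  cintegral m (gauss_phase c v) =
  cis (dot v c) * (expR (- (qform (invmx alpha) v / 4)) * gauss_int m alpha)%:C.
Proof.
rewrite -(cintegral_shift minv c (gauss_phase_continuous (c := c) (v := v))).
rewrite (@eq_cintegral _ _ _ _ (fun y => cis (dot v c) * gauss_phase 0 v y)); last first.
  move=> y; rewrite /gauss_phase (addrC c) addrK subr0 dotDr cisD.
  by rewrite (mulrC (cis (dot v y))) mulrCA.
rewrite cintegralZ; last exact: cintegrable_gauss_phase.
congr (_ * _); rewrite /cintegral.
have -> : \int[m]_x Re (gauss_phase 0 v x) = \int[m]_x (cos (dot v x) * expR (- qform alpha x)).
  apply: eq_Rintegral => y _; rewrite /gauss_phase subr0 /= mul0r subr0.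
  exact: mulrC.
have -> : \int[m]_x Im (gauss_phase 0 v x) = \int[m]_x (sin (dot v x) * expR (- qform alpha x)).
  apply: eq_Rintegral => y _; rewrite /gauss_phase subr0 /= mul0r addr0.
  exact: mulrC.
by rewrite (gauss_fourier_cos minv mfin pa) (gauss_fourier_sin minv mfin pa).
Qed.

Context (a : A0) (u : A0 -> R[i]) (k : R[i]) (psi : dual R (subgroup H)).
Hypothesis u_out : forall y, y - a \notin H -> u y = 0.
Hypothesis u_in : forall h : subgroup H, u (a + val h) = k * psi h.

Let ucont : continuous u :=
  coset_char_continuous oH (@dual_continuous _ _ psi) u_out u_in.

Definition cyl_gauss (c v : 'rV[R]_d) (z : G) : R[i] := gauss_phase c v z.1 * u z.2.

Lemma cyl_gauss_continuous c v : continuous (cyl_gauss c v).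
Proof.
move=> z.
have h1 : {for z, continuous (fun z : G => gauss_phase c v z.1)}.
  apply: (continuous_comp (@prodg_fst_continuous _ _ z)); exact: gauss_phase_continuous.
have h2 : {for z, continuous (fun z : G => u z.2)}.
  apply: (continuous_comp (@prodg_snd_continuous _ _ z)); exact: ucont.
exact: (continuousM h1 h2).
Qed.

Lemma coset_rep y : y - a \in H -> exists h : subgroup H, y = a + val h.
Proof. by move=> ya; exists (exist _ (y - a) ya); rewrite /= addrC subrK. Qed.

Lemma normc_coset_char y :
  Normc.normc (u y) = if y - a \in H then Normc.normc k else 0.
Proof.
case: ifPn => ya; last by rewrite u_out// normc_zero.
have [h ->] := coset_rep ya.
by rewrite u_in normc_mul (normc_unit (dual_norm _ _)) mulr1.
Qed.

Lemma normc_cyl_gauss c v z : Normc.normc (cyl_gauss c v z) =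
  cyl_fun H a (fun y => Normc.normc k * expR (- qform alpha (y - c))) z.
Proof.
rewrite normc_mul normc_gauss_phase normc_coset_char /cyl_fun.
by case: ifP => _; rewrite ?mulr0// mulrC.
Qed.

Lemma cyl_gauss_integrable c v : cintegrable mu (cyl_gauss c v).
Proof.
have k0 := normc_ge0 k.
have cg : continuous (fun y : 'rV[R]_d => Normc.normc k * expR (- qform alpha (y - c))).
  move=> y; exact: (continuousM (@cst_continuous _ _ (Normc.normc k) y)
    (@gauss_shift_continuous R d alpha c y)).
apply: (@cintegrable_le _ _ _ _
  (cyl_fun H a (fun y => Normc.normc k * expR (- qform alpha (y - c))))).
- exact: cyl_gauss_continuous.
- apply/integrableP; split.
    by apply/measurable_EFinP; exact: cyl_fun_measurable.
  rewrite (eq_integral (fun z : borel G =>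
    (cyl_fun H a (fun y => Normc.normc k * expR (- qform alpha (y - c))) z)%:E)).
    by rewrite (integral_gauss_cyl oH mu_inv mu_fin cH pa)// ltry.
  move=> z _ /=; rewrite ger0_norm// /cyl_fun; case: ifP => // _.
  by rewrite mulr_ge0 ?expR_ge0.
- by move=> z; rewrite normc_cyl_gauss.
Qed.

(** Translation by a point of H where [psi] is not 1 multiplies the function by
    that value. *)
Lemma cintegral_cyl_gauss_nontrivial c v : psi != 0 -> cintegral mu (cyl_gauss c v) = 0.
Proof.
move=> psi0; have [h h1] : exists h, psi h != 1.
  apply/not_existsP => hh; move/eqP: psi0; apply; apply: dual_ext => h.
  by apply/eqP/negPn/negP; exact: hh.
apply: (cintegral_eigen mu_inv (x := ((0, val h) : G)) _ _ h1).
- exact: cyl_gauss_continuous.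
- exact: cyl_gauss_integrable.
- move=> z; rewrite /cyl_gauss.
  change (gauss_phase c v (0 + z.1) * u (val h + z.2) = psi h * (gauss_phase c v z.1 * u z.2)).
  rewrite add0r [RHS]mulrCA; congr (_ * _).
  have hH : val h \in H by exact: valP.
  have [za|za] := boolP (z.2 - a \in H).
    have [l zl] := coset_rep za.
    rewrite zl addrCA -[val h + val l]/(val (h + l)) !u_in dual_add.
    by rewrite mulrCA.
  rewrite [u z.2]u_out// mulr0 u_out//.
  by apply: contra za => za; rewrite -(addKr (val h) z.2) -addrA rpredD ?rpredN.
Qed.

Lemma cintegral_cyl_gauss_trivial c v : psi = 0 ->
  cintegral mu (cyl_gauss c v) = k * cintegral m (gauss_phase c v).
Proof.
move=> psi0; have ig := cintegrable_gauss_phase c v.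
rewrite -cintegralZ//.
have cg : continuous (fun y => k * gauss_phase c v y).
  move=> y; exact: (continuousM (@cst_continuous _ _ k y) (@gauss_phase_continuous c v y)).
have [mr mi] := continuous_cmeasurable cg.
have uE z : u z.2 = if z.2 - a \in H then k else 0.
  case: ifPn => za; last exact: u_out.
  by have [l ->] := coset_rep za; rewrite u_in psi0 mulr1.
rewrite /cintegral; congr (_ +i* _).
- rewrite -(Rintegral_cyl oH mu_inv a mr) [RHS]Rintegral_mkcond.
  apply: eq_Rintegral => z _; rewrite patchE /cyl_gauss uE.
  have [za|za] := boolP ((z : G).2 - a \in H).
    by rewrite mem_set// mulrC.
  by rewrite memNset ?mulr0//; exact/negP.
- rewrite -(Rintegral_cyl oH mu_inv a mi) [RHS]Rintegral_mkcond.
  apply: eq_Rintegral => z _; rewrite patchE /cyl_gauss uE.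
  have [za|za] := boolP ((z : G).2 - a \in H).
    by rewrite mem_set// mulrC.
  by rewrite memNset ?mulr0//; exact/negP.
Qed.

Lemma normc_cintegral_cyl_gauss c v :
  Normc.normc (cintegral mu (cyl_gauss c v)) =
  if psi == 0
  then Normc.normc k * (expR (- (qform (invmx alpha) v / 4)) * gauss_int m alpha)
  else 0.
Proof.
have [psi0|psi0] := eqVneq psi 0; last first.
  by rewrite cintegral_cyl_gauss_nontrivial// normc_zero.
rewrite cintegral_cyl_gauss_trivial// cintegral_gauss_phase !normc_mul.
rewrite (normc_unit (normr_cis _)) mul1r normc_real//.
by rewrite mulr_ge0 ?expR_ge0// /gauss_int Rintegral_ge0// => y _; exact: expR_ge0.
Qed.

End gauss_integrals.

(** * The fibers of the restriction map on the dual *)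

Lemma cLnormE (R : realType) (A : topologicalZmodType)
    (mu : {measure set (borel A) -> \bar R}) (p : R) (f : A -> R[i]) :
  (cLnorm mu p f = (\int[mu]_x ((Normc.normc (f x)) `^ p)%:E) `^ p^-1)%E.
Proof.
rewrite /cLnorm unlock; apply: (congr1 (fun x => poweR x p^-1)).
by apply: eq_integral => x _; rewrite /= (ger0_norm (normc_ge0 _)).
Qed.

Section gauss_positive.
Context (R : realType) (d : nat) (m : {measure set (borel 'rV[R]_d) -> \bar R}).
Hypothesis m_inv : forall (x : 'rV[R]_d) (E : set (borel 'rV[R]_d)),
  measurable E -> m [set x + y | y in (E : set 'rV[R]_d)] = m E.
Hypothesis m_fin : forall K : set 'rV[R]_d, compact K -> (m K < +oo)%E.

Lemma gauss_int_gt0 (alpha : 'M[R]_d) : posdefmx alpha -> m setT != 0%E ->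
  0 < gauss_int m alpha.
Proof.
move=> pa m0; rewrite lt_neqAle; apply/andP; split; last first.
  by rewrite /gauss_int Rintegral_ge0// => y _; exact: expR_ge0.
apply: contra m0 => /eqP I0.
have cg := @gauss_continuous R d alpha.
have mg : measurable_fun [set: borel 'rV[R]_d] (fun y => (expR (- qform alpha y))%:E).
  by apply/measurable_EFinP; exact: borel_continuous_measurable_real.
have : (\int[m]_y `|(expR (- qform alpha y))%:E| = 0)%E.
  rewrite (eq_integral (fun y : borel 'rV[R]_d => (expR (- qform alpha ((y : 'rV[R]_d) - 0)))%:E)).
    by rewrite (integral_gaussE pa m_inv m_fin) -I0.
  by move=> y _; rewrite /= subr0 ger0_norm ?expR_ge0.
move/(ae_eq_integral_abs m measurableT mg) => [N [mN N0 NS]].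
rewrite -(@subset_measure0 _ _ _ m setT N)//.
by move=> y _; apply: NS => /= /(_ I) [] /eqP; rewrite gt_eqF ?expR_gt0.
Qed.

End gauss_positive.

(** Markov's inequality for exp (- q). *)
Lemma sublevel_finite (R : realType) (A : topologicalZmodType)
    (m : {measure set (borel A) -> \bar R}) (q : A -> R) (k : R) :
  continuous q -> (\int[m]_y (expR (- q y))%:E < +oo)%E ->
  (m [set y | (q y < k)%R] < +oo)%E.
Proof.
move=> cq iq; set S := [set y | q y < k].
have mS : measurable (S : set (borel A)).
  apply: borel_open; apply: (@open_comp _ _ q [set x | x < k]); last exact: open_lt.
  by move=> x _; exact: cq.
have mq : measurable_fun [set: borel A] (fun y => (expR (- q y))%:E).
  apply/measurable_EFinP; apply: (@borel_continuous_measurable_real _ _ (fun y => expR (- q y))) => y.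
  apply: (@continuous_comp _ _ _ (fun y => - q y) expR); last exact: continuous_expR.
  by apply: continuousN; exact: cq.
have : ((expR (- k))%:E * m S < +oo)%E.
  have <- : (\int[m]_y (\1_S y)%:E = m S)%E by rewrite integral_indic// setIT.
  apply: le_lt_trans iq.
  have mI : measurable_fun [set: borel A] (fun y => (\1_S y)%:E : \bar R).
    by apply/measurable_EFinP; exact: measurable_indic.
  have k0 : (0 <= (expR (- k))%:E)%E by rewrite lee_fin expR_ge0.
  rewrite -ge0_integralZl//.
  apply: ge0_le_integral => //.
  - exact: emeasurable_funM.
  - move=> y _; rewrite indicE; have [yS|yS] := boolP (y \in S).
      by rewrite mule1 lee_fin ler_expR lerN2 ltW//; move: yS; rewrite inE.
    by rewrite mule0 lee_fin expR_ge0.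
apply: contraLR; rewrite -!leNgt !leye_eq => /eqP ->.
by rewrite gt0_muley// lte_fin expR_gt0.
Qed.

HB.instance Definition _ (A B : topologicalZmodType) :=
  isPointed.Build (prodg A B) 0.

Section dual_fibers.
Context (R : realType) (d : nat) (A0 : topologicalZmodType) (H : zmodClosed A0).
Local Notation G := (prodg 'rV[R]_d A0).
Hypothesis oH : open [set x : A0 | x \in H].
Hypothesis cH : compact [set x : A0 | x \in H].
Context (mu : {measure set (borel G) -> \bar R}).
Context (nu : {measure set (borel (dual R G)) -> \bar R}).
Hypothesis mu_haar : is_haar mu.
Hypothesis nu_haar : is_haar nu.
Hypothesis mu_nu : plancherel mu nu.
Hypothesis hausG : hausdorff_space G.
Local Notation m := (fiber_measure oH mu 0).

Let mu_inv (x : G) (E : set (borel G)) : measurable E ->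
  mu [set x + y | y in (E : set G)] = mu E.
Proof. by case: mu_haar => _ + _ _ _ => h /h; exact. Qed.

Let mu_fin (K : set G) : compact K -> (mu K < +oo)%E.
Proof. by case: mu_haar => _ _ + _ _; exact. Qed.

Let nu_inv (x : dual R G) (E : set (borel (dual R G))) : measurable E ->
  nu [set x + y | y in (E : set (dual R G))] = nu E.
Proof. by case: nu_haar => _ + _ _ _ => h /h; exact. Qed.

Let minv := fiber_measure_inv oH mu_inv.
Let mfin := fiber_measure_fin oH mu_fin cH.

(** Otherwise all cylinders are null, so all compact sets, and by inner
    regularity the whole group. *)
Lemma fiber_measure_neq0 : m setT != 0%E.
Proof.
have [mu0 _ _ _ mu_inner] := mu_haar.
apply: contra mu0 => /eqP m0; rewrite (mu_inner _ openT).
rewrite eq_le; apply/andP; split; last first.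
  by apply: ereal_sup_ubound; exists set0; [split => //; exact: compact0|exact: measure0].
apply: ge_ereal_sup => _ [K [cK _] <-].
have cyl0 a : mu (cyl (R := R) (d := d) H a : set (borel G)) = 0%E.
  have := fiber_measure_coset oH mu_inv a measurableT; rewrite m0 fiber_measureE => <-.
  by congr (mu _); apply/seteqP; split => // z [].
have := cK; rewrite compact_cover => /(_ G setT (fun z => cyl (R := R) (d := d) H z.2)).
case; first by move=> z _; exact: cyl_open.
  by move=> z _; exists z => //; rewrite /cyl /= subrr rpred0.
move=> D _ KD; pose s := finmap.enum_fset D.
have : (mu K <= \sum_(z <- s) mu (cyl (R := R) (d := d) H z.2 : set (borel G)))%E.
  rewrite fsbig_seq; last exact: finmap.fset_uniq.
  apply: content_sub_fsum => //.
  - by move=> z _; exact: cyl_measurable.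
  - by apply: borel_closed; exact: compact_closed.
by rewrite big1.
Qed.

Lemma freq_measurable : measurable_fun setT
  ((@freq R d A0) : borel (dual R G) -> borel 'rV[R]_d).
Proof. by apply: borel_continuous_measurable; exact: freq_continuous. Qed.

Lemma res_fiber_measurable (chi : dual R (subgroup H)) :
  measurable ([set xi : dual R G | res H xi = chi] : set (borel (dual R G))).
Proof. by apply: borel_open; exact: res_fiber_open. Qed.

(** The counterpart of [fiber_measure] on the dual side: the coset is replaced by
    the set of characters with a given restriction to H, an open set, and the
    projection to R^d by the frequency. *)
Definition dual_fiber_measure (chi : dual R (subgroup H)) :
  {measure set (borel 'rV[R]_d) -> \bar R} :=
  restricted_image nu (res_fiber_measurable chi) freq_measurable.

Definition extend0 (chi : dual R (subgroup H)) (y : A0) : R[i] :=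
  if insub y is Some h then chi (h : subgroup H) else 0.

Lemma extend0_out chi y : y \notin H -> extend0 chi y = 0.
Proof. by move=> yH; rewrite /extend0 insubN. Qed.

Lemma extend0_in chi (h : subgroup H) : extend0 chi (val h) = chi h.
Proof. by rewrite /extend0 valK. Qed.

Section transform.
Context (alpha : 'M[R]_d).
Hypothesis pa : posdefmx alpha.

(** The transform lives on the characters that restrict to [chi], by orthogonality
    on H. *)
Lemma fourier_cyl_gauss (chi : dual R (subgroup H)) (xi : dual R G) :
  Normc.normc (fourier mu (cyl_gauss alpha (extend0 chi) 0 0) xi) =
  if res H xi == chi
  then expR (- (qform (invmx alpha) (freq xi) / 4)) * gauss_int m alpha else 0.
Proof.
pose u y := extend0 chi y * (xi (0, y))^*.
have u_out y : y - 0 \notin H -> u y = 0.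
  by rewrite subr0 => yH; rewrite /u extend0_out ?mul0r.
have u_in (h : subgroup H) : u (0 + val h) = 1 * (chi - res H xi) h.
  by rewrite add0r mul1r /u extend0_in.
have := normc_cintegral_cyl_gauss oH cH mu_inv mu_fin pa u_out u_in 0 (- freq xi).
rewrite qformN (normc_unit (normr1 _)) mul1r subr_eq0 eq_sym => <-.
rewrite /fourier; congr Normc.normc; apply: eq_cintegral => z.
rewrite /cyl_gauss /gauss_phase /u dot0l cis0 mulr1 (dual_prodg xi) freqP.
have conjM (x y : R[i]) : Num.conj (x * y) = Num.conj x * Num.conj y.
  exact: rmorphM.
have conj_cisE t : Num.conj (cis t) = cis (- t) :> R[i] := conj_cis t.
by rewrite conjM conj_cisE dotNl; ring.
Qed.

(** The Plancherel formula for a Gaussian times the extension of [chi] by zero: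
    its transform is a Gaussian of the frequency on the fiber above [chi]. *)
Lemma plancherel_gauss (chi : dual R (subgroup H)) :
  (\int[dual_fiber_measure chi]_w
    (expR (- (qform (invmx alpha) w / 2)))%:E * (gauss_int m alpha ^+ 2)%:E
    = (gauss_int m (2 *: alpha))%:E)%E.
Proof.
pose f := cyl_gauss alpha (extend0 chi) 0 0 : G -> R[i].
have u_out y : y - 0 \notin H -> extend0 chi y = 0.
  by rewrite subr0; exact: extend0_out.
have u_in (h : subgroup H) : extend0 chi (0 + val h) = 1 * chi h.
  by rewrite add0r mul1r extend0_in.
have nf z : Normc.normc (f z) = cyl_fun H 0 (fun y => expR (- qform alpha (y - 0))) z.
  rewrite (normc_cyl_gauss alpha u_out u_in) (normc_unit (normr1 _)).
  by rewrite /cyl_fun; case: ifP => //; rewrite mul1r.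
have nfp (q : R) z : 0 < q -> Normc.normc (f z) `^ q =
    cyl_fun H 0 (fun y => 1 * expR (- qform (q *: alpha) (y - 0))) z.
  move=> q0; rewrite nf /cyl_fun; case: ifP => _; last by rewrite powR0// gt_eqF.
  by rewrite qformZmx mul1r -expRM -mulNr mulrC mulrN -mulNr mulrC.
have If (q : R) : 0 < q ->
    (\int[mu]_z ((Normc.normc (f z)) `^ q)%:E = (gauss_int m (q *: alpha))%:E)%E.
  move=> q0; under eq_integral do rewrite nfp//.
  by rewrite (integral_gauss_cyl oH mu_inv mu_fin cH (posdefZ q0 pa))// mul1r.
have fc : continuous f by exact: (cyl_gauss_continuous oH u_out u_in).
have fin q : 0 < q -> (cLnorm mu q f < +oo)%E.
  by move=> q0; rewrite cLnormE If// poweR_EFin ltry.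
have := mu_nu (continuous_cmeasurable fc) (fin _ ltr01) (fin _ (ltr0Sn _ 1)).
rewrite !cLnormE If// => /(congr1 (fun x => (x `^ 2)%E)).
rewrite -!poweRrM mulVf ?pnatr_eq0// !poweRe1//; last 2 first.
- by rewrite lee_fin /gauss_int Rintegral_ge0// => y _; exact: expR_ge0.
- by apply: integral_ge0 => y _; rewrite lee_fin powR_ge0.
move=> <-.
have cq : continuous (fun w => expR (- (qform (invmx alpha) w / 2))).
  move=> w; apply: (@continuous_comp _ _ _ (fun w => - (qform (invmx alpha) w / 2)) expR).
    apply: continuousN.
    exact: (continuousM (@qform_continuous _ _ _ w) (@cst_continuous _ _ (2^-1 : R) w)).
  exact: continuous_expR.
have mq : measurable_fun [set: borel 'rV[R]_d]
    (fun w => (expR (- (qform (invmx alpha) w / 2)))%:E).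
  by apply/measurable_EFinP; exact: borel_continuous_measurable_real.
have I2 : (0 <= (gauss_int m alpha ^+ 2)%:E)%E by rewrite lee_fin sqr_ge0.
have e0 (w : borel 'rV[R]_d) : setT w ->
    (0 <= (expR (- (qform (invmx alpha) w / 2)))%:E)%E.
  by move=> _; rewrite lee_fin expR_ge0.
rewrite muleC -(@ge0_integralZl _ _ _ _ _ measurableT _ mq _ e0 I2).
rewrite ge0_integral_restricted_image; last 2 first.
- by apply: emeasurable_funM.
- by move=> w; rewrite mule_ge0// e0.
rewrite integral_mkcond; apply: eq_integral => xi _.
rewrite patchE fourier_cyl_gauss.
have [rx|rx] := eqVneq (res H xi) chi; last first.
  by rewrite memNset ?powR0//= => /eqP; exact/negP.
rewrite mem_set//= powR_mulrn ?mulr_ge0 ?expR_ge0//; last first.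
  by rewrite /gauss_int Rintegral_ge0// => y _; exact: expR_ge0.
rewrite -EFinM exprMn -expRM_natl mulrC; congr (_ * _)%:E.
by congr expR; field.
Qed.

End transform.

Lemma posdef1 : posdefmx (1%:M : 'M[R]_d).
Proof.
split; first by rewrite trmx1.
move=> x x0; rewrite qform_dot mulmx1 lt_neqAle eq_sym; apply/andP; split.
  apply: contra x0 => /eqP; rewrite dotE => /psumr_eq0P h.
  apply/eqP/rowP => j; rewrite mxE; apply/eqP; rewrite -sqrf_eq0 expr2.
  by apply/eqP/h => // i _; rewrite -expr2 sqr_ge0.
by rewrite dotE sumr_ge0// => i _; rewrite -expr2 sqr_ge0.
Qed.

(** If no character restricted to [chi], the left side of [plancherel_gauss] would
    vanish, but the Gaussian integral on the right is positive. *)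
Lemma res_surjective (chi : dual R (subgroup H)) : exists xi : dual R G, res H xi = chi.
Proof.
apply/not_existsP => noxi.
have p1 := posdef1; have p2 := posdefZ (ltr0Sn R 1) p1.
have := plancherel_gauss p1 chi.
rewrite ge0_integral_restricted_image; last 2 first.
- apply/measurable_EFinP; apply: borel_continuous_measurable_real => w.
  apply: (@continuous_comp _ _ _ (fun w => - (qform (invmx 1%:M) w / 2)) expR).
    apply: continuousN.
    exact: (continuousM (@qform_continuous _ _ _ w) (@cst_continuous _ _ (2^-1 : R) w)).
  exact: continuous_expR.
- by move=> w; rewrite lee_fin expR_ge0.
have -> : [set xi : dual R G | res H xi = chi] = set0.
  by apply/seteqP; split => // xi /noxi.
rewrite integral_set0 mul0e => -[] /eqP; rewrite eq_sym gt_eqF//.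
exact: (gauss_int_gt0 minv mfin p2 fiber_measure_neq0).
Qed.

Lemma dual_fiber_measureE chi E : dual_fiber_measure chi E =
  nu [set xi | E (freq xi) /\ res H xi = chi].
Proof. by []. Qed.

Let mS chi (E : set (borel 'rV[R]_d)) : measurable E ->
  measurable ([set xi : dual R G | E (freq xi) /\ res H xi = chi] : set (borel (dual R G))).
Proof.
move=> mE; have := measurableI _ _ (freq_measurable measurableT mE) (res_fiber_measurable chi).
by rewrite setTI.
Qed.

(** Translation by [xi0] maps the characters trivial on H onto those that restrict
    like [xi0], and moves the frequency by that of [xi0]. *)
Lemma dual_fiber_measure_shift (xi0 : dual R G) (E : set (borel 'rV[R]_d)) : measurable E ->
  dual_fiber_measure (res H xi0) [set freq xi0 + w | w in (E : set 'rV[R]_d)] =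
  dual_fiber_measure 0 E.
Proof.
move=> mE; rewrite !dual_fiber_measureE -(nu_inv xi0 (mS 0 mE)); congr (nu _).
apply/seteqP; split=> [xi /= [[w Ew wE] rx]|_ /= [xi [Exi rx] <-]].
  exists (xi - xi0); last by rewrite addrC subrK.
  by rewrite resD resN rx subrr freqD freqN -wE addrC addrA addNr add0r.
by rewrite resD rx addr0; split => //; exists (freq xi) => //; rewrite freqD.
Qed.

(** Modulations have trivial restriction and arbitrary frequency. *)
Lemma dual_fiber_measure_inv (x : 'rV[R]_d) (E : set (borel 'rV[R]_d)) : measurable E ->
  dual_fiber_measure 0 [set x + w | w in (E : set 'rV[R]_d)] = dual_fiber_measure 0 E.
Proof.
move=> mE; have := dual_fiber_measure_shift (modulation A0 x) mE.
by rewrite freq_modulation res_modulation.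
Qed.

Lemma dual_fiber_measure_eq chi (E : set (borel 'rV[R]_d)) : measurable E ->
  dual_fiber_measure chi E = dual_fiber_measure 0 E.
Proof.
move=> mE; have [xi rx] := res_surjective chi.
rewrite -[in RHS](dual_fiber_measure_inv (- freq xi) mE).
have mE' : measurable ([set - freq xi + w | w in (E : set 'rV[R]_d)] : set (borel 'rV[R]_d)).
  rewrite (_ : [set _ | _ in _] = [set w | E (freq xi + w)]).
    rewrite -[X in measurable X]setTI.
    exact: (borel_continuous_measurable (@addl_continuous _ (freq xi))).
  apply/seteqP; split => [_ [w Ew <-]|w /= Ew]; first by rewrite /= addNKr.
  by exists (freq xi + w) => //; rewrite addKr.
rewrite -(dual_fiber_measure_shift xi mE') rx; congr (dual_fiber_measure _ _).
apply/seteqP; split=> [w Ew|_ [_ [w Ew <-] <-]]; last by rewrite addNKr.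
by exists (- freq xi + w); [exists w|rewrite addNKr].
Qed.

End dual_fibers.

(** * Product measures without sigma-finiteness *)

Section product_of_open_sets.
Context (R : realType) (A B : topologicalZmodType).
Hypotheses (hA : hausdorff_space A) (hB : hausdorff_space B).
Context (mu : {measure set (borel A) -> \bar R}).
Context (nu : {measure set (borel B) -> \bar R}).
Context (lam : {measure set (borel (prodg A B)) -> \bar R}).
Hypotheses (mu_haar : is_haar mu) (nu_haar : is_haar nu).
Hypothesis lam_prod : is_product_haar mu nu lam.

Lemma prodg_open (U : set A) (V : set B) : open U -> open V ->
  open (U `*` V : set (prodg A B)).
Proof.
move=> oU oV; rewrite (_ : _ `*` _ =
  ((fst : prodg A B -> A) @^-1` U) `&` ((snd : prodg A B -> B) @^-1` V))//.
apply: openI; apply: open_comp => // z _.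
- exact: prodg_fst_continuous.
- exact: prodg_snd_continuous.
Qed.

(** Exhaust by compact sets: a compact subset of the rectangle lies in the compact
    rectangle of its projections.  When one side has infinite measure, the
    product is infinite unless the other side is null. *)
Lemma product_haar_open (U : set A) (V : set B) : open U -> open V ->
  (lam (U `*` V) = mu U * nu V)%E.
Proof.
move=> oU oV.
have [lam_haar lamE] := lam_prod.
have [_ _ _ _ mu_in] := mu_haar; have [_ _ _ _ nu_in] := nu_haar.
have [_ _ _ _ lam_in] := lam_haar.
have [_ _ mu_fin _ _] := mu_haar; have [_ _ nu_fin _ _] := nu_haar.
have mO (C : topologicalZmodType) (W : set (borel C)) : open (W : set C) -> measurable W.
  exact: borel_open.
have mK (C : topologicalZmodType) (W : set (borel C)) : hausdorff_space C ->
    compact (W : set C) -> measurable W.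
  by move=> hC cW; apply: borel_closed; exact: compact_closed.
have hAB := prodg_hausdorff hA hB.
apply/eqP; rewrite eq_le; apply/andP; split.
  rewrite (lam_in _ (prodg_open oU oV)); apply: ge_ereal_sup => _ [K [cK KUV] <-].
  pose K1 : set A := (fst : prodg A B -> A) @` K.
  pose K2 : set B := (snd : prodg A B -> B) @` K.
  have cK1 : compact K1.
    by apply: continuous_compact cK; apply: continuous_subspaceT; exact: prodg_fst_continuous.
  have cK2 : compact K2.
    by apply: continuous_compact cK; apply: continuous_subspaceT; exact: prodg_snd_continuous.
  apply: (@le_trans _ _ (lam (K1 `*` K2))).
    apply: le_measure; rewrite ?inE.
    - exact: mK.
    - by apply: mK => //; exact: compact_setX.
    - by move=> z Kz; split; exists z.
  rewrite lamE// lee_pmul//.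
  - apply: le_measure; rewrite ?inE; [exact: mK|exact: mO|].
    by move=> _ [z /KUV[Uz _] <-].
  - apply: le_measure; rewrite ?inE; [exact: mK|exact: mO|].
    by move=> _ [z /KUV[_ Vz] <-].
have step (K : set A) (L : set B) : compact K -> K `<=` U -> compact L -> L `<=` V ->
    (mu K * nu L <= lam (U `*` V))%E.
  move=> cK KU cL LV; rewrite -lamE//; apply: le_measure; rewrite ?inE.
  - by apply: mK => //; exact: compact_setX.
  - by apply: mO; exact: prodg_open.
  - by move=> z [Kz Lz]; split; [exact: KU|exact: LV].
have step2 (K : set A) : compact K -> K `<=` U -> (mu K * nu V <= lam (U `*` V))%E.
  move=> cK KU; rewrite (nu_in _ oV).
  have fK : mu K \is a fin_num by rewrite ge0_fin_numE// mu_fin.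
  rewrite -(fineK fK) -ereal_supZl.
  - apply: ge_ereal_sup => _ [_ [L [cL LV] <-] <-].
    by rewrite fineK// step.
  - by apply/set0P; exists (nu set0); exists set0 => //; split => //; exact: compact0.
  - by rewrite fine_ge0.
have [nuV|nuV] := boolP (nu V \is a fin_num).
  rewrite (mu_in _ oU) muleC -(fineK nuV) -ereal_supZl.
  - apply: ge_ereal_sup => _ [_ [K [cK KU] <-] <-].
    by rewrite fineK// muleC step2.
  - by apply/set0P; exists (mu set0); exists set0 => //; split => //; exact: compact0.
  - by rewrite fine_ge0.
have nuVy : nu V = +oo%E.
  by apply/eqP; move: nuV; rewrite ge0_fin_numE// ltey negbK.
have [->|muU] := eqVneq (mu U) 0%E; first by rewrite mul0e.
have [K [cK KU] K0] : exists2 K : set A, compact K /\ K `<=` U & (0 < mu K)%E.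
  apply/not_exists2P => noK; move/eqP: muU; apply.
  rewrite (mu_in _ oU); apply/eqP; rewrite eq_le; apply/andP; split.
    apply: ge_ereal_sup => _ [K cKU <-].
    by have [//|/negP] := noK K; rewrite -leNgt.
  by apply: ereal_sup_ubound; exists set0; [split => //; exact: compact0|exact: measure0].
have := step2 K cK KU; rewrite nuVy gt0_muley// leye_eq => /eqP ->.
exact: leey.
Qed.

End product_of_open_sets.

Section product_of_borel.
Context (A B : topologicalZmodType).

Definition open_rect : set (set (borel A * borel B)) :=
  [set E | exists2 U : set A, open U & exists2 V : set B, open V & E = U `*` V].

(** The rectangles with one full side make both projections measurable. *)
Lemma measurable_open_rect :
  @measurable _ (borel A * borel B)%type = <<s open_rect >>.
Proof.
apply/seteqP; split; last first.
  apply: smallest_sub; first exact: sigma_algebra_measurable.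
  by move=> _ [U oU [V oV ->]]; apply: measurableX; exact: borel_open.
rewrite measurable_prod_measurableType; apply: smallest_sub.
  exact: smallest_sigma_algebra.
move=> _ [E mE [F mF <-]].
pose T := g_sigma_algebraType open_rect.
have mfst : measurable_fun [set: T] (fst : T -> borel A).
  apply: (measurability (@open A : set (set (borel A)))) => //.
  move=> _ [U oU <-]; rewrite setTI; apply: sub_sigma_algebra.
  exists U => //; exists setT; first exact: openT.
  by apply/seteqP; split => x //= [].
have msnd : measurable_fun [set: T] (snd : T -> borel B).
  apply: (measurability (@open B : set (set (borel B)))) => //.
  move=> _ [U oU <-]; rewrite setTI; apply: sub_sigma_algebra.
  exists setT; first exact: openT.
  by exists U => //; apply/seteqP; split => x //= [].
have := measurableI _ _ (mfst measurableT _ mE) (msnd measurableT _ mF).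
by rewrite !setTI.
Qed.

Context (R : realType).
Context (m1 : {measure set (borel A) -> \bar R}) (m2 : {measure set (borel B) -> \bar R}).
Context (q1 : A -> R) (q2 : B -> R).
Hypotheses (cq1 : continuous q1) (cq2 : continuous q2).
Hypothesis fin1 : forall k : R, (m1 [set x | (q1 x < k)%R] < +oo)%E.
Hypothesis fin2 : forall k : R, (m2 [set x | (q2 x < k)%R] < +oo)%E.

Lemma sublevel_open (C : topologicalZmodType) (q : C -> R) (k : R) : continuous q ->
  open [set x | q x < k].
Proof.
move=> cq; apply: (@open_comp _ _ q [set x | x < k]); last exact: open_lt.
by move=> x _; exact: cq.
Qed.

Lemma sublevel_cover (C : topologicalZmodType) (q : C -> R) :
  \bigcup_k [set x | q x < k%:R] = setT.
Proof.
apply/seteqP; split => // x _; exists (Num.truncn (q x)).+1 => //=.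
exact: truncnS_gt.
Qed.

Lemma sublevel_sigma_finite (C : topologicalZmodType) (q : C -> R)
  (l : {measure set (borel C) -> \bar R}) : continuous q ->
  (forall k : R, (l [set x | (q x < k)%R] < +oo)%E) -> sigma_finite setT l.
Proof.
move=> cq fq; exists (fun k : nat => [set x | q x < k%:R]).
  by rewrite sublevel_cover.
by move=> k; split => //; apply: borel_open; exact: sublevel_open.
Qed.

(** The two sides integrate [F] against the image of [l] under (p, q) and against
    the product measure.  These measures agree on open rectangles, which are stable
    under intersection and generate; the sublevel sets of [q1] and [q2] exhaust by
    rectangles of finite measure. *)
Lemma integral_pair_fubini (d : measure_display) (X : measurableType d)
    (l : {measure set X -> \bar R}) (D : set X) (p : X -> borel A) (q : X -> borel B)
    (F : borel A * borel B -> \bar R) :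
  measurable D -> measurable_fun setT p -> measurable_fun setT q ->
  (forall (U : set A) (V : set B), open U -> open V ->
    l [set x | [/\ D x, U (p x) & V (q x)]] = (m1 U * m2 V)%E) ->
  measurable_fun setT F -> (forall z, 0 <= F z)%E ->
  (\int[l]_(x in D) F (p x, q x) = \int[m1]_x \int[m2]_y F (x, y))%E.
Proof.
move=> mD mp mq lUV mF F0.
have s1 := sublevel_sigma_finite cq1 fin1.
pose sf1 := isSFinite.Build _ _ _ _ (sfinite_measure_sigma_finite s1).
pose sg1 := isSigmaFinite.Build _ _ _ _ s1.
pose M1 := HB.pack_for (SigmaFiniteMeasure.type (borel A) R) (Measure.sort m1) sf1 sg1.
have s2 := sublevel_sigma_finite cq2 fin2.
pose sf2 := isSFinite.Build _ _ _ _ (sfinite_measure_sigma_finite s2).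
pose sg2 := isSigmaFinite.Build _ _ _ _ s2.
pose M2 := HB.pack_for (SigmaFiniteMeasure.type (borel B) R) (Measure.sort m2) sf2 sg2.
have mpq : measurable_fun [set: X] (fun x => (p x, q x)).
  exact: measurable_fun_pair.
rewrite -(ge0_integral_restricted_image l mD mpq mF F0).
rewrite -(@fubini_tonelli1 _ _ _ _ _ M1 M2 F mF F0).
have restrE (U : set A) (V : set B) : open U -> open V ->
    restricted_image l mD mpq (U `*` V) = (m1 U * m2 V)%E.
  move=> oU oV; rewrite restricted_imageE -lUV//; congr (l _).
  by apply/seteqP; split => [x [[] ? ? ?]|x [? ? ?]]; split.
apply: (@eq_measure_integral _ _ _ setT (M1 \x M2)%E (restricted_image l mD mpq)) => E mE _.
apply: (@measure_unique _ _ _ open_rect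
  (fun k : nat => [set x | q1 x < k%:R] `*` [set x | q2 x < k%:R])) => //.
- exact: measurable_open_rect.
- move=> _ _ [U oU [V oV ->]] [U' oU' [V' oV' ->]].
  exists (U `&` U'); first exact: openI.
  exists (V `&` V'); first exact: openI.
  by rewrite setXI.
- move=> k; exists [set x | q1 x < k%:R]; first exact: sublevel_open.
  by exists [set x | q2 x < k%:R]; first exact: sublevel_open.
- apply/seteqP; split => // -[x y] _.
  pose k := maxn (Num.truncn (q1 x)).+1 (Num.truncn (q2 y)).+1.
  exists k => //; split => /=.
  + by rewrite (lt_le_trans (truncnS_gt _))// ler_nat leq_maxl.
  + by rewrite (lt_le_trans (truncnS_gt _))// ler_nat leq_maxr.
- move=> _ [U oU [V oV ->]]; apply: (etrans (restrE U V oU oV)).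
  apply: esym; apply: (@product_measure1E _ _ _ _ _ M1 M2); exact: borel_open.
- move=> k.
  have : (m1 [set x | (q1 x < k%:R)%R] * m2 [set x | (q2 x < k%:R)%R] < +oo)%E.
    by rewrite lte_mul_pinfty// ge0_fin_numE.
  by rewrite -restrE; [|exact: sublevel_open|exact: sublevel_open].
Qed.

End product_of_borel.

(** * The region supporting the short-time Fourier transform *)

Section graph_region.
Context (R : realType) (d : nat) (A0 : topologicalZmodType) (H : zmodClosed A0).
Local Notation G := (prodg 'rV[R]_d A0).
Hypothesis oH : open [set x : A0 | x \in H].
Hypothesis cH : compact [set x : A0 | x \in H].
Context (mu : {measure set (borel G) -> \bar R}).
Context (nu : {measure set (borel (dual R G)) -> \bar R}).
Context (lam : {measure set (borel (prodg G (dual R G))) -> \bar R}).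
Hypothesis mu_haar : is_haar mu.
Hypothesis nu_haar : is_haar nu.
Hypothesis mu_nu : plancherel mu nu.
Hypothesis lam_prod : is_product_haar mu nu lam.
Hypothesis hausG : hausdorff_space G.

Let mu_inv (x : G) (E : set (borel G)) : measurable E ->
  mu [set x + y | y in (E : set G)] = mu E.
Proof. by case: mu_haar => _ + _ _ _ => h /h; exact. Qed.

Local Notation m := (fiber_measure oH mu 0).
Local Notation n := (dual_fiber_measure cH nu 0).

Context (a : A0) (label : subgroup H -> dual R (subgroup H)).
Hypothesis label_finite : finite_set (range label).
Hypothesis label_open : forall chi, open [set h | label h = chi].

(** The region where the short-time Fourier transform does not vanish: a graph over
    the A0-component, up to the restriction map. *)
Definition graph_region : set (prodg G (dual R G)) :=
  [set w | exists h, w.1.2 = a + val h /\ res H w.2 = label h].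

Let base (U : set 'rV[R]_d) chi : set G :=
  [set z | U z.1 /\ exists h, z.2 = a + val h /\ label h = chi].

Let fibre (V : set 'rV[R]_d) chi : set (dual R G) :=
  [set xi | V (freq xi) /\ res H xi = chi].

Let base_open U chi : open U -> open (base U chi).
Proof.
move=> oU; rewrite (_ : base U chi = U `*` [set x : A0 |
   [set val h | h in [set h | label h = chi]] (- a + x)]).
  apply: prodg_open => //; apply: (@open_comp _ _ (fun x : A0 => - a + x)
    [set val h | h in [set h | label h = chi]]).
    by move=> x _; exact: addl_continuous.
  by apply: subgroup_open.
apply/seteqP; split=> [z [Uz [h [zh lh]]]|z [Uz [h lh zh]]].
  by split => //; exists h => //; rewrite zh addKr.
by split => //; exists h; split => //; rewrite (zh : val h = - a + z.2) addNKr.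
Qed.

Let fibre_open V chi : open V -> open (fibre V chi).
Proof.
move=> oV; rewrite (_ : fibre V chi = (@freq R d A0) @^-1` V `&` [set xi | res H xi = chi])//.
apply: openI; last exact: res_fiber_open.
by apply: open_comp => // xi _; exact: freq_continuous.
Qed.

(** One rectangle for each value of the label. *)
Lemma graph_region_bigcup U V :
  [set w | [/\ graph_region w, U w.1.1 & V (freq w.2)]] =
  \bigcup_(chi in range label) (base U chi `*` fibre V chi : set (prodg G (dual R G))).
Proof.
apply/seteqP; split=> [w [[h [wh rw]] Uw Vw]|w [_ [h _ <-] [[Uw [k [wk lk]]] [Vw rw]]]].
  exists (label h); first by exists h.
  by split; split => //; exists h.
by split => //; exists k; split => //; rewrite rw lk.
Qed.

Lemma graph_region_open U V : open U -> open V ->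
  open [set w | [/\ graph_region w, U w.1.1 & V (freq w.2)]].
Proof.
move=> oU oV; rewrite graph_region_bigcup; apply: bigcup_open => chi _.
by apply: prodg_open; [exact: base_open|exact: fibre_open].
Qed.

Lemma graph_region_measurable : measurable (graph_region : set (borel (prodg G (dual R G)))).
Proof.
apply: borel_open; rewrite (_ : graph_region = [set w | [/\ graph_region w, [set: 'rV[R]_d] w.1.1 &
   [set: 'rV[R]_d] (freq w.2)]]).
  by apply: graph_region_open; exact: openT.
by apply/seteqP; split => w //= [].
Qed.

(** The fibers above all labels have the same measure [n V], so the sum over the
    labels adds up the measures of the pieces of the coset. *)
Lemma lam_graph_region U V : open U -> open V ->
  (lam [set w | [/\ graph_region w, U w.1.1 & V (freq w.2)]] = m U * n V)%E.
Proof.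
move=> oU oV; rewrite graph_region_bigcup.
have obf chi : open (base U chi `*` fibre V chi : set (prodg G (dual R G))).
  by apply: prodg_open; [exact: base_open|exact: fibre_open].
have hdual := @dual_hausdorff R G.
rewrite (@measure_fin_bigcup _ _ _ lam)//; last 2 first.
- apply/trivIsetP => chi chi' _ _ cc'; apply/seteqP; split => // w [[_ [_ r1]] [_ [_ r2]]].
  by move/eqP: cc'; apply; rewrite -r1 -r2.
- by move=> chi _; exact: (borel_open (obf chi)).
have fibreE chi : (nu (fibre V chi) = n V)%E.
  rewrite -(dual_fiber_measure_eq oH cH mu_haar nu_haar mu_nu hausG chi)//.
  exact: borel_open.
rewrite (eq_fsbigr (fun chi => mu (base U chi) * n V)%E); last first.
  move=> chi _.
  apply: (etrans (product_haar_open hausG hdual mu_haar nu_haar lam_prod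
    (@base_open U chi oU) (@fibre_open V chi oV))).
  by rewrite fibreE.
rewrite -ge0_mule_fsuml; last by move=> chi; exact: measure_ge0.
congr (_ * _)%E.
rewrite -(fiber_measure_coset oH mu_inv a (borel_open oU)) fiber_measureE.
rewrite -(@measure_fin_bigcup _ _ _ mu)//; last 2 first.
- apply/trivIsetP => chi chi' _ _ cc'; apply/seteqP; split => // z.
  move=> [[_ [h [zh lh]]] [_ [k [zk lk]]]].
  move/eqP: cc'; apply; rewrite -lh -lk; congr label; apply: val_inj.
  by apply: (addrI a); rewrite -zh -zk.
- by move=> chi _; exact: (borel_open (@base_open U chi oU)).
congr (mu _); apply/seteqP; split=> [z [_ [h _ <-] [Uz [k [zk lk]]]]|z [Uz za]].
  by split => //; rewrite zk addrAC subrr add0r; exact: valP.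
pose h : subgroup H := exist _ (z.2 - a) za.
exists (label h); first by exists h.
by split => //; exists h; split => //=; rewrite addrC subrK.
Qed.

End graph_region.

(** * Normal form of matched Gaussians *)

Section gaussian_normal_form.
Context (R : realType) (d : nat).
Local Notation Re := (@complex.Re R).
Local Notation Im := (@complex.Im R).
Implicit Types (alpha beta : 'M[R]_d) (b w x y : 'rV[R]_d).

(** Normal form of a Gaussian: [b] is the center and exp [k] the height of the
    modulus, while the phase is real quadratic. *)
Definition chirped alpha beta (k : R) b w (t : R) y : R[i] :=
  (expR (k - qform alpha (y - b)))%:C * cis (qform beta y + dot w y + t).

Lemma Re_linear_form (gamma : 'rV[R[i]]_d) y :
  Re (\sum_(j < d) gamma ord0 j * (y ord0 j)%:C) = dot (map_mx Re gamma) y.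
Proof.
rewrite dotE (big_morph Re (id1 := 0) (op1 := +%R)) //; last by case=> ? ? [].
apply: eq_bigr => j _; rewrite mxE; case: (gamma ord0 j) => p q /=.
by rewrite mulr0 subr0.
Qed.

Lemma Im_linear_form (gamma : 'rV[R[i]]_d) y :
  Im (\sum_(j < d) gamma ord0 j * (y ord0 j)%:C) = dot (map_mx Im gamma) y.
Proof.
rewrite dotE (big_morph Im (id1 := 0) (op1 := +%R)) //; last by case=> ? ? [].
apply: eq_bigr => j _; rewrite mxE; case: (gamma ord0 j) => p q /=.
by rewrite mulr0 add0r.
Qed.

(** The real part of the linear term is absorbed into the center [b], which solves
    2 b alpha = v. *)
Lemma gaussian_chirped alpha beta f : is_gaussian alpha beta f ->
  exists k b w t, f = chirped alpha beta k b w t.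
Proof.
move=> [pa _ [gamma [delta ->]]].
pose v := map_mx Re gamma.
pose b := 2^-1 *: (v *m invmx alpha).
exists (qform alpha b + Re delta), b, (map_mx Im gamma), (Im delta).
apply/funext => y; rewrite /gaussian_fun /chirped /cexp.
have ReD (z z' : R[i]) : Re (z + z') = Re z + Re z' by case: z; case: z'.
have ImD (z z' : R[i]) : Im (z + z') = Im z + Im z' by case: z; case: z'.
rewrite !ReD !ImD Re_linear_form Im_linear_form /=.
congr ((expR _)%:C * _).
have cs : - qform alpha (b + (y - b)) + dot v (b + (y - b)) =
  qform (invmx alpha) v / 4 - qform alpha (y - b) := complete_square pa v (y - b).
rewrite (addrC b) subrK in cs.
have qb : qform (invmx alpha) v / 4 = qform alpha b.
  rewrite !qform_dot /b -scalemxAl mulmxKV ?posdef_unit// dotZl dotZr.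
  by rewrite (dotC v) -qform_dot; field.
by rewrite cs qb; ring.
Qed.

(** The two moduli have centers b1 and b2 + x, so the product of the Gaussians is
    one of twice the form, centered at the midpoint, times a factor that depends
    on the distance of the centers; in the phases the quadratic terms in y cancel. *)
Lemma chirped_product alpha beta k1 k2 b1 b2 w1 w2 t1 t2 x w y :
  alpha^T = alpha -> beta^T = beta ->
  chirped alpha beta k1 b1 w1 t1 y *
    ((chirped alpha beta k2 b2 w2 t2 (y - x))^* * (cis (dot w y))^*) =
  ((expR (k1 + k2 - qform alpha (x - (b1 - b2)) / 2))%:C *
    cis (- qform beta x + dot w2 x + t1 - t2)) *
  gauss_phase (2 *: alpha) (2^-1 *: (b1 + b2 + x))
    (2 *: (x *m beta) + (w1 - w2) - w) y.
Proof.
move=> sa sb; rewrite /chirped /gauss_phase.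
set e1 := expR (k1 - _); set e2 := expR (k2 - _).
set p1 := qform beta y + _ + _; set p2 := qform beta (y - x) + _ + _.
have conjM (z z' : R[i]) : Num.conj (z * z') = Num.conj z * Num.conj z'.
  exact: rmorphM.
have conjR (r : R) : Num.conj r%:C = r%:C := conjc_real r.
have conj_cisE s : Num.conj (cis s) = cis (- s) :> R[i] := conj_cis s.
rewrite conjM conjR !conj_cisE.
rewrite (_ : _ * _ = (e1 * e2)%:C * cis (p1 - p2 - dot w y)); last first.
  by rewrite rmorphM /= !cisD; ring.
set e3 := expR _; set e4 := expR _; set p3 := - qform beta x + _ + _ - _.
rewrite [RHS](_ : _ = (e3 * e4)%:C * cis (p3 + dot (2 *: (x *m beta) + (w1 - w2) - w) y)); last first.
  by rewrite rmorphM /= !cisD; ring.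
congr (_%:C * cis _); last first.
  rewrite /p1 /p2 /p3 (qformD _ _ sb) qformN !dotDl !dotDr !dotNl !dotNr dotZl.
  by rewrite (dot_mulmxC beta y x) sb (dotC y); ring.
rewrite /e1 /e2 /e3 /e4 -!expRD; congr expR.
rewrite qformZmx.
have sc (r : R) (p : 'rV[R]_d) : (r *: p) *m alpha = r *: (p *m alpha).
  by rewrite scalemxAl.
have sD (p q : 'rV[R]_d) : dot (p *m alpha) q = dot (q *m alpha) p.
  by rewrite dot_mulmxC sa dotC.
rewrite !qform_dot.
rewrite !(sc, mulmxDl, mulNmx, scalerDr, dotDl, dotDr, dotNl, dotNr, dotZl, dotZr).
rewrite (sD b1 y) (sD b2 y) (sD x y) (sD b2 b1) (sD x b1) (sD x b2).
by field.
Qed.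

End gaussian_normal_form.

(** * The modulus of the short-time Fourier transform *)

(** A point where both [y] and [y - x] meet the supports forces [x] into the coset
    of [a - b]. *)
Lemma coset_far_identity (V : zmodType) (x y a b : V) :
  (y - a) - (y - x - b) = x - (a - b).
Proof. by rewrite !opprB [b + _]addrC addrA [_ + (x - y)]addrC subrKA -addrA [- a + b]addrC. Qed.

Lemma coset_near_identity (V : zmodType) (a b k l : V) :
  a - (a - b + k) + l - b = l - k.
Proof.
by rewrite opprD opprB addrA [a + _]addrC subrK [LHS]addrC -!addrA addKr addrC.
Qed.

Section stft_formula.
Context (R : realType) (d : nat) (A0 : topologicalZmodType) (H : zmodClosed A0).
Local Notation G := (prodg 'rV[R]_d A0).
Hypothesis oH : open [set x : A0 | x \in H].
Hypothesis cH : compact [set x : A0 | x \in H].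
Context (mu : {measure set (borel G) -> \bar R}).
Hypothesis mu_haar : is_haar mu.

Let mu_inv (x : G) (E : set (borel G)) : measurable E ->
  mu [set x + y | y in (E : set G)] = mu E.
Proof. by case: mu_haar => _ + _ _ _ => h /h; exact. Qed.

Let mu_fin (K : set G) : compact K -> (mu K < +oo)%E.
Proof. by case: mu_haar => _ _ + _ _; exact. Qed.

Local Notation m := (fiber_measure oH mu 0).

Lemma is_character_subgroup (eta : dual R A0) :
  is_character (fun h : subgroup H => eta (val h)).
Proof.
split=> [h|h|g h].
- apply: (@continuous_comp _ _ _ (val : subgroup H -> A0)); last exact: dual_continuous.
  exact: subgroup_val_continuous.
- exact: dual_norm.
- exact: (dual_add eta (val g) (val h)).
Qed.

Definition restrict_dual (eta : dual R A0) : dual R (subgroup H) :=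
  Dual (is_character_subgroup eta).

Context (alpha beta : 'M[R]_d).
Hypothesis pa : posdefmx alpha.
Hypothesis sb : beta^T = beta.
Context (k1 k2 : R) (b1 b2 w1 w2 : 'rV[R]_d) (t1 t2 : R).
Context (c1 c2 : R[i]) (a1 a2 : A0) (eta1 eta2 : dual R A0).
Context (phi : subgroup H -> dual R (subgroup H)) (h : A0 -> R[i]).
Hypothesis h_char : second_degree_char phi (fun x : subgroup H => h (val x)).
Hypothesis h_out : forall x, x \notin H -> h x = 0.

Local Notation f1 := (chirped alpha beta k1 b1 w1 t1).
Local Notation g1 := (chirped alpha beta k2 b2 w2 t2).
Local Notation f2 := (fun y => c1 * tf_shift ((a1, eta1) : prodg A0 (dual R A0)) h y).
Local Notation g2 := (fun y => c2 * tf_shift ((a2, eta2) : prodg A0 (dual R A0)) h y).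

(** The restriction to H that a character must have, at the point a1 - a2 + k, for
    the short-time Fourier transform not to vanish. *)
Definition stft_label (k : subgroup H) : dual R (subgroup H) :=
  phi k + restrict_dual eta1 - restrict_dual eta2.

(** The factor of the integrand that depends on the A0-component [y]. *)
Definition coset_product (xi : dual R G) (x y : A0) : R[i] :=
  f2 y * ((g2 (y - x))^* * (xi (0, y))^*).

Lemma coset_product_out xi x y : y - a1 \notin H -> coset_product xi x y = 0.
Proof. by move=> ya; rewrite /coset_product /tf_shift /= h_out// !mulr0 mul0r. Qed.

Lemma coset_product_far xi x y : x - (a1 - a2) \notin H -> coset_product xi x y = 0.
Proof.
move=> xa; have [ya|/coset_product_out//] := boolP (y - a1 \in H).
have yxa : y - x - a2 \notin H.
  apply: contra xa => yxa.
  by rewrite -(coset_far_identity x y); exact: rpredB.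
have -> : coset_product xi x y = f2 y * ((0 : R[i])^* * (xi (0, y))^*).
  by rewrite /coset_product /tf_shift /= (h_out yxa) !mulr0.
by rewrite rmorph0 mul0r mulr0.
Qed.

(** By the second degree identity h (l) conj (h (l - k)) is h (k) conj (phi k k)
    times the character [phi k] of l; collecting the other characters gives
    [stft_label]. *)
Lemma coset_product_near xi (k : subgroup H) : exists2 kap : R[i],
  Normc.normc kap = Normc.normc c1 * Normc.normc c2 &
  forall l : subgroup H, coset_product xi (a1 - a2 + val k) (a1 + val l) =
    kap * (stft_label k - res H xi) l.
Proof.
have [_ h1 hD] := h_char.
pose x := a1 - a2 + val k.
exists (c1 * Num.conj c2 * eta1 a1 * Num.conj (eta2 (a1 - x)) * h (val k)
  * Num.conj (phi k k) * Num.conj (xi (0, a1))).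
  rewrite !normc_mul.
  have nJ (z : R[i]) : Normc.normc (Num.conj z) = Normc.normc z.
    by apply: complexI; rewrite -!normr_normc norm_conjC.
  by rewrite !nJ !(normc_unit (dual_norm _ _)) (normc_unit (h1 k)) !mulr1.
move=> l; set rhs := (stft_label k - res H xi) l.
rewrite /coset_product /tf_shift /=.
have conjM (z z' : R[i]) : Num.conj (z * z') = Num.conj z * Num.conj z'.
  exact: rmorphM.
have e1 : a1 + val l - a1 = val l by rewrite addrAC subrr add0r.
have e2 : a1 + val l - x = (a1 - x) + val l by rewrite addrAC.
have e3 : a1 - x + val l - a2 = val (l - k) := coset_near_identity a1 a2 (val k) (val l).
rewrite -/x e1 e2 e3 dual_add [eta2 _]dual_add.
have -> : ((0, a1 + val l) : G) = ((0, a1) : G) + ((0, val l) : G).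
  by change ((0, a1 + val l) = (0 + 0, a1 + val l) :> G); rewrite addr0.
rewrite (dual_add xi) !conjM.
have hl : h (val l) * Num.conj (h (val (l - k))) =
    h (val k) * (phi k l * Num.conj (phi k k)).
  have := hD (l - k) k; rewrite subrK => ->.
  rewrite dual_add (_ : phi k (- k) = Num.conj (phi k k)); last first.
    apply: (mulfI (dual_neq0 (phi k) k)); rewrite -dual_add subrr dual_zero.
    by rewrite dual_conjM.
  have hh : h (val (l - k)) * Num.conj (h (val (l - k))) = 1.
    by rewrite -[LHS]/(_ * conjc _) -sqr_normc h1 expr1n.
  transitivity ((h (val (l - k)) * Num.conj (h (val (l - k)))) *
    (h (val k) * (phi k l * Num.conj (phi k k)))); first by ring.
  by rewrite hh mul1r.
have lab : rhs =
    phi k l * eta1 (val l) * Num.conj (eta2 (val l)) * Num.conj (xi (0, val l)) by [].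
rewrite lab.
transitivity (c1 * Num.conj c2 * eta1 a1 * eta1 (val l) * Num.conj (eta2 (a1 - x)) *
  Num.conj (eta2 (val l)) * Num.conj (xi (0, a1)) * Num.conj (xi (0, val l)) *
  (h (val l) * Num.conj (h (val (l - k))))); first by ring.
by rewrite hl; ring.
Qed.

(** The maximum of the modulus of the transform. *)
Definition stft_height : R :=
  expR (k1 + k2) * (Normc.normc c1 * Normc.normc c2) * gauss_int m (2 *: alpha).

Definition stft_profile (x w : 'rV[R]_d) : R :=
  expR (- (qform alpha (x - (b1 - b2)) / 2)) *
  expR (- (qform (invmx alpha) (w - (2 *: (x *m beta) + (w1 - w2))) / 8)).

Lemma stft_integrand (w : prodg G (dual R G)) (y : G) :
  tensor f1 f2 y * Num.conj (tf_shift w (tensor g1 g2) y) =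
  gauss_phase (2 *: alpha) (2^-1 *: (b1 + b2 + w.1.1))
    (2 *: (w.1.1 *m beta) + (w1 - w2) - freq w.2) y.1 *
  ((expR (k1 + k2 - qform alpha (w.1.1 - (b1 - b2)) / 2))%:C *
    cis (- qform beta w.1.1 + dot w2 w.1.1 + t1 - t2)
   * coset_product w.2 w.1.2 y.2).
Proof.
have [sa _] := pa.
have conjM (z z' : R[i]) : Num.conj (z * z') = Num.conj z * Num.conj z'.
  exact: rmorphM.
rewrite [RHS]mulrA [X in X * coset_product _ _ _]mulrC.
rewrite -(chirped_product k1 k2 b1 b2 w1 w2 t1 t2 w.1.1 (freq w.2) y.1 sa sb).
rewrite /tensor {2}/tf_shift (dual_prodg w.2 y) freqP !conjM.
rewrite -[(y - w.1).1]/(y.1 - w.1.1) -[(y - w.1).2]/(y.2 - w.1.2) /coset_product.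
set F2 := c1 * _; set G2 := c2 * _.
by rewrite /G2 /tf_shift !conjM; ring.
Qed.

Lemma normc_stft (w : prodg G (dual R G)) :
  Normc.normc (stft mu (tensor g1 g2) (tensor f1 f2) w) =
  if w \in graph_region (a1 - a2) stft_label
  then stft_height * stft_profile w.1.1 (freq w.2) else 0.
Proof.
have [sa _] := pa.
rewrite /stft /inner (eq_cintegral _ (stft_integrand w)).
have [xa|xa] := boolP (w.1.2 - (a1 - a2) \in H); last first.
  rewrite memNset; last first.
    move=> [k [wk _]]; move/negP: xa; apply.
    by rewrite wk addrAC subrr add0r; exact: valP.
  rewrite (@eq_cintegral _ _ _ _ (fun=> 0)).
    rewrite /cintegral /= (Rintegral_cst mu measurableT) mul0r.
    exact: normc_zero.
  by move=> y; rewrite coset_product_far// !mulr0.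
have [k wk] := coset_rep xa.
have [kap nkap kapE] := coset_product_near w.2 k.
pose K : R[i] := (expR (k1 + k2 - qform alpha (w.1.1 - (b1 - b2)) / 2))%:C *
    cis (- qform beta w.1.1 + dot w2 w.1.1 + t1 - t2).
pose u y := K * coset_product w.2 w.1.2 y.
have u_out y : y - a1 \notin H -> u y = 0.
  by move=> ya; rewrite /u coset_product_out// mulr0.
have u_in (l : subgroup H) : u (a1 + val l) = (K * kap) * (stft_label k - res H w.2) l.
  by rewrite /u wk kapE mulrA.
have p2 := posdefZ (ltr0Sn R 1) pa.
have := normc_cintegral_cyl_gauss oH cH mu_inv mu_fin p2 u_out u_in
  (2^-1 *: (b1 + b2 + w.1.1)) (2 *: (w.1.1 *m beta) + (w1 - w2) - freq w.2).
rewrite /cyl_gauss => ->.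
have -> : (w \in graph_region (a1 - a2) stft_label) = (stft_label k - res H w.2 == 0).
  rewrite subr_eq0; apply/idP/idP.
    rewrite inE => -[l [wl rl]]; rewrite rl; apply/eqP; congr stft_label.
    by apply: val_inj; apply: (addrI (a1 - a2)); rewrite -wl -wk.
  by move=> /eqP e; rewrite inE; exists k; rewrite e.
case: ifP => // _.
rewrite !normc_mul normc_real ?expR_ge0// (normc_unit (normr_cis _)) mulr1 nkap.
rewrite /stft_height /stft_profile expRD.
have -> : qform (invmx (2 *: alpha)) (2 *: (w.1.1 *m beta) + (w1 - w2) - freq w.2) / 4 =
   qform (invmx alpha) (freq w.2 - (2 *: (w.1.1 *m beta) + (w1 - w2))) / 8.
  rewrite -opprB qformN invmxZ ?unitfE// ?unitrE ?divff ?posdef_unit//.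
  by rewrite qformZmx; field.
by ring.
Qed.

End stft_formula.

(** * The Lebesgue norms *)

Lemma measurable_qform (R : realType) (d : nat) (disp : measure_display)
    (T : measurableType disp) (M : 'M[R]_d) (v : T -> 'rV[R]_d) :
  (forall j, measurable_fun setT (fun t => v t ord0 j)) ->
  measurable_fun setT (fun t => qform M (v t)).
Proof.
move=> mv.
rewrite (_ : (fun t => qform M (v t)) =
  fun t => \sum_(j < d) (\sum_(i < d) v t ord0 i * M i j) * v t ord0 j).
  apply: measurable_sum => j; apply: measurable_funM => //.
  by apply: measurable_sum => i; apply: measurable_funM.
apply/funext => t; rewrite qform_dot dotE; apply: eq_bigr => j _.
by rewrite mxE.
Qed.

Section lieb_equality.
Context (R : realType) (d : nat) (A0 : topologicalZmodType) (H : zmodClosed A0).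
Local Notation G := (prodg 'rV[R]_d A0).
Hypothesis oH : open [set x : A0 | x \in H].
Hypothesis cH : compact [set x : A0 | x \in H].
Context (mu : {measure set (borel G) -> \bar R}).
Context (nu : {measure set (borel (dual R G)) -> \bar R}).
Hypothesis mu_haar : is_haar mu.
Hypothesis nu_haar : is_haar nu.
Hypothesis mu_nu : plancherel mu nu.
Hypothesis hausG : hausdorff_space G.

Let mu_inv (x : G) (E : set (borel G)) : measurable E ->
  mu [set x + y | y in (E : set G)] = mu E.
Proof. by case: mu_haar => _ + _ _ _ => h /h; exact. Qed.

Let mu_fin (K : set G) : compact K -> (mu K < +oo)%E.
Proof. by case: mu_haar => _ _ + _ _; exact. Qed.

Let minv := fiber_measure_inv oH mu_inv.
Let mfin := fiber_measure_fin oH mu_fin cH.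

Local Notation m := (fiber_measure oH mu 0).
Local Notation n := (dual_fiber_measure cH nu 0).

Context (alpha : 'M[R]_d).
Hypothesis pa : posdefmx alpha.
Local Notation I := (gauss_int m).

Let Ipos (s : R) : 0 < s -> 0 < I (s *: alpha).
Proof.
move=> s0; apply: (gauss_int_gt0 minv mfin (posdefZ s0 pa)).
exact: fiber_measure_neq0.
Qed.

Lemma invmx_scale (s : R) w : 0 < s ->
  qform (invmx (s *: alpha)) w = s^-1 * qform (invmx alpha) w.
Proof.
move=> s0; rewrite invmxZ ?qformZmx//.
by apply: posdef_unit; exact: posdefZ.
Qed.

(** The Plancherel identity for the form s alpha, solved for the dual side. *)
Lemma dual_gauss_integral (s : R) : 0 < s ->
  (\int[n]_w (expR (- (qform (invmx alpha) w / (2 * s))))%:E =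
   (I ((2 * s) *: alpha) / I (s *: alpha) ^+ 2)%:E)%E.
Proof.
move=> s0; have ps := posdefZ s0 pa.
have := plancherel_gauss oH cH mu_haar mu_nu ps 0.
rewrite scalerA.
under eq_integral do rewrite invmx_scale//.
rewrite (eq_integral (fun w : borel 'rV[R]_d =>
  (expR (- (qform (invmx alpha) w / (2 * s))))%:E)); last first.
  by move=> w _; congr (expR _)%:E; field; rewrite gt_eqF.
have I2 : I (s *: alpha) ^+ 2 != 0 by rewrite expf_neq0// gt_eqF ?Ipos.
move=> E; rewrite EFinM -E -muleA -EFinM mulfV// mule1.
by [].
Qed.

Context (beta : 'M[R]_d).
Context (h : A0 -> R[i]) (phi : subgroup H -> dual R (subgroup H)).
Hypothesis h_char : second_degree_char phi (fun x : subgroup H => h (val x)).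
Hypothesis h_out : forall x, x \notin H -> h x = 0.

(** The square of the modulus is a Gaussian of the form 2 alpha on one cylinder. *)
Lemma cLnorm_tensor (k : R) (b w : 'rV[R]_d) (t : R) (c : R[i]) (a : A0) (eta : dual R A0) :
  cLnorm mu 2 (tensor (chirped alpha beta k b w t)
     (fun y => c * tf_shift ((a, eta) : prodg A0 (dual R A0)) h y)) =
  ((Normc.normc c * expR k) * (I (2 *: alpha)) `^ 2^-1)%:E.
Proof.
have [_ h1 _] := h_char.
have C0 : 0 <= Normc.normc c * expR k by rewrite mulr_ge0 ?normc_ge0 ?expR_ge0.
rewrite cLnormE.
rewrite (eq_integral (fun z : borel G => (cyl_fun H a (fun y =>
   (Normc.normc c * expR k) ^+ 2 * expR (- qform (2 *: alpha) (y - b))) z)%:E)); last first.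
  move=> z _; congr EFin; rewrite powR_mulrn ?normc_ge0// /tensor /tf_shift /chirped /= /cyl_fun.
  rewrite !normc_mul normc_real ?expR_ge0// (normc_unit (normr_cis _)) (normc_unit (dual_norm _ _)).
  case: ifPn => za; last by rewrite h_out// normc_zero !mulr0 expr0n.
  pose l : subgroup H := exist (fun x => x \in H) ((z : G).2 - a) za.
  have hl : Normc.normc (h (val l)) = 1 by apply: normc_unit; exact: h1.
  rewrite (hl : Normc.normc (h ((z : G).2 - a)) = 1).
  rewrite qformZmx ?mulr1 ?mul1r expRD !exprMn -mulrN -!expRM_natl.
  by ring.
have p2 := posdefZ (ltr0Sn R 1) pa.
rewrite (integral_gauss_cyl oH mu_inv mu_fin cH p2) ?sqr_ge0//.
have I0 : 0 <= I (2 *: alpha) by rewrite ltW// Ipos.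
rewrite poweR_EFin powRM ?sqr_ge0//; congr (_ * _)%:E.
by rewrite -powR_mulrn// -powRrM mulfV ?pnatr_eq0// powRr1.
Qed.

(** Raising to the power p dilates the form in x to (p / 2) alpha, and in w gives
    Q' / (2 s) with s = 4 / p.  The exponents of 2 and p then combine as
    (8 / p)^(-d/2) (4 / p)^d (p / 2)^(-d/2) = (2 / p)^d. *)
Lemma integral_profile_power (p : R) (b g : 'rV[R]_d) (D : R) : 1 <= p -> 0 <= D ->
  (\int[m]_x \int[n]_w
    ((D * (expR (- (qform alpha ((x : 'rV[R]_d) - b) / 2)) *
      expR (- (qform (invmx alpha) ((w : 'rV[R]_d) - (2 *: ((x : 'rV[R]_d) *m beta) + g)) / 8)))) `^ p)%:E =
   (D `^ p * (2 / p) `^ d%:R)%:E)%E.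
Proof.
move=> p1 D0; have p0 : 0 < p by rewrite (lt_le_trans _ p1).
pose J := I ((2 * (4 / p)) *: alpha) / I ((4 / p) *: alpha) ^+ 2.
have s0 : 0 < 4 / p by rewrite divr_gt0.
have J0 : 0 <= J.
  by apply: divr_ge0; [apply/ltW/Ipos; rewrite mulr_gt0|exact: sqr_ge0].
have cq : continuous (fun w => expR (- (qform (invmx alpha) w / (2 * (4 / p))))).
  move=> w; apply: (@continuous_comp _ _ _ (fun w => - (qform (invmx alpha) w / (2 * (4 / p)))) expR).
    apply: continuousN.
    exact: (continuousM (@qform_continuous _ _ _ w) (@cst_continuous _ _ ((2 * (4 / p))^-1 : R) w)).
  exact: continuous_expR.
have mq : measurable_fun [set: borel 'rV[R]_d]
    (fun w => (expR (- (qform (invmx alpha) w / (2 * (4 / p)))))%:E).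
  by apply/measurable_EFinP; exact: borel_continuous_measurable_real.
have ninv := dual_fiber_measure_inv cH nu_haar.
have inner (x : 'rV[R]_d) : (\int[n]_w
    ((D * (expR (- (qform alpha (x - b) / 2)) *
      expR (- (qform (invmx alpha) ((w : 'rV[R]_d) - (2 *: (x *m beta) + g)) / 8)))) `^ p)%:E =
    (D `^ p * J)%:E * (expR (- qform ((p / 2) *: alpha) (x - b)))%:E)%E.
  (* For fixed x the center v of the Gaussian in w is removed by translation. *)
  pose v := 2 *: (x *m beta) + g.
  rewrite (eq_integral (fun w : borel 'rV[R]_d =>
    (D `^ p * expR (- qform ((p / 2) *: alpha) (x - b)))%:E *
    (expR (- (qform (invmx alpha) (- v + (w : 'rV[R]_d)) / (2 * (4 / p)))))%:E)%E); last first.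
    move=> w _; rewrite -EFinM; congr EFin.
    rewrite !powRM ?mulr_ge0 ?expR_ge0// -!expRM -mulrA; congr (_ * (expR _ * expR _)).
      by rewrite qformZmx; field.
    by rewrite (addrC (- v)); field; rewrite gt_eqF.
  have mqv : measurable_fun [set: borel 'rV[R]_d] (fun w =>
      (expR (- (qform (invmx alpha) (- v + (w : 'rV[R]_d)) / (2 * (4 / p)))))%:E).
    apply/measurable_EFinP; apply: (@borel_continuous_measurable_real _ _
      (fun w : 'rV[R]_d => expR (- (qform (invmx alpha) (- v + w) / (2 * (4 / p)))))) => w.
    exact: (continuous_comp (@addl_continuous _ (- v) w) (@cq (- v + w))).
  have qv0 (w : borel 'rV[R]_d) : setT w ->
      (0 <= (expR (- (qform (invmx alpha) (- v + (w : 'rV[R]_d)) / (2 * (4 / p)))))%:E)%E.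
    by move=> _; rewrite lee_fin expR_ge0.
  have k0 : (0 <= (D `^ p * expR (- qform ((p / 2) *: alpha) (x - b)))%:E)%E.
    by rewrite lee_fin mulr_ge0 ?powR_ge0 ?expR_ge0.
  rewrite (@ge0_integralZl _ _ _ _ _ measurableT _ mqv _ qv0 k0).
  rewrite (ge0_integral_shift ninv (- v) mq); last by move=> w; rewrite lee_fin expR_ge0.
  by rewrite dual_gauss_integral// -!EFinM; congr EFin; rewrite -/J; ring.
under eq_integral do rewrite inner.
have pp : 0 < p / 2 by rewrite divr_gt0.
have ppa := posdefZ pp pa.
have mgx : measurable_fun [set: borel 'rV[R]_d] (fun x =>
    (expR (- qform ((p / 2) *: alpha) ((x : 'rV[R]_d) - b)))%:E).
  apply/measurable_EFinP; apply: borel_continuous_measurable_real.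
  exact: gauss_shift_continuous.
have gx0 (x : borel 'rV[R]_d) : setT x ->
    (0 <= (expR (- qform ((p / 2) *: alpha) ((x : 'rV[R]_d) - b)))%:E)%E.
  by move=> _; rewrite lee_fin expR_ge0.
have k0 : (0 <= (D `^ p * J)%:E)%E by rewrite lee_fin mulr_ge0 ?powR_ge0.
rewrite (@ge0_integralZl _ _ _ _ _ measurableT _ mgx _ gx0 k0).
rewrite (integral_gaussE ppa minv mfin) -EFinM -mulrA; congr (_ * _)%:E.
have pinv : 0 < p^-1 by rewrite invr_gt0.
rewrite /J !(gauss_intZ minv mfin pa) ?mulr_gt0//.
have I1 : I alpha != 0 by rewrite -[alpha]scale1r gt_eqF// Ipos.
rewrite /powR !gt_eqF ?mulr_gt0 ?divr_gt0//.
have l2 : 0 < (2 : R) by [].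
have lnd (x : R) : 0 < x -> ln (x / p) = ln x - ln p.
  by move=> x0; rewrite lnM ?posrE// lnV ?posrE.
have ln4 : ln 4 = ln 2 + ln 2 :> R by rewrite -lnM ?posrE// (_ : 2 * 2 = 4 :> R)//; ring.
have ln8 : ln (2 * (4 / p)) = ln 2 + ln 2 + ln 2 - ln p.
  by rewrite lnM ?posrE// lnd// ln4; ring.
have lnp : ln (p / 2) = ln p - ln 2 by rewrite lnM ?posrE ?invr_gt0// lnV ?posrE.
rewrite ln8 lnp !lnd// ln4.
(* The powers of 2 and p are compared through their logarithms. *)
set e := d%:R / 2; set L := ln 2; set P := ln p.
have e2 : expR (d%:R * (L - P)) = expR (- e * (L + L + L - P)) *
    expR (- e * (P - L)) / (expR (- e * (L + L - P))) ^+ 2.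
  rewrite -expRM_natl -expRN -!expRD; congr expR.
  by rewrite /e; field.
rewrite e2.
field.
by rewrite I1 gt_eqF ?expR_gt0.
Qed.

End lieb_equality.

(** * Equality in Lieb's inequalities *)

Theorem proposition7p5 (R : realType) (d : nat) (A0 : topologicalZmodType)
  (A0_lca : lca A0)
  (A0_sub : exists H : zmodClosed A0, compact_open_subgroup H)
  (mu : {measure set (borel (prodg 'rV[R]_d A0)) -> \bar R})
  (nu : {measure set (borel (dual R (prodg 'rV[R]_d A0))) -> \bar R})
  (lam : {measure set (borel (prodg (prodg 'rV[R]_d A0)
                                    (dual R (prodg 'rV[R]_d A0)))) -> \bar R})
  (mu_haar : is_haar mu) (nu_haar : is_haar nu)
  (mu_nu : plancherel mu nu) (lam_prod : is_product_haar mu nu lam)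
  (f1 g1 : 'rV[R]_d -> R[i]) (f2 g2 : A0 -> R[i])
  (fg1 : matched_gaussians f1 g1) (fg2 : matched_subcharacters f2 g2) :
  forall p : R, 1 <= p ->
    cLnorm lam p (stft mu (tensor g1 g2) (tensor f1 f2)) =
    (((2 / p) `^ (d%:R / p))%:E
       * cLnorm mu 2 (tensor f1 f2) * cLnorm mu 2 (tensor g1 g2))%E.
Proof.
move: fg1 fg2 => [alpha [beta [gf gg]]] [c1 [c2 [z1 [z2 [h [_ _ sub -> ->]]]]]] p p1.
have [pa sb _] := gf.
have [k1 [b1 [w1 [t1 ->]]]] := gaussian_chirped gf.
have [k2 [b2 [w2 [t2 ->]]]] := gaussian_chirped gg.
have [H [phi [[cH oH] [cphi _ _] h_char h_out]]] := sub.
case: z1 => a1 eta1; case: z2 => a2 eta2.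
have p0 : 0 < p by rewrite (lt_le_trans _ p1).
have hausG : hausdorff_space (prodg 'rV[R]_d A0).
  by apply: prodg_hausdorff; [exact: norm_hausdorff|exact: A0_lca.1].
pose label := stft_label eta1 eta2 phi.
(* The label differs from phi by the constant character [e]. *)
have label_continuous : continuous label.
  pose e := restrict_dual H eta1 - restrict_dual H eta2.
  rewrite (_ : label = (fun k => e + phi k)); last first.
    by apply/funext => k; rewrite /label /stft_label -addrA addrC.
  by move=> k; exact: (continuous_comp (cphi k) (@addl_continuous _ e (phi k))).
have label_finite := compact_dual_range_finite cH label_continuous.
have label_open chi := compact_dual_fiber_open chi cH label_continuous.
pose D := stft_height oH mu alpha k1 k2 c1 c2.
have [mu_inv mu_fin] : (forall (x : prodg 'rV[R]_d A0) (E : set (borel (prodg 'rV[R]_d A0))),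
    measurable E -> mu [set x + y | y in (E : set (prodg 'rV[R]_d A0))] = mu E) /\
    (forall K : set (prodg 'rV[R]_d A0), compact K -> (mu K < +oo)%E).
  by case: mu_haar => _ ? ? _ _.
have minv := fiber_measure_inv oH mu_inv.
have mfin := fiber_measure_fin oH mu_fin cH.
have m0 := fiber_measure_neq0 oH mu_haar hausG.
have I2 : 0 <= gauss_int (fiber_measure oH mu 0) (2 *: alpha).
  by rewrite ltW// (gauss_int_gt0 minv mfin (posdefZ (ltr0Sn R 1) pa)).
have D0 : 0 <= D by rewrite !mulr_ge0 ?expR_ge0 ?normc_ge0.
pose prof := stft_profile alpha beta b1 b2 w1 w2.
(* The p-th power of the modulus on the region, in the coordinates (x, w). *)
pose F (xw : borel 'rV[R]_d * borel 'rV[R]_d) : \bar R := ((D * prof xw.1 xw.2) `^ p)%:E.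
have intE : (\int[lam]_w ((Normc.normc (stft mu
    (tensor (chirped alpha beta k2 b2 w2 t2) (fun y => c2 * tf_shift (a2, eta2) h y))
    (tensor (chirped alpha beta k1 b1 w1 t1) (fun y => c1 * tf_shift (a1, eta1) h y)) w)) `^ p)%:E =
    (D `^ p * (2 / p) `^ d%:R)%:E)%E.
  transitivity (\int[lam]_(w in graph_region (d := d) (a1 - a2)%R label)
      F ((w : prodg _ _).1.1, freq (w : prodg _ _).2))%E.
    rewrite [RHS]integral_mkcond; apply: eq_integral => w _.
    rewrite patchE (normc_stft oH cH mu_haar pa sb k1 k2 b1 b2 w1 w2 t1 t2 c1 c2 a1 a2 eta1 eta2 h_char h_out).
    by case: ifP => // _; rewrite powR0// gt_eqF.
  have mp : measurable_fun setT ((fun w : prodg (prodg 'rV[R]_d A0) (dual R (prodg 'rV[R]_d A0)) => w.1.1)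
      : borel _ -> borel 'rV[R]_d).
    apply: borel_continuous_measurable => w.
    exact: (continuous_comp (@prodg_fst_continuous _ _ w) (@prodg_fst_continuous _ _ w.1)).
  have mq : measurable_fun setT ((fun w : prodg (prodg 'rV[R]_d A0) (dual R (prodg 'rV[R]_d A0)) => freq w.2)
      : borel _ -> borel 'rV[R]_d).
    apply: borel_continuous_measurable => w.
    exact: (continuous_comp (@prodg_snd_continuous _ _ w) (@freq_continuous R d A0 w.2)).
  have mcoord j : measurable_fun setT ((fun x : 'rV[R]_d => x ord0 j) : borel 'rV[R]_d -> R).
    by apply: borel_continuous_measurable_real; exact: coord_continuous.
  have mF : measurable_fun setT F.
    apply/measurable_EFinP.
    apply: (measurableT_comp (measurable_powR p)).
    apply: measurable_funM => //; apply: measurable_funM.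
    - apply: (measurableT_comp (@measurable_expR R)).
      apply: measurable_funN; apply: measurable_funM => //.
      apply: measurable_qform => j.
      rewrite (_ : (fun _ => _) = (fun xw : borel 'rV[R]_d * borel 'rV[R]_d =>
        (xw.1 : 'rV[R]_d) ord0 j - (b1 - b2) ord0 j)); last by apply/funext => xw; rewrite !mxE.
      by apply: measurable_funB => //; exact: (measurableT_comp (mcoord j)).
    - apply: (measurableT_comp (@measurable_expR R)).
      apply: measurable_funN; apply: measurable_funM => //.
      apply: measurable_qform => j.
      rewrite (_ : (fun _ => _) = (fun xw : borel 'rV[R]_d * borel 'rV[R]_d =>
        (xw.2 : 'rV[R]_d) ord0 j -
        (2 * dot (row j beta^T) (xw.1 : 'rV[R]_d) + (w1 - w2) ord0 j))); last first.
        apply/funext => xw; rewrite !mxE; congr (_ - (2 * _ + _)).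
        by rewrite dotE; apply: eq_bigr => i _; rewrite !mxE mulrC.
      apply: measurable_funB; first exact: (measurableT_comp (mcoord j)).
      apply: measurable_funD => //; apply: measurable_funM => //.
      have md : measurable_fun setT (dot (row j beta^T) : borel 'rV[R]_d -> R).
        by apply: borel_continuous_measurable_real; exact: dot_continuous.
      exact: (measurableT_comp md).
  have F0 z : (0 <= F z)%E by rewrite lee_fin powR_ge0.
  have cq2 : continuous (fun w : 'rV[R]_d => qform (invmx alpha) w / (2 * 1)).
    move=> w; exact: (continuousM (@qform_continuous _ _ _ w) (@cst_continuous _ _ ((2 * 1)^-1 : R) w)).
  have fin1 (r : R) : (fiber_measure oH mu 0%R [set x | (qform alpha x < r)%R] < +oo)%E.
    apply: sublevel_finite; first exact: qform_continuous.
    exact: gaussian_finite.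
  (* The factor 2 * 1 is that of the Plancherel identity at s = 1. *)
  have fin2 (r : R) : (dual_fiber_measure cH nu 0%R
      [set w | (qform (invmx alpha) w / (2 * 1) < r)%R] < +oo)%E.
    apply: sublevel_finite; first exact: cq2.
    by rewrite (dual_gauss_integral oH cH mu_haar mu_nu hausG pa ltr01) ltry.
  have mO := @graph_region_measurable R d A0 H oH cH (a1 - a2)%R label label_open.
  rewrite (@integral_pair_fubini _ _ _ _ _ _ _ (@qform_continuous _ _ alpha) cq2 fin1 fin2
    _ _ lam _ _ _ F mO mp mq _ mF F0).
    by rewrite -(integral_profile_power oH cH mu_haar nu_haar mu_nu hausG pa beta (b1 - b2) (w1 - w2) p1 D0).
  move=> U V oU oV.
  exact: (lam_graph_region oH cH mu_haar nu_haar mu_nu lam_prod hausG (a1 - a2) label_finite label_open oU oV).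
rewrite cLnormE intE.
rewrite !(cLnorm_tensor oH cH mu_haar hausG pa beta h_char h_out).
rewrite poweR_EFin powRM ?powR_ge0// -!powRrM mulfV ?gt_eqF// powRr1// -!EFinM; congr EFin.
set I := gauss_int _ _ in I2 *.
have half : (2^-1 + 2^-1 : R) = 1 by field.
(* The height of the transform contains I = I (2 alpha), of which each of the two
   L^2 norms provides a square root. *)
have I_half : I = I `^ 2^-1 * I `^ 2^-1.
  by rewrite -powRD half ?powRr1// oner_eq0.
rewrite /D /stft_height expRD -/I {1}I_half.
ring.
Qed.
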